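(* Let $G^{(5)}_{24}\simeq S_3\times \mathbb Z/4$ be a maximal subgroup of order $24$ of the umbral group $G^{(5)}$ attached to the Niemeier root system $A_4^{\oplus 6}$, let $W^{(5)}_{\mathrm{tw}}=A(\mathfrak e)_{\mathrm{tw}}\otimes A(\mathfrak a)_{\mathrm{tw}}\otimes A(\mathfrak a')_{\mathrm{tw}}\otimes \underline{A}(\mathfrak b)_{\mathrm{tw}}$ (with $\mathfrak e,\mathfrak a,\mathfrak a'$ all $2$-dimensional and $\dim\mathfrak b=6$) be the canonically twisted module, equipped with the action of $G^{(5)}_{24}$ and the operators $J_{\mathfrak e}(0)$, $(-1)^F$, $J(0)$, $L(0)$, specified in the context. For $g\in G^{(5)}_{24}$ define the formal series $$\widetilde\psi^{(5)}_g:=-\mathrm{tr}\left((g+g^{-1})\,J_{\mathfrak e}(0)\,(-1)^F\,y^{J(0)}q^{L(0)}\,\middle|\,W^{(5)}_{\mathrm{tw}}\right).$$ Then for every $g\in G^{(5)}_{24}$ the series $\widetilde\psi^{(5)}_g$ is the expansion of the meromorphic Jacobi form $\psi^{(5)}_g$ in the domain $0<-\mathrm{Im}(z)<\mathrm{Im}(\tau)$; that is, after the substitution $q=e^{2\pi i\tau}$, $y=e^{2\pi i z}$ the series converges to $\psi^{(5)}_g(\tau,z)$ for all $\tau\in\mathbb H$, $z\in\mathbb C$ with $0<-\mathrm{Im}(z)<\mathrm{Im}(\tau)$.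
   Context: **Clifford modules.** Let $\mathfrak a$ be a complex vector space of finite even dimension $d$ with a non-degenerate symmetric bilinear form $\langle\cdot,\cdot\rangle$ and a polarization $\mathfrak a=\mathfrak a^+\oplus\mathfrak a^-$ (both summands isotropic). For a space $\mathfrak u$ with symmetric form, $\mathrm{Cliff}(\mathfrak u)=T(\mathfrak u)/(u\otimes u'+u'\otimes u-\langle u,u'\rangle\mathbf 1)$. For $r\in\frac12\mathbb Z$ let $\mathfrak a(r)=\{a(r)\mid a\in\mathfrak a\}$ be a copy of $\mathfrak a$; put $\hat{\mathfrak a}=\bigoplus_{n\in\mathbb Z}\mathfrak a(n+\frac12)$, $\hat{\mathfrak a}_{\mathrm{tw}}=\bigoplus_{n\in\mathbb Z}\mathfrak a(n)$, with $\langle a(r),a'(r')\rangle=\langle a,a'\rangle\delta_{r+r',0}$. Put $\hat{\mathfrak a}^+=\bigoplus_{n\ge0}\mathfrak a(n+\frac12)$ and $\hat{\mathfrak a}_{\mathrm{tw}}^+=\mathfrak a^+(0)\oplus\bigoplus_{n>0}\mathfrak a(n)$. Then $A(\mathfrak a)=\mathrm{Cliff}(\hat{\mathfrak a})\otimes_{\langle\hat{\mathfrak a}^+\rangle}\mathbb C\mathbf v$ and $A(\mathfrak a)_{\mathrm{tw}}=\mathrm{Cliff}(\hat{\mathfrak a}_{\mathrm{tw}})\otimes_{\langle\hat{\mathfrak a}_{\mathrm{tw}}^+\rangle}\mathbb C\mathbf v_{\mathrm{tw}}$, where $\langle\cdot\rangle$ denotes the unital subalgebra generated, and $\hat{\mathfrak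 a}^+\mathbf v=0$, $\hat{\mathfrak a}_{\mathrm{tw}}^+\mathbf v_{\mathrm{tw}}=0$. $A(\mathfrak a)$ has the unique super vertex algebra structure with vacuum $\mathbf v$ and $Y(a(-\frac12)\mathbf v,z)=\sum_{n\in\mathbb Z}a(n+\frac12)z^{-n-1}$, and $A(\mathfrak a)_{\mathrm{tw}}$ has the unique canonically twisted $A(\mathfrak a)$-module structure with $Y_{\mathrm{tw}}(a(-\frac12)\mathbf v,z)=\sum_{n\in\mathbb Z}a(n)z^{-n-\frac12}$. With bases $\{a_i^\pm\}$ of $\mathfrak a^\pm$ such that $\langle a_i^\mp,a_j^\pm\rangle=\delta_{ij}$, put $\omega=\frac12\sum_i(a_i^+(-\frac32)a_i^-(-\frac12)-a_i^+(-\frac12)a_i^-(-\frac32))\mathbf v$ (Virasoro element, $c=\frac d2$) and $\jmath=\sum_i a_i^+(-\frac12)a_i^-(-\frac12)\mathbf v$. Writing $J(0)$ for the coefficient of $z^{-1}$ in $Y_{\mathrm{tw}}(\jmath,z)$ and $L(0)$ for that of $z^{-2}$ in $Y_{\mathrm{tw}}(\omega,z)$, $$\mathrm{tr}(y^{J(0)}q^{L(0)-c/24}|A(\mathfrak a)_{\mathrm{tw}})=y^{d/4}q^{d/24}\prod_{n>0}(1+y^{-1}q^{n-1})^{d/2}(1+yq^n)^{d/2}.$$ **Weyl modules.** Let $\mathfrak b$ be a complex vector space of finite even dimension $d$ with a non-degenerate anti-symmetric form $\langle\!\langle\cdot,\cdot\rangle\!\rangle$ and polarization $\mathfrak b=\mathfrak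 b^+\oplus\mathfrak b^-$. Replace the Clifford algebra by the Weyl algebra $T(\mathfrak u)/(u\otimes u'-u'\otimes u-\langle\!\langle u,u'\rangle\!\rangle\mathbf 1)$ and repeat the construction verbatim (same index sets, $\hat{\mathfrak b}^+=\bigoplus_{n\ge0}\mathfrak b(n+\frac12)$, $\hat{\mathfrak b}_{\mathrm{tw}}^+=\mathfrak b^+(0)\oplus\bigoplus_{n>0}\mathfrak b(n)$, same formulas for $Y$ and $Y_{\mathrm{tw}}$ on generators) to get a super vertex algebra $\underline A(\mathfrak b)$ and canonically twisted module $\underline A(\mathfrak b)_{\mathrm{tw}}$. With bases such that $\langle\!\langle b_i^\mp,b_j^\pm\rangle\!\rangle=\pm\delta_{ij}$, put $\omega=\frac12\sum_i(b_i^+(-\frac32)b_i^-(-\frac12)-b_i^+(-\frac12)b_i^-(-\frac32))\mathbf v$ ($c=-\frac d2$) and $\jmath=\sum_ib_i^+(-\frac12)b_i^-(-\frac12)\mathbf v$; then $$\mathrm{tr}(y^{J(0)}q^{L(0)-c/24}|\underline A(\mathfrak b)_{\mathrm{tw}})=y^{-d/4}q^{-d/24}\prod_{n>0}(1-y^{-1}q^{n-1})^{-d/2}(1-yq^n)^{-d/2},$$ with $(1-X)^{-1}=\sum_{k\ge0}X^k$. **Group actions.** $g\in\mathrm{GL}(\mathfrak a^+)$ acts on $\mathfrak a=\mathfrak a^+\oplus\mathfrak a^-$ as $(g,g')$, where $g'\in\mathrm{GL}(\mathfrak a^-)$ is determined by $\langle ga,g'a'\rangle=\langle a,a'\rangle$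 for $a\in\mathfrak a^+,a'\in\mathfrak a^-$, and on $A(\mathfrak a)$ and $A(\mathfrak a)_{\mathrm{tw}}$ by $g\cdot a_1(r_1)\cdots a_n(r_n)\mathbf v=(ga_1)(r_1)\cdots(ga_n)(r_n)\mathbf v$ (resp. with $\mathbf v_{\mathrm{tw}}$). Similarly $\mathrm{GL}(\mathfrak b^+)$ acts on $\underline A(\mathfrak b)$, $\underline A(\mathfrak b)_{\mathrm{tw}}$. **The case $\ell=5$.** Let $\mathfrak e,\mathfrak a,\mathfrak a'$ be $2$-dimensional with non-degenerate symmetric forms and $\mathfrak b$ $6$-dimensional with a non-degenerate anti-symmetric form, all with fixed polarizations. Set $W^{(5)}=A(\mathfrak e)\otimes A(\mathfrak a)\otimes A(\mathfrak a')\otimes\underline A(\mathfrak b)$, $W^{(5)}_{\mathrm{tw}}=A(\mathfrak e)_{\mathrm{tw}}\otimes A(\mathfrak a)_{\mathrm{tw}}\otimes A(\mathfrak a')_{\mathrm{tw}}\otimes\underline A(\mathfrak b)_{\mathrm{tw}}$; let $\omega^{(5)}$ be the tensor product Virasoro element (sum of the $\omega$'s of the four factors), $\jmath_{\mathfrak e}=\jmath\otimes\mathbf v\otimes\mathbf v\otimes\mathbf v$, and $\jmath^{(5)}=2\,\mathbf v\otimes\jmath\otimes\mathbf v\otimes\mathbf v+3\,\mathbf v\otimes\mathbf v\otimes\jmath\otimes\mathbf v+\mathbf v\otimes\mathbf v\otimes\mathbf v\otimes\jmath$. On $W^{(5)}_{\mathrm{tw}}$: $J_{\mathfrak e}(0)$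 and $J(0)$ are the coefficients of $z^{-1}$ in $Y_{\mathrm{tw}}(\jmath_{\mathfrak e},z)$ and $Y_{\mathrm{tw}}(\jmath^{(5)},z)$, $L(0)$ is the coefficient of $z^{-2}$ in $Y_{\mathrm{tw}}(\omega^{(5)},z)$, and $(-1)^F=(-I)\otimes(-I)\otimes(-I)\otimes I\in\mathrm{GL}(\mathfrak e^+)\otimes\mathrm{GL}(\mathfrak a^+)\otimes\mathrm{GL}(\mathfrak a'^+)\otimes\mathrm{GL}(\mathfrak b^+)$. **Group.** $G^{(5)}=\mathrm{Aut}(N)/\mathrm{Inn}(N)\simeq\mathrm{GL}_2(5)/2$, where $N$ is the Niemeier lattice with root system $A_4^{\oplus6}$ and $\mathrm{Inn}(N)$ is generated by reflections in roots. There is a unique conjugacy class of maximal subgroups of $G^{(5)}$ of order $24$; $G^{(5)}_{24}$ is one of these, and $G^{(5)}_{24}\simeq S_3\times\langle c\rangle$ with $c$ of order $4$. Let $s\in S_3$ be a transposition and $r\in S_3$ a $3$-cycle. The classes of $G^{(5)}_{24}$ are: 1A $\ni 1$; 2A $\ni c^2$; 4A $\ni c$; 4B $\ni c^{-1}$; 2B $\ni s$; 2C $\ni sc^2$; 4C $\ni sc$; 4D $\ni sc^{-1}$; 3A $\ni r$; 6A $\ni rc^2$; 12A $\ni rc$; 12B $\ni rc^{-1}$. In $G^{(5)}$ the classes 4C and 4D of $G^{(5)}_{24}$ fuse into the classes 4A and 4B respectively, and every other class lies in the class of $G^{(5)}$ of the same name. Let $\varrho:G^{(5)}_{24}\to\mathrm{GL}(\mathfrak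 a^+)$, $\varrho':G^{(5)}_{24}\to\mathrm{GL}(\mathfrak a'^+)$ and $\underline\varrho:G^{(5)}_{24}\to\mathrm{GL}(\mathfrak b^+)$ be homomorphisms with characters $\chi_2$, $\chi_3$ and $\chi_7+\chi_{12}$ respectively, where for $\sigma\in S_3$: $\chi_2(\sigma c^k)=(-1)^k$, $\chi_3(\sigma c^k)=i^k$, $\chi_7(\sigma c^k)=\mathrm{sgn}(\sigma)i^k$, and $\chi_{12}(\sigma c^k)=\chi_{\mathrm{std}}(\sigma)(-i)^k$ with $\chi_{\mathrm{std}}$ the character of the $2$-dimensional irreducible representation of $S_3$. An element $g\in G^{(5)}_{24}$ acts on $W^{(5)}$ and $W^{(5)}_{\mathrm{tw}}$ as $I\otimes\varrho(g)\otimes\varrho'(g)\otimes\underline\varrho(g)$. **The functions $\psi^{(5)}_g$.** With $q=e^{2\pi i\tau}$, $y=e^{2\pi iz}$: $\eta(\tau)=q^{1/24}\prod_{n>0}(1-q^n)$, $\theta_1(\tau,z)=-iq^{1/8}y^{1/2}\prod_{n>0}(1-y^{-1}q^{n-1})(1-yq^n)(1-q^n)$, $\theta_2(\tau,z)=q^{1/8}y^{1/2}\prod_{n>0}(1+y^{-1}q^{n-1})(1+yq^n)(1-q^n)$ (where $y^{1/2}=e^{\pi i z}$). For $g\in G^{(5)}_{24}$ the meromorphic Jacobi form $\psi^{(5)}_g$ of umbral moonshine is given, according to the class of $g$ in $G^{(5)}$, by: - 1A: $2i\,\eta(\tau)^3\theta_1(\tau,2z)\theta_1(\tau,3z)/\theta_1(\tau,z)^3$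 - 2A: $-2i\,\eta(\tau)^3\theta_1(\tau,2z)\theta_2(\tau,3z)/\theta_2(\tau,z)^3$ - 2B: $-2i\,\frac{\eta(\tau)^3\theta_1(\tau,2z)\theta_1(\tau,3z)}{\theta_1(\tau,z)\theta_2(\tau,z)^2}$ - 2C: $2i\,\frac{\eta(\tau)^3\theta_1(\tau,2z)\theta_2(\tau,3z)}{\theta_1(\tau,z)^2\theta_2(\tau,z)}$ - 3A: $-2i\,\eta(3\tau)\theta_1(\tau,2z)\theta_1(\tau,3z)/\theta_1(3\tau,3z)$ - 6A: $-2i\,\eta(3\tau)\theta_1(\tau,2z)\theta_2(\tau,3z)/\theta_2(3\tau,3z)$ - 4A, 4B: $-i\frac{\eta(2\tau)^2\theta_2(\tau,2z)}{\eta(\tau)\theta_2(2\tau,2z)^2}\left(\theta_1(\tau,z+\frac14)\theta_1(\tau,3z+\frac14)-\theta_1(\tau,z-\frac14)\theta_1(\tau,3z-\frac14)\right)$ - 12A, 12B: $i\frac{\eta(6\tau)\theta_2(\tau,2z)}{\eta(\tau)^3\theta_2(6\tau,6z)}\big(\theta_1(\tau,z+\frac1{12})\theta_1(\tau,z+\frac14)\theta_1(\tau,z+\frac5{12})\theta_1(\tau,3z-\frac14)-\theta_1(\tau,z-\frac1{12})\theta_1(\tau,z-\frac14)\theta_1(\tau,z-\frac5{12})\theta_1(\tau,3z+\frac14)\big)$ *)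

(* Defs.v *)
From HB Require Import structures.
From mathcomp Require Import all_boot all_order all_algebra.
From mathcomp Require Import all_fingroup all_solvable all_character.
From mathcomp Require Import complex finmap.
From mathcomp Require Import all_classical all_reals all_analysis.
(* The notations of monalg clash with those of MathComp-Analysis. *)
From mathcomp Require Import -(notations) monalg.

Set Implicit Arguments.
Unset Strict Implicit.
Unset Printing Implicit Defensive.

Import Order.TTheory GRing.Theory Num.Theory.
Import numFieldNormedType.Exports.

Local Open Scope classical_set_scope.
Local Open Scope ring_scope.
Local Open Scope quotient_scope.

Section LinearQuotient.
Variables (K : fieldType) (F : lmodType K) (rel : set F).

Definition lspan : {pred F} := [pred x | `[< forall U : set F,
  U 0 -> (forall k y z, U y -> U z -> U (k *: y + z)) -> rel `<=` U -> U x >]].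

Lemma lspanP x : reflect (forall U : set F,
  U 0 -> (forall k y z, U y -> U z -> U (k *: y + z)) -> rel `<=` U -> U x)
  (x \in lspan).
Proof. by rewrite unfold_in; apply: asboolP. Qed.

Lemma lspan_rel x : rel x -> x \in lspan.
Proof. by move=> rx; apply/lspanP => U _ _ relU; exact: relU. Qed.

Lemma lspan_linear k x y : x \in lspan -> y \in lspan -> k *: x + y \in lspan.
Proof.
move=> /lspanP hx /lspanP hy; apply/lspanP => U U0 UL UR.
exact: UL (hx U U0 UL UR) (hy U U0 UL UR).
Qed.

Lemma lspan0 : 0 \in lspan.
Proof. by apply/lspanP => U U0. Qed.

Lemma lspanZ k x : x \in lspan -> k *: x \in lspan.
Proof. by move=> hx; rewrite -[_ *: _]addr0 lspan_linear // lspan0. Qed.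

Lemma lspan_zmod : zmod_closed lspan.
Proof.
split=> [|x y hx hy]; first exact: lspan0.
by rewrite addrC -scaleN1r lspan_linear.
Qed.
HB.instance Definition _ := GRing.isZmodClosed.Build F lspan lspan_zmod.

Definition lquot := Quotient.quot lspan.
HB.instance Definition _ := Choice.on lquot.
HB.instance Definition _ := GRing.Zmodule.on lquot.

Definition lpi (x : F) : lquot := \pi_(Quotient.quot lspan) x.
Definition lrepr (u : lquot) : F :=
  generic_quotient.repr (u : Quotient.quot lspan).

Lemma lreprK u : lpi (lrepr u) = u.
Proof. exact: (@reprK _ (Quotient.quot lspan)). Qed.

Lemma lpi_eq x y : lpi x = lpi y <-> x - y \in lspan.
Proof.
by split=> [|h]; [move/eqP | apply/eqP]; rewrite /lpi -Quotient.idealrBE.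
Qed.

Lemma lrepr_lpi x : x - lrepr (lpi x) \in lspan.
Proof. by apply/lpi_eq; rewrite lreprK. Qed.

Lemma lpiD x y : lpi (x + y) = lpi x + lpi y.
Proof. exact: (raddfD (\pi_(Quotient.quot lspan))). Qed.

Definition lscale (k : K) (u : lquot) : lquot := lpi (k *: lrepr u).

Lemma lpiZ k x : lpi (k *: x) = lscale k (lpi x).
Proof. by apply/lpi_eq; rewrite -scalerBr lspanZ // lrepr_lpi. Qed.

Lemma lscaleA a b u : lscale a (lscale b u) = lscale (a * b) u.
Proof. by rewrite -[u]lreprK -!lpiZ scalerA. Qed.

Lemma lscale1 : left_id 1 lscale.
Proof. by move=> u; rewrite -[u in LHS]lreprK -lpiZ scale1r lreprK. Qed.

Lemma lscaleDr : right_distributive lscale +%R.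
Proof.
by move=> a u v; rewrite -[u]lreprK -[v]lreprK -lpiD -!lpiZ scalerDr lpiD.
Qed.

Lemma lscaleDl u : {morph lscale^~ u : a b / a + b}.
Proof. by move=> a b; rewrite -[u]lreprK -!lpiZ scalerDl lpiD. Qed.

HB.instance Definition _ := GRing.Zmodule_isLmodule.Build K lquot
  lscaleA lscale1 lscaleDr lscaleDl.

Lemma lpi_linear : linear lpi.
Proof. by move=> k x y; rewrite lpiD lpiZ. Qed.
HB.instance Definition _ := GRing.isLinear.Build K F lquot _ lpi lpi_linear.

Lemma lpi_rel y : rel y -> lpi y = 0.
Proof.
by move=> ry; rewrite -(linear0 lpi); apply/lpi_eq; rewrite subr0 lspan_rel.
Qed.

(** A linear map that kills the relations descends to the quotient, as
    [f \o lrepr]. *)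
Lemma lift_lpi (U : lmodType K) (f : F -> U) (x : F) :
  linear f -> (forall y, rel y -> f y = 0) -> f (lrepr (lpi x)) = f x.
Proof.
move=> fL fR; have fB y z : f (y - z) = f y - f z.
  by rewrite addrC -scaleN1r fL scaleN1r addrC.
have /lspanP/(_ [set y | f y = 0]) h := lrepr_lpi x.
apply/eqP; rewrite eq_sym -subr_eq0 -fB; apply/eqP/h => //=.
- by rewrite -[0 in LHS](subrr (0 : F)) fB subrr.
- by move=> k y z fy fz; rewrite fL fy fz scaler0 addr0.
Qed.

End LinearQuotient.

Section FreeModule.
Variables (K : fieldType) (X : choiceType) (U : lmodType K) (h : X -> U).

(** The linear extension of [h] to the free module on [X]. *)
Definition free_lift (f : malg X K) : U := \sum_(k <- msupp f) mcoeff k f *: h k.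

Lemma free_liftw (D : {fset X}) f : (msupp f `<=` D)%fset ->
  free_lift f = \sum_(k <- D) mcoeff k f *: h k.
Proof.
move=> sfD; rewrite /free_lift (big_fset_incl _ sfD) //= => k _ kf.
by rewrite mcoeff_outdom // scale0r.
Qed.

Lemma free_lift_linear : linear free_lift.
Proof.
move=> k f g; pose D := (msupp f `|` msupp g `|` msupp (k *: f + g))%fset.
have sD : [/\ (msupp f `<=` D)%fset, (msupp g `<=` D)%fset
    & (msupp (k *: f + g) `<=` D)%fset].
  by split; apply/fsubsetP => x xf; rewrite !inE xf ?orbT.
have [sf sg sh] := sD; rewrite (free_liftw sf) (free_liftw sg) (free_liftw sh).
rewrite scaler_sumr -big_split; apply: eq_bigr => x _ /=.
by rewrite mcoeffD mcoeffZ scalerDl scalerA.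
Qed.
HB.instance Definition _ := GRing.isLinear.Build K (malg X K) U _ free_lift
  free_lift_linear.

Lemma free_liftU k : free_lift (mkmalgU k 1) = h k.
Proof.
rewrite (@free_liftw [fset k]%fset) ?msuppU_le //.
by rewrite big_seq_fset1 mcoeffUU scale1r.
Qed.

Lemma malg_ext (f g : malg X K -> U) : linear f -> linear g ->
  (forall k, f (mkmalgU k 1) = g (mkmalgU k 1)) -> f =1 g.
Proof.
move=> fL gL fg x.
pose f' : {linear malg X K -> U} :=
  HB.pack f (GRing.isLinear.Build K (malg X K) U _ f fL).
pose g' : {linear malg X K -> U} :=
  HB.pack g (GRing.isLinear.Build K (malg X K) U _ g gL).
have E : x = \sum_(k <- msupp x) mcoeff k x *: mkmalgU k 1.
  rewrite [LHS]monalgE; apply: eq_bigr => k _.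
  by apply/malgP => w; rewrite mcoeffZ !mcoeffU mulr_natr.
rewrite -[LHS]/(f' x) -[RHS]/(g' x) E !linear_sum.
by apply: eq_bigr => k _; rewrite !linearZ /= fg.
Qed.

End FreeModule.

Section TensorProduct.
Variables (K : fieldType) (V W : lmodType K).

Definition pure (v : V) (w : W) : malg (V * W)%type K := mkmalgU (v, w) 1.

Inductive bilinear_rel : set (malg (V * W)%type K) :=
| Bilinear_l k v v' w :
    bilinear_rel (pure (k *: v + v') w - k *: pure v w - pure v' w)
| Bilinear_r k v w w' :
    bilinear_rel (pure v (k *: w + w') - k *: pure v w - pure v w').

Definition tensor := lquot bilinear_rel.
HB.instance Definition _ := GRing.Lmodule.on tensor.

Definition tmul (v : V) (w : W) : tensor := lpi bilinear_rel (pure v w).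

(** The linear map induced by a bilinear map [h]. *)
Definition tlift (U : lmodType K) (h : V -> W -> U) (t : tensor) : U :=
  free_lift (fun p => h p.1 p.2) (lrepr t).

Lemma tliftE (U : lmodType K) (h : V -> W -> U) v w :
  (forall w, linear (h^~ w)) -> (forall v, linear (h v)) ->
  tlift h (tmul v w) = h v w.
Proof.
move=> hl hr; rewrite /tlift lift_lpi ?free_liftU//.
  exact: free_lift_linear.
move=> y [k v1 v2 u|k u w1 w2]; rewrite !linearB linearZ/= !free_liftU/=.
  by rewrite hl addrAC addrK subrr.
by rewrite hr addrAC addrK subrr.
Qed.

End TensorProduct.

Arguments tensor {K} V W.

Definition tmap (K : fieldType) (V W V' W' : lmodType K)
    (f : V -> V') (g : W -> W') : tensor V W -> tensor V' W' :=
  tlift (fun v w => tmul (f v) (g w)).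

(** [p] is the parity of the generators of the algebra attached to the space:
    [p = true] is the symmetric (Clifford) case and [p = false] the
    anti-symmetric (Weyl) case. *)
Record polarized_space (K : fieldType) (p : bool) := PolarizedSpace {
  ps_space :> vectType K;
  ps_form : ps_space -> ps_space -> K;
  ps_plus : {vspace ps_space};
  ps_minus : {vspace ps_space};
  ps_form_linear : forall k a a' b,
    ps_form (k *: a + a') b = k * ps_form a b + ps_form a' b;
  ps_form_sym : forall a b, ps_form b a = - (-1) ^+ p * ps_form a b;
  ps_form_nondegenerate : forall a, (forall b, ps_form a b = 0) -> a = 0;
  ps_full : (ps_plus + ps_minus = fullv)%VS;
  ps_direct : (ps_plus :&: ps_minus = 0)%VS;
  ps_plus_isotropic : {in ps_plus &, forall a b, ps_form a b = 0};
  ps_minus_isotropic : {in ps_minus &, forall a b, ps_form a b = 0} }.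

Lemma commutator_morph (K : fieldType) (U : lalgType K) (h : U -> U)
    u v u' v' k l :
  (forall x y, h (x - y) = h x - h y) -> (forall k x, h (k *: x) = k *: h x) ->
  (forall x y, h (x * y) = h x * h y) -> h 1 = 1 -> h u = u' -> h v = v' ->
  h (u * v - k *: (v * u) - l *: 1) = u' * v' - k *: (v' * u') - l *: 1.
Proof. by move=> hB hZ hM h1 <- <-; rewrite !hB !hZ h1 !hM. Qed.

Section Fock.
Variables (K : fieldType) (p : bool) (P : polarized_space K p).

Local Notation free_algebra := (malg (fmonom (P * int)%type) K).

Definition fgen (a : P) (n : int) : free_algebra := mkmalgU (fmu (a, n)) 1.

Variable tw : bool.

(** [fgen a n] stands for [a(mode_index n)]. *)
Definition mode_index (n : int) : rat := if tw then n%:~R else n%:~R + 1 / 2.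

Definition annihilates (a : P) (n : int) : bool :=
  if tw then (0 < n) || (n == 0) && (a \in ps_plus P) else 0 <= n.

(** The tensor algebra of the affinization is the free algebra on the symbols
    [a(r)] modulo [Fock_linear]; [Fock_commutator] gives the Clifford or Weyl
    algebra; since the positive part kills the vacuum, inducing from the
    subalgebra it generates amounts to dividing by the left ideal
    [Fock_vacuum]. *)
Inductive fock_rel : set free_algebra :=
| Fock_linear (x y : free_algebra) k a b n :
    fock_rel (x * (fgen (k *: a + b) n - k *: fgen a n - fgen b n) * y)
| Fock_commutator (x y : free_algebra) a b m n :
    fock_rel (x * (fgen a m * fgen b n - (-1) ^+ p *: (fgen b n * fgen a m)
      - (if mode_index m + mode_index n == 0 then ps_form a b else 0) *: 1) * y)
| Fock_vacuum (x : free_algebra) a n :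
    annihilates a n -> fock_rel (x * fgen a n).

(** [A(a)] for [tw = false] and [A(a)_tw] for [tw = true]. *)
Definition fock := lquot fock_rel.
HB.instance Definition _ := GRing.Lmodule.on fock.

Definition vacuum : fock := lpi fock_rel 1.

(** The action of [a(mode_index n)]. *)
Definition mode (a : P) (n : int) (u : fock) : fock :=
  lpi fock_rel (fgen a n * lrepr u).

(** [a_1(mode_index n_1) ... a_k(mode_index n_k) v] *)
Definition word (s : seq (P * int)) : fock :=
  foldr (fun l => mode l.1 l.2) vacuum s.

Lemma free_mulZr (x y : free_algebra) k : x * (k *: y) = k *: (x * y).
Proof.
rewrite -mul_malgC mulrA; have -> : x * mkmalgU monalg.one k = k *: x.
  rewrite malgM_def malgZ_def fgmulgU; apply: eq_bigr => w _.
  by rewrite mulm1 mulrC.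
by rewrite -scalerAl.
Qed.

Lemma free_mull_linear (x : free_algebra) : linear ( *%R x).
Proof. by move=> k y z; rewrite mulrDr free_mulZr. Qed.

Lemma modeE a n x : mode a n (lpi fock_rel x) = lpi fock_rel (fgen a n * x).
Proof.
apply: (@lift_lpi _ _ fock_rel fock (fun y => lpi fock_rel (fgen a n * y))).
  by move=> k y z; rewrite free_mull_linear lpi_linear.
move=> y hy; apply: lpi_rel.
case: hy => [x1 y1 k b c m|x1 y1 b c m m'|x1 b m bm]; rewrite !mulrA.
- exact: Fock_linear.
- exact: Fock_commutator.
- exact: Fock_vacuum.
Qed.

Definition free_word (s : seq (P * int)) : free_algebra :=
  \prod_(l <- s) fgen l.1 l.2.

Lemma wordE s : word s = lpi fock_rel (free_word s).
Proof.
elim: s => [|l s IHs]; first by rewrite /free_word big_nil.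
by rewrite /= IHs modeE /free_word big_cons.
Qed.

Lemma free_wordE (s : seq (P * int)) : free_word s = mkmalgU (FMonom s) 1.
Proof.
elim: s => [|l s IHs].
  by rewrite /free_word big_nil; congr mkmalgU; rewrite -fmoneE.
rewrite /free_word big_cons -/(free_word s) IHs malgM_def fgmulUU mulr1.
by congr mkmalgU; apply/eqP; rewrite fmP fmM fmU; case: l.
Qed.

(** [a_1(r_1) ... a_k(r_k) v |-> (f a_1)(r_1) ... (f a_k)(r_k) v] *)
Definition fock_map (f : P -> P) (u : fock) : fock :=
  free_lift (fun s : fmonom (P * int)%type => word [seq (f l.1, l.2) | l <- s])
    (lrepr u).

Section FockMap.
Variables (f : P -> P) (f_linear : linear f).
Hypothesis f_form : forall a b, ps_form (f a) (f b) = ps_form a b.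
Hypothesis f_plus : forall a, a \in ps_plus P -> f a \in ps_plus P.

Let psi : free_algebra -> free_algebra :=
  free_lift (fun s : fmonom (P * int)%type =>
    free_word [seq (f l.1, l.2) | l <- s]).

Let psiZ k x : psi (k *: x) = k *: psi x. Proof. exact: linearZ. Qed.
Let psiB x y : psi (x - y) = psi x - psi y. Proof. exact: linearB. Qed.

Let psi_word s : psi (mkmalgU s 1) = free_word [seq (f l.1, l.2) | l <- s].
Proof. exact: free_liftU. Qed.

Let psi1 : psi 1 = 1.
Proof. by rewrite psi_word fm1 /free_word big_nil. Qed.

Let psi_gen a n : psi (fgen a n) = fgen (f a) n.
Proof. by rewrite psi_word fmU; exact: big_seq1. Qed.

Let psiM_word s t :
  psi (mkmalgU s 1 * mkmalgU t 1) = psi (mkmalgU s 1) * psi (mkmalgU t 1).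
Proof.
have -> : mkmalgU s 1 * mkmalgU t 1 = mkmalgU (monalg.mul s t) 1 :> free_algebra.
  by rewrite -[in RHS](mulr1 1); exact: fgmulUU.
rewrite (psi_word (monalg.mul s t)) (psi_word s) (psi_word t) fmM map_cat.
exact: big_cat.
Qed.

Let psiM x y : psi (x * y) = psi x * psi y.
Proof.
have mulL (z : free_algebra) : linear ( *%R^~ z).
  by move=> k u v; rewrite mulrDl scalerAl.
have psiL : linear psi by exact: free_lift_linear.
have psiMl s z : psi (mkmalgU s 1 * z) = psi (mkmalgU s 1) * psi z.
  pose F z := psi (mkmalgU s 1 * z); pose G z := psi (mkmalgU s 1) * psi z.
  apply: (@malg_ext _ _ _ F G) => [k u v|k u v|t]; last exact: psiM_word.
    by rewrite /F free_mull_linear psiL.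
  by rewrite /G psiL free_mull_linear.
pose F z := psi (z * y); pose G z := psi z * psi y.
apply: (@malg_ext _ _ _ F G) => [k u v|k u v|s]; last exact: psiMl.
  by rewrite /F mulL psiL.
by rewrite /G psiL mulL.
Qed.

Let psi_commutator a b m n k l :
  psi (fgen a m * fgen b n - k *: (fgen b n * fgen a m) - l *: 1) =
  fgen (f a) m * fgen (f b) n - k *: (fgen (f b) n * fgen (f a) m) - l *: 1.
Proof.
exact: (commutator_morph k l psiB psiZ psiM psi1 (psi_gen a m) (psi_gen b n)).
Qed.

Lemma fock_map_word s :
  fock_map f (word s) = word [seq (f l.1, l.2) | l <- s].
Proof.
have E x : free_lift (fun s : fmonom (P * int)%type =>
    word [seq (f l.1, l.2) | l <- s]) x = lpi fock_rel (psi x).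
  rewrite /psi /free_lift linear_sum; apply: eq_bigr => w _.
  by rewrite linearZ /= wordE.
rewrite /fock_map E wordE.
rewrite (@lift_lpi _ _ fock_rel fock (fun x => lpi fock_rel (psi x))).
- by rewrite free_wordE psi_word -wordE.
- by move=> k x y; rewrite /psi !linearP.
move=> y hy; apply: lpi_rel.
case: hy => [x1 y1 k b c m|x1 y1 b c m m'|x1 b m bm].
- rewrite !psiM !psiB psiZ !psi_gen f_linear; exact: Fock_linear.
- rewrite 2!psiM psi_commutator -f_form.
  exact: Fock_commutator.
- rewrite psiM psi_gen; apply: Fock_vacuum; move: bm; rewrite /annihilates.
  by case: ifP => // _ /orP[->//|/andP[-> /f_plus ->]]; rewrite orbT.
Qed.

End FockMap.
End Fock.

Arguments vacuum {K p P tw}.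
Arguments mode {K p P} tw a n u.
Arguments fock {K p} P tw.
Arguments fock_map {K p P} tw f u.

Section VertexAlgebras.
Variable K : numFieldType.

(** [Y a n w] is the coefficient of [z ^ (- n - 1)] in [Y(a, z) w]. *)
Definition fields (V M : lmodType K) := V -> rat -> M -> M.

Definition gbinom (x : rat) (i : nat) : K :=
  ratr ((\prod_(j < i) (x - j%:R)) / i`!%:R).

(** Modules twisted by an involution [theta] of the super space [V] whose
    parity involution is [par], the Jacobi identity being given by components.
    On vectors with [theta a = (-1)^s a] the field has exponents in
    [s / 2 + Z]. Both sides of the identity are finite sums by truncation. *)
Record twisted_module (V M : lmodType K) (vac : V) (par theta : V -> V)
    (Y : fields V V) (YM : fields V M) : Prop := {
  tm_linear_state : forall n w, linear (fun a => YM a n w);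
  tm_linear_vector : forall a n, linear (YM a n);
  tm_exponents : forall (s : bool) a n w, theta a = (-1) ^+ s *: a ->
    n - s%:R / 2 \isn't a Num.int -> YM a n w = 0;
  tm_truncation : forall a w, exists N : nat,
    forall n, N%:R <= n -> YM a n w = 0;
  tm_vacuum : forall n w, YM vac n w = if n == -1 then w else 0;
  tm_jacobi : forall (j k s t : bool) (a b : V) (w : M) (l : int) (m n : rat),
    par a = (-1) ^+ j *: a -> par b = (-1) ^+ k *: b ->
    theta a = (-1) ^+ s *: a -> theta b = (-1) ^+ t *: b ->
    m - s%:R / 2 \is a Num.int -> n - t%:R / 2 \is a Num.int ->
    \forall N \near \oo,
      \sum_(i < N) gbinom m i *: YM (Y a (l%:~R + i%:R) b) (m + n - i%:R) w =
      \sum_(i < N) ((-1) ^+ i * gbinom l%:~R i) *: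
        (YM a (m + l%:~R - i%:R) (YM b (n + i%:R) w)
         - ((-1) ^+ (j && k) * (-1) ^ l) *:
           YM b (n + l%:~R - i%:R) (YM a (m + i%:R) w)) }.

Record super_vertex_algebra (V : lmodType K) (vac : V) (par : V -> V)
    (Y : fields V V) : Prop := {
  sva_par_linear : linear par;
  sva_par_invol : involutive par;
  sva_par_vacuum : par vac = vac;
  sva_par_field : forall a n b, par (Y a n b) = Y (par a) n (par b);
  sva_adjoint : twisted_module vac par id Y Y;
  sva_creation : forall a, Y a (-1) vac = a;
  sva_creation0 : forall a (n : nat), Y a n%:R vac = 0 }.

(** The tensor product of fields, [(a (x) b)(x (x) y) = +- a x (x) b y]: the
    odd part of [b] picks up the parity [par_M] of [x]. *)
Definition tensor_fields (V1 M1 V2 M2 : lmodType K) (par_V : V2 -> V2)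
    (par_M : M1 -> M1) (Y1 : fields V1 M1) (Y2 : fields V2 M2) :
    fields (tensor V1 V2) (tensor M1 M2) := fun ab n =>
  tlift (fun x y => tlift (fun a b =>
    let b0 := 2^-1 *: (b + par_V b) in
    let b1 := 2^-1 *: (b - par_V b) in
    \sum_(i \in [set: rat])
      (tmul (Y1 a i x) (Y2 b0 (n - 1 - i) y)
       + tmul (Y1 a i (par_M x)) (Y2 b1 (n - 1 - i) y))) ab).

End VertexAlgebras.

Section FreeFieldStructures.
Variables (K : numFieldType) (p : bool) (P : polarized_space K p).

(** This is [(-1)^k] on words of length [k], that is, [exp(2 pi i L(0))] on
    [A(a)], the automorphism by which canonically twisted modules are twisted.
    It is the parity of the Clifford module vertex algebra, while the Weyl
    module vertex algebra is purely even. *)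
Definition canonical_involution (tw : bool) : fock P tw -> fock P tw :=
  fock_map tw (fun a => - a).

Definition parity (tw : bool) : fock P tw -> fock P tw :=
  if p then @canonical_involution tw else id.

(** [a(-1/2) v] *)
Definition gen_state (a : P) : fock P false := mode false a (-1) vacuum.

(** The super vertex algebra structure on [A(a)] with the given generating
    fields, and the canonically twisted module structure on [A(a)_tw]. *)
Record vertex_structure := VertexStructure {
  vs_fields : fields (fock P false) (fock P false);
  vs_sva : super_vertex_algebra vacuum (@parity false) vs_fields;
  vs_generator : forall a (n : int) u,
    vs_fields (gen_state a) n%:~R u = mode false a n u;
  vs_twisted : fields (fock P false) (fock P true);
  vs_module : twisted_module vacuum (@parity false) (@canonical_involution false)
    vs_fields vs_twisted;
  vs_twisted_generator : forall a (n : int) u,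
    vs_twisted (gen_state a) (n%:~R - 1 / 2) u = mode true a n u }.

(** Bases [a_i^+], [a_i^-] with [<a_i^-, a_j^+> = delta_ij]; the value of
    [<a_i^+, a_j^->] follows by (anti-)symmetry. *)
Record dual_bases := DualBases {
  db_size : nat;
  db_plus : 'I_db_size -> P;
  db_minus : 'I_db_size -> P;
  db_plus_basis : basis_of (ps_plus P) (codom db_plus);
  db_minus_basis : basis_of (ps_minus P) (codom db_minus);
  db_dual : forall i j, ps_form (db_minus i) (db_plus j) = (i == j)%:R }.

(** [mode false a n] is the action of [a(n + 1/2)]. *)
Definition conformal (b : dual_bases) : fock P false :=
  2^-1 *: \sum_(i < db_size b)
    (mode false (db_plus i) (-2) (mode false (db_minus i) (-1) vacuum)
     - mode false (db_plus i) (-1) (mode false (db_minus i) (-2) vacuum)).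

Definition current (b : dual_bases) : fock P false :=
  \sum_(i < db_size b)
    mode false (db_plus i) (-1) (mode false (db_minus i) (-1) vacuum).

(** [g] in [GL(a^+)] acts on [a] as [(g, g')], where [g' y] is the vector of
    [a^-] such that [<g x, g' y> = <x, y>] for all [x] in [a^+]. *)
Definition gl_act (g : 'End(subvs_of (ps_plus P))) (a : P) : P :=
  vsval (g (vsproj (ps_plus P) (daddv_pi (ps_plus P) (ps_minus P) a)))
  + xget 0 [set y | y \in ps_minus P /\ forall x : subvs_of (ps_plus P),
      ps_form (vsval (g x)) y =
      ps_form (vsval x) (daddv_pi (ps_minus P) (ps_plus P) a)].

Definition gl_fock (g : 'End(subvs_of (ps_plus P))) : fock P true -> fock P true :=
  fock_map true (gl_act g).

End FreeFieldStructures.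

Definition endo_trace (K : fieldType) (V : vectType K) (f : 'End(V)) : K :=
  \tr (passmx.mxof (vbasis fullv) (vbasis fullv) f).

Definition is_representation (K : fieldType) (gT : finGroupType) (H : {group gT})
    (V : vectType K) (rho : gT -> 'End(V)) : Prop :=
  rho 1%g = \1%VF /\ {in H &, forall g h, rho (g * h)%g = (rho g \o rho h)%VF}.

Section Traces.
Variables (K : numFieldType) (W : lmodType K).

(** [X] preserves the finite-dimensional subspace [S], and has trace [t] on
    it. *)
Definition trace_on (S : set W) (X : W -> W) (t : K) : Prop :=
  exists (k : nat) (e : 'I_k -> W) (A : 'M[K]_k),
  [/\ S = [set w | exists c : 'I_k -> K, w = \sum_i c i *: e i],
      (forall c : 'I_k -> K, \sum_i c i *: e i = 0 -> forall i, c i = 0),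
      (forall j, X (e j) = \sum_i A i j *: e i) &
      t = \tr A].

Definition joint_eigenspace (J L : W -> W) (m n : int) : set W :=
  [set w | J w = m%:~R *: w /\ L w = n%:~R *: w].

(** [tr(X y^J q^L | W)] is the formal series whose coefficient of [y^m q^n] is
    [t m n]; in particular, [J] and [L] are simultaneously diagonalizable with
    integral eigenvalues and finite-dimensional joint eigenspaces. *)
Definition trace_series (X J L : W -> W) (t : int -> int -> K) : Prop :=
  (forall w, exists (k : nat) (m n : 'I_k -> int) (v : 'I_k -> W),
     (forall i, joint_eigenspace J L (m i) (n i) (v i)) /\ w = \sum_i v i) /\
  (forall m n, trace_on (joint_eigenspace J L m n) X (t m n)).

End Traces.

(** Unconditional (equivalently, absolute) summability. *)
Definition has_sum (K : numFieldType) (I : choiceType) (f : I -> K) (l : K) :=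
  forall e : K, 0 < e -> exists A : {fset I}, forall B : {fset I},
    (A `<=` B)%fset -> `| \sum_(i <- B) f i - l | < e.

Section Module5.
Variable K : numFieldType.
Variables (E A A' : polarized_space K true) (B : polarized_space K false).

Definition W5 : lmodType K :=
  tensor (tensor (tensor (fock E false) (fock A false)) (fock A' false))
    (fock B false).

Definition W5tw : lmodType K :=
  tensor (tensor (tensor (fock E true) (fock A true)) (fock A' true))
    (fock B true).

Definition tmul4 (e : fock E false) (a : fock A false) (a' : fock A' false)
    (b : fock B false) : W5 := tmul (tmul (tmul e a) a') b.

Definition tmap4 (e : fock E true -> fock E true) (a : fock A true -> fock A true)
    (a' : fock A' true -> fock A' true) (b : fock B true -> fock B true) :
  W5tw -> W5tw := tmap (tmap (tmap e a) a') b.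

Definition W5tw_fields (vE : vertex_structure E) (vA : vertex_structure A)
    (vA' : vertex_structure A') (vB : vertex_structure B) : fields W5 W5tw :=
  let parE := @parity K true E true in
  let parA := @parity K true A true in
  let parA' := @parity K true A' true in
  tensor_fields (@parity K false B false) (tmap (tmap parE parA) parA')
    (tensor_fields (@parity K true A' false) (tmap parE parA)
      (tensor_fields (@parity K true A false) parE
        (vs_twisted vE) (vs_twisted vA))
      (vs_twisted vA'))
    (vs_twisted vB).

Section Vectors.
Variables (bE : dual_bases E) (bA : dual_bases A) (bA' : dual_bases A').
Variable bB : dual_bases B.

Definition omega5 : W5 :=
  tmul4 (conformal bE) vacuum vacuum vacuum
  + tmul4 vacuum (conformal bA) vacuum vacuum
  + tmul4 vacuum vacuum (conformal bA') vacuum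
  + tmul4 vacuum vacuum vacuum (conformal bB).

Definition currentE : W5 := tmul4 (current bE) vacuum vacuum vacuum.

Definition current5 : W5 :=
  2 *: tmul4 vacuum (current bA) vacuum vacuum
  + 3 *: tmul4 vacuum vacuum (current bA') vacuum
  + tmul4 vacuum vacuum vacuum (current bB).

End Vectors.

Definition fermion_sign : W5tw -> W5tw :=
  tmap4 (gl_fock (- \1%VF)) (gl_fock (- \1%VF)) (gl_fock (- \1%VF))
    (gl_fock \1%VF).

Definition act5 (gA : 'End(subvs_of (ps_plus A)))
    (gA' : 'End(subvs_of (ps_plus A'))) (gB : 'End(subvs_of (ps_plus B))) :
  W5tw -> W5tw :=
  tmap4 (gl_fock \1%VF) (gl_fock gA) (gl_fock gA') (gl_fock gB).

End Module5.

Section Niemeier.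
Variable Q : 'M[int]_24.

(** The lattice [Z^24] of row vectors with Gram matrix [Q]. *)
Definition lform (x y : 'rV[int]_24) : int := (x *m Q *m y^T) 0 0.

Definition lattice_root (x : 'rV[int]_24) : Prop := lform x x = 2.

Definition cartan_A4 (i j : 'I_4) : int :=
  if i == j then 2 else if (i.+1 == j) || (j.+1 == i) then -1 else 0.

Record niemeier_A4_6 : Prop := {
  nie_sym : Q^T = Q;
  nie_pos : forall x, x != 0 -> 0 < lform x x;
  nie_even : forall x, (2 %| lform x x)%Z;
  nie_unimodular : \det Q = 1;
  nie_roots : exists alpha : 'I_6 -> 'I_4 -> 'rV[int]_24,
    (forall i j k l, lform (alpha i k) (alpha j l) =
       if i == j then cartan_A4 k l else 0) /\
    (forall x, lattice_root x ->
       exists c : 'I_6 -> 'I_4 -> int, x = \sum_i \sum_k c i k *: alpha i k) }.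

Definition lattice_aut : set 'M[int]_24 := [set g | g *m Q *m g^T = Q].

(** [y *m reflection x = y - <y, x> x] *)
Definition reflection (x : 'rV[int]_24) : 'M[int]_24 := 1%:M - Q *m x^T *m x.

Inductive lattice_inn : set 'M[int]_24 :=
| Inn_1 : lattice_inn 1%:M
| Inn_M x g : lattice_root x -> lattice_inn g -> lattice_inn (reflection x *m g).

End Niemeier.

(** [G] is isomorphic to [Aut(N) / Inn(N)]. *)
Definition umbral_group_A4_6 (gT : finGroupType) (G : {group gT}) : Prop :=
  exists (Q : 'M[int]_24) (f : 'M[int]_24 -> gT),
  [/\ niemeier_A4_6 Q,
      {in lattice_aut Q &, forall g h, f (g *m h) = (f g * f h)%g},
      f @` lattice_aut Q = [set` G] &
      forall g, lattice_aut Q g -> f g = 1%g <-> lattice_inn Q g].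

Record maximal_subgroup24 (gT : finGroupType) (G H : {group gT})
    (iota : {morphism [set: {perm 'I_3}] >-> gT}) (c : gT) : Prop := {
  ms_maximal : maximal H G;
  ms_order : #|H| = 24%N;
  ms_injective : ('injm iota)%g;
  ms_order_c : #[c]%g = 4%N;
  ms_product : (iota @* 'dom iota \x <[c]>)%g = H }.

Variant umbral_class :=
  C1A | C2A | C2B | C2C | C3A | C6A | C4A | C4B | C12A | C12B.

(** The name of the class in [G] of an element [g] of [H], where [s] and [r] are
    the images of a transposition and of a 3-cycle; the classes 4C and 4D of [H],
    those of [s * c] and [s * c^-1], fuse into the classes 4A and 4B of [G]. *)
Definition umbral_class_of (gT : finGroupType) (H : {group gT}) (c s r g : gT) :
    umbral_class :=
  let cls x := (g \in x ^: H)%g in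
  if cls 1%g then C1A else
  if cls (c ^+ 2)%g then C2A else
  if cls c then C4A else
  if cls (c^-1)%g then C4B else
  if cls s then C2B else
  if cls (s * c ^+ 2)%g then C2C else
  if cls (s * c)%g then C4A else
  if cls (s * c^-1)%g then C4B else
  if cls r then C3A else
  if cls (r * c ^+ 2)%g then C6A else
  if cls (r * c)%g then C12A else C12B.

Definition cplx (R : realType) : numClosedFieldType := R[i].

Section Theta.
Variable R : realType.
Implicit Types tau z : cplx R.

Definition cexp (z : cplx R) : cplx R :=
  let: (x +i* y)%C := z in (expR x * cos y +i* (expR x * sin y))%C.

(** [exp(2 pi i z)] *)
Definition ce (z : cplx R) : cplx R := cexp (2 * (pi : R)%:C%C * 'i * z).

Definition iprod (f : nat -> cplx R) : cplx R :=
  lim ((\prod_(1 <= n < N) f n) @[N --> \oo]).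

Definition eta tau : cplx R :=
  ce (tau / 24) * iprod (fun n => 1 - ce tau ^+ n).

Definition theta1 tau z : cplx R :=
  - 'i * ce (tau / 8) * ce (z / 2) *
  iprod (fun n => (1 - (ce z)^-1 * ce tau ^+ n.-1) * (1 - ce z * ce tau ^+ n)
                  * (1 - ce tau ^+ n)).

Definition theta2 tau z : cplx R :=
  ce (tau / 8) * ce (z / 2) *
  iprod (fun n => (1 + (ce z)^-1 * ce tau ^+ n.-1) * (1 + ce z * ce tau ^+ n)
                  * (1 - ce tau ^+ n)).

Definition psi5 (k : umbral_class) tau z : cplx R :=
  match k with
  | C1A => 2 * 'i * (eta tau ^+ 3 * theta1 tau (2 * z) * theta1 tau (3 * z)
             / theta1 tau z ^+ 3)
  | C2A => - 2 * 'i * (eta tau ^+ 3 * theta1 tau (2 * z) * theta2 tau (3 * z)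
             / theta2 tau z ^+ 3)
  | C2B => - 2 * 'i * (eta tau ^+ 3 * theta1 tau (2 * z) * theta1 tau (3 * z)
             / (theta1 tau z * theta2 tau z ^+ 2))
  | C2C => 2 * 'i * (eta tau ^+ 3 * theta1 tau (2 * z) * theta2 tau (3 * z)
             / (theta1 tau z ^+ 2 * theta2 tau z))
  | C3A => - 2 * 'i * (eta (3 * tau) * theta1 tau (2 * z) * theta1 tau (3 * z)
             / theta1 (3 * tau) (3 * z))
  | C6A => - 2 * 'i * (eta (3 * tau) * theta1 tau (2 * z) * theta2 tau (3 * z)
             / theta2 (3 * tau) (3 * z))
  | C4A | C4B =>
      - 'i * (eta (2 * tau) ^+ 2 * theta2 tau (2 * z)
              / (eta tau * theta2 (2 * tau) (2 * z) ^+ 2))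
      * (theta1 tau (z + 1 / 4) * theta1 tau (3 * z + 1 / 4)
         - theta1 tau (z - 1 / 4) * theta1 tau (3 * z - 1 / 4))
  | C12A | C12B =>
      'i * (eta (6 * tau) * theta2 tau (2 * z)
            / (eta tau ^+ 3 * theta2 (6 * tau) (6 * z)))
      * (theta1 tau (z + 1 / 12) * theta1 tau (z + 1 / 4)
           * theta1 tau (z + 5 / 12) * theta1 tau (3 * z - 1 / 4)
         - theta1 tau (z - 1 / 12) * theta1 tau (z - 1 / 4)
           * theta1 tau (z - 5 / 12) * theta1 tau (3 * z + 1 / 4))
  end.

End Theta.

(* Main.v *)
(** Each Fock module has a basis of ordered words in its creation modes. Their
    linear independence comes from a vacuum functional, obtained by letting a
    mode act on the free algebra as left multiplication by its creation part
    plus the superderivation that contracts with its annihilation part. The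
    Jacobi identity turns J(0) and L(0) into quadratic expressions in the modes
    that are diagonal on such words, and in W_tw the vacuum eigenvalues add up
    to integers. Since g has finite order, the words can be taken in
    eigenvectors of g, so that the trace is a sum over occupation numbers.

    Adding or removing the zero mode of the first factor preserves J(0) and
    L(0), changes the sign of (-1)^F and changes the eigenvalue of J_e(0) by
    one. Pairing the states accordingly leaves prod (1 - q^n)^2 for this factor.
    The sum over the remaining states converges absolutely for
    0 < - Im z < Im tau, to a quotient of products
    Theta_q(u) = prod (1 - u^-1 q^(n-1)) (1 - u q^n). By Newton's identities it
    depends on g only through the characters, and the functions psi_g are
    obtained from Theta_q(u) Theta_q(-u) = Theta_(q^2)(u^2) and its analogue for
    the cube roots of unity. *)

From HB Require Import structures.
From mathcomp Require Import all_boot all_order all_algebra.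
From mathcomp Require Import all_fingroup all_solvable all_character.
From mathcomp Require Import complex finmap multiset.
From mathcomp Require Import all_classical all_reals all_analysis.
From mathcomp Require Import -(notations) monalg.
From mathcomp Require Import separable cyclotomic.
From mathcomp Require Import ring lra zify.
Require Import Defs.

Set Implicit Arguments.
Unset Strict Implicit.
Unset Printing Implicit Defensive.

Import Order.TTheory GRing.Theory Num.Theory.
Import numFieldNormedType.Exports.

Local Open Scope classical_set_scope.
Local Open Scope ring_scope.

(** * The universal property of the Fock module *)

(** Without the insertion of [J_e(0)] the trace would be zero, because the first factor alone would
    contribute [Theta_q(1) = 0]. The weights 2 and 3 and the dimensions are balanced against each
    other: the vacuum charge is [2/2 + 3/2 - 3/2 = 1], whence the prefactor [y], and the vacuum
    energies [3/8 - 3/8] cancel, in accordance with a total central charge of zero. The domain is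
    dictated by the Weyl factor. Each of its modes contributes a geometric series in [y^-1 q^n] or
    [y q^(n+1)], times a root of unity, and these series all converge exactly when [|y| > 1] and
    [|y q| < 1]. Because of the sum [g + g^-1] the value is invariant under inverting all
    eigenvalues; this is why 4A and 4B, and likewise 12A and 12B, share one formula. The Fock
    modules are quotients of a free algebra by a span of relations, so that even the vacuum is not
    visibly nonzero; maps out of them are obtained from their universal property. The vertex
    structures are arbitrary, and the Jacobi identity is applied only to pairs of generators. *)

Lemma mkmalgU_scale (K : fieldType) (X : choiceType) (s : X) (c : K) :
  mkmalgU s c = c *: mkmalgU s 1.
Proof. by apply/malgP => w; rewrite mcoeffZ !mcoeffU mulr_natr. Qed.

Lemma lalg_rel_mulr (K : fieldType) (U : lalgType K) (a b c y : U) k :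
  1 * (a - k *: b - c) * y = a * y - k *: (b * y) - c * y.
Proof. by rewrite mul1r !mulrBl -scalerAl. Qed.

Lemma lalg_commutator_mulr (K : fieldType) (U : lalgType K) (a b y : U) k l :
  1 * (a * b - k *: (b * a) - l *: 1) * y =
  a * (b * y) - k *: (b * (a * y)) - l *: y.
Proof. by rewrite mul1r !mulrBl -!scalerAl mul1r !mulrA. Qed.

Section AbstractAction.
Variables (K : fieldType) (U : lalgType K) (M : lmodType K) (G : U -> M).
Hypothesis GL : linear G.

Let GB x y : G (x - y) = G x - G y.
Proof.
have -> : x - y = -1 *: y + x by rewrite scaleN1r addrC.
by rewrite GL scaleN1r addrC.
Qed.

Let GZ k x : G (k *: x) = k *: G x.
Proof. by rewrite -[k *: x]addr0 GL -(subrr 0) GB subrr addr0. Qed.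

(** Well-definedness of a map out of [fock] comes down to this lemma and the next: the map turns
    left multiplications into operators, and the operators satisfy the relation. *)
Lemma action_linear_rel (a b c y : U) k (oa ob oc : M -> M) :
  (forall x, G (a * x) = oa (G x)) -> (forall x, G (b * x) = ob (G x)) ->
  (forall x, G (c * x) = oc (G x)) -> (forall u, oa u = k *: ob u + oc u) ->
  G ((a - k *: b - c) * y) = 0.
Proof.
move=> ha hb hc h; rewrite !mulrBl -scalerAl !GB GZ ha hb hc h.
by rewrite addrAC addrK subrr.
Qed.

Lemma action_commutator_rel (a b y : U) k l (oa ob : M -> M) :
  (forall x, G (a * x) = oa (G x)) -> (forall x, G (b * x) = ob (G x)) ->
  (forall u, oa (ob u) = k *: ob (oa u) + l *: u) ->
  G ((a * b - k *: (b * a) - l *: 1) * y) = 0.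
Proof.
move=> ha hb h; rewrite !mulrBl -!scalerAl mul1r -!mulrA !GB !GZ !(ha, hb) h.
by rewrite addrAC addrK subrr.
Qed.

End AbstractAction.

Section FockUniversal.
Variables (K : fieldType) (p : bool) (P : polarized_space K p) (tw : bool).
Local Notation eps := ((-1) ^+ p : K).
Local Notation T := (malg (fmonom (P * int)%type) K).

Definition fpi (x : T) : fock P tw := lpi (@fock_rel _ _ P tw) x.

Lemma fpiP k x y : fpi (k *: x + y) = k *: fpi x + fpi y.
Proof. exact: (@lpi_linear _ _ (@fock_rel _ _ P tw)). Qed.

Lemma fpi0 : fpi 0 = 0.
Proof. exact: (linear0 (lpi (@fock_rel _ _ P tw))). Qed.

Lemma fpiZ k x : fpi (k *: x) = k *: fpi x.
Proof. by rewrite -[in LHS](addr0 (k *: x)) fpiP fpi0 addr0. Qed.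

Let lmul_linear k (x y z : T) : x * (k *: y + z) = k *: (x * y) + x * z.
Proof. exact: free_mull_linear. Qed.

Lemma fpi_surj u : exists x, u = fpi x.
Proof. by exists (lrepr u); rewrite /fpi lreprK. Qed.

Lemma fpi_mode a n x : mode tw a n (fpi x) = fpi (fgen a n * x).
Proof. exact: modeE. Qed.

Lemma fpi_rel x : fock_rel tw x -> fpi x = 0.
Proof. exact: lpi_rel. Qed.

Lemma fpi_eq x y z k : fpi (x - k *: y - z) = 0 -> fpi x = k *: fpi y + fpi z.
Proof.
move=> h; have -> : x = 1 *: (x - k *: y - z) + (k *: y + z).
  by rewrite scale1r -[x - _ - _]addrA -opprD subrK.
by rewrite fpiP h scaler0 add0r fpiP.
Qed.

Lemma mode_is_linear (a : P) n : linear (mode tw a n).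
Proof.
move=> k u v; have [x ->] := fpi_surj u; have [y ->] := fpi_surj v.
rewrite [X in mode tw a n X](_ : _ = fpi (k *: x + y)); last by rewrite fpiP.
by rewrite !fpi_mode lmul_linear fpiP.
Qed.

Lemma mode_linearl k (a b : P) n (u : fock P tw) :
  mode tw (k *: a + b) n u = k *: mode tw a n u + mode tw b n u.
Proof.
have [x ->] := fpi_surj u; rewrite !fpi_mode; apply: fpi_eq.
apply: fpi_rel; have := Fock_linear tw 1 x k a b n.
by rewrite lalg_rel_mulr.
Qed.

Lemma mode_commutator (a b : P) m n (u : fock P tw) :
  mode tw a m (mode tw b n u) = eps *: mode tw b n (mode tw a m u) +
  (if mode_index tw m + mode_index tw n == 0 then ps_form a b else 0) *: u.
Proof.
have [x ->] := fpi_surj u; rewrite !fpi_mode.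
rewrite -(fpiZ _ x); apply: fpi_eq.
apply: fpi_rel; have := Fock_commutator tw 1 x a b m n.
by rewrite lalg_commutator_mulr.
Qed.

Lemma mode_vacuum (a : P) n : annihilates tw a n -> mode tw a n vacuum = 0.
Proof.
move=> an; have := fpi_mode a n 1; rewrite mulr1 => ->; apply: fpi_rel.
by have := Fock_vacuum (1 : T) an; rewrite mul1r.
Qed.

Variables (M : lmodType K) (o : P -> int -> M -> M) (v0 : M).

Definition word_act (s : seq (P * int)) (u : M) : M :=
  foldr (fun l => o l.1 l.2) u s.

(** The Fock module is induced from the line on which the annihilation operators vanish. This is the
    resulting module map that sends the vacuum to [v0], under the hypotheses that follow. *)
Definition fock_lift (u : fock P tw) : M :=
  free_lift (fun s : fmonom (P * int)%type => word_act s v0) (lrepr u).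

Hypothesis oL : forall a n, linear (o a n).
Hypothesis oA : forall k a b n u, o (k *: a + b) n u = k *: o a n u + o b n u.
Hypothesis oC : forall a b m n u, o a m (o b n u) = eps *: o b n (o a m u) +
  (if mode_index tw m + mode_index tw n == 0 then ps_form a b else 0) *: u.
Hypothesis oV : forall a n, annihilates tw a n -> o a n v0 = 0.

Let G : T -> M := free_lift (fun s : fmonom (P * int)%type => word_act s v0).

Let GL : linear G. Proof. exact: free_lift_linear. Qed.
Let GB x y : G (x - y) = G x - G y. Proof. exact: linearB. Qed.
Let GZ k x : G (k *: x) = k *: G x. Proof. exact: linearZ. Qed.

Let G1 : G 1 = v0.
Proof.
transitivity (word_act (monalg.one : fmonom (P * int)%type) v0).
  exact: free_liftU.
by rewrite fm1.
Qed.

Let o0 a n : o a n 0 = 0.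
Proof. by rewrite -[X in o a n X](subrr 0) -scaleN1r addrC oL scaleN1r addrC subrr. Qed.

Let G_gen a n x : G (fgen a n * x) = o a n (G x).
Proof.
apply: (@malg_ext _ _ _ (fun x => G (fgen a n * x)) (fun x => o a n (G x))).
- by move=> k u v; rewrite lmul_linear GL.
- by move=> k u v; rewrite GL oL.
move=> s; rewrite /fgen.
have -> : mkmalgU (fmu (a, n)) 1 * mkmalgU s 1 =
  mkmalgU (monalg.mul (fmu (a, n)) s) 1 :> T.
  by rewrite -[in RHS](mulr1 1); exact: fgmulUU.
by rewrite /G !free_liftU fmM fmU.
Qed.

Let G_word s x : G (free_word s * x) = word_act s (G x).
Proof.
elim: s => [|l s IHs]; first by rewrite /free_word big_nil mul1r.
by rewrite /free_word big_cons -mulrA G_gen -/(free_word s) IHs.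
Qed.

(** The kernel is a left ideal, which disposes of the left factor in all three kinds of
    relations. *)
Let G_kill z x : G z = 0 -> G (x * z) = 0.
Proof.
move=> Gz; apply: (@malg_ext _ _ _ (fun x => G (x * z)) (fun=> 0)).
- by move=> k u v; rewrite mulrDl -scalerAl GL.
- by move=> k u v; rewrite scaler0 addr0.
move=> s; rewrite -[s]fmK -free_wordE G_word Gz.
by elim: (fmonom_val s) => //= l s' ->.
Qed.

Let fock_lift_fpi x : fock_lift (fpi x) = G x.
Proof.
apply: lift_lpi => // y [x1 y1 k a b n|x1 y1 a b m n|x1 a n an].
- rewrite -mulrA; apply: G_kill.
  by apply: (action_linear_rel GL) => [?|?|?|?]; rewrite ?G_gen// oA.
- rewrite -mulrA; apply: G_kill.
  by apply: (action_commutator_rel GL) => [?|?|?]; rewrite ?G_gen// oC.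
- apply: G_kill; rewrite -[fgen a n]mulr1 G_gen.
  by rewrite G1 oV.
Qed.

Lemma fock_lift_linear : linear fock_lift.
Proof.
move=> k u v; have [x ->] := fpi_surj u; have [y ->] := fpi_surj v.
by rewrite -fpiP !fock_lift_fpi GL.
Qed.

Lemma fock_lift_vacuum : fock_lift vacuum = v0.
Proof. by rewrite (fock_lift_fpi 1) G1. Qed.

Lemma fock_lift_mode a n u : fock_lift (mode tw a n u) = o a n (fock_lift u).
Proof. by have [x ->] := fpi_surj u; rewrite fpi_mode !fock_lift_fpi G_gen. Qed.

End FockUniversal.

Lemma fock_ind (K : fieldType) (p : bool) (P : polarized_space K p) (tw : bool)
    (U : set (fock P tw)) :
  U 0 -> (forall k u v, U u -> U v -> U (k *: u + v)) -> U vacuum ->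
  (forall a n u, U u -> U (mode tw a n u)) -> forall u, U u.
Proof.
move=> U0 UL Uv Um u; have [x {u}->] := fpi_surj u.
have fpiB (y z : malg (fmonom (P * int)%type) K) : U (fpi tw y) ->
    U (fpi tw z) -> forall k, U (fpi tw (k *: y + z)).
  by move=> Uy Uz k; rewrite fpiP; apply: UL.
rewrite (monalgE x); elim/big_rec: _ => [|s y _ Uy]; first by rewrite fpi0.
rewrite mkmalgU_scale.
apply: fpiB => //; rewrite -[s]fmK -free_wordE.
have -> : fpi tw (free_word s) = word tw s by rewrite wordE.
by elim: (fmonom_val s) => //= l s' Us; apply: Um.
Qed.

Section PlainLinear.
Variables (K : fieldType) (U V : lmodType K) (f : U -> V) (fL : linear f).

Lemma plin0 : f 0 = 0.
Proof. by have := fL (-1) 0 0; rewrite scaler0 addr0 scaleN1r addNr. Qed.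

Lemma plinZ k x : f (k *: x) = k *: f x.
Proof. by rewrite -[k *: x]addr0 fL plin0 addr0. Qed.

Lemma plinD x y : f (x + y) = f x + f y.
Proof. by rewrite -[x in LHS]scale1r fL scale1r. Qed.

Lemma plinB x y : f (x - y) = f x - f y.
Proof. by rewrite plinD -scaleN1r plinZ scaleN1r. Qed.

Lemma plin_sum (I : Type) (r : seq I) (Q : pred I) (F : I -> U) :
  f (\sum_(i <- r | Q i) F i) = \sum_(i <- r | Q i) f (F i).
Proof. by apply: big_morph; [exact: plinD|exact: plin0]. Qed.

End PlainLinear.

Section ScaleIdentities.
Variables (K : fieldType) (V : lmodType K).

Lemma derivation_linear_rel (c1 c2 k e : K) (z A B C : V) :
  (k * c1 + c2) *: z + e *: A - k *: (c1 *: z + e *: B) - (c2 *: z + e *: C) =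
  e *: (A - k *: B - C).
Proof.
rewrite !scalerBr scalerDl !scalerDr !scalerA [k * e]mulrC !opprD !addrA.
by rewrite (ACl ((1*4)*(2*6)*3*5*7))%AC/= !subrr !add0r.
Qed.

Lemma derivation_commutator_rel (c1 c2 e : K) (x y A B : V) : e * e = 1 ->
  c1 *: x + e *: (c2 *: y + e *: A) - e *: (c2 *: y + e *: (c1 *: x + e *: B)) =
  A - e *: B.
Proof.
move=> e2; rewrite !scalerDr !scalerA e2 !mul1r !scale1r !opprD !addrA.
by rewrite (ACl ((1*5)*(2*4)*3*6))%AC/= !subrr !add0r.
Qed.

Lemma linear_in_mode (c1 c2 k e : K) (z A B : V) :
  (k * c1 + c2) *: z + e *: (k *: A + B) =
  k *: (c1 *: z + e *: A) + (c2 *: z + e *: B).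
Proof.
by rewrite scalerDl !scalerDr !scalerA [k * e]mulrC !addrA (ACl (1*3*2*4))%AC.
Qed.

Lemma commutator_of_sums (ca cb e : K) (x A1 A2 A3 A4 B1 B2 : V) : e * e = 1 ->
  A1 + A2 + (ca *: x + e *: A3 + e *: A4) -
  (e *: (B1 + A3 + (cb *: x + e *: B2 + A4)) + (ca - e * cb) *: x) =
  A1 + A2 - e *: B1 - B2.
Proof.
move=> e2; rewrite !scalerDr !scalerA e2 scale1r scalerBl !opprD opprK !addrA.
by rewrite (ACl (1*2*6*9*(3*11)*(4*7)*(5*10)*(12*8)))%AC/= !subrr !addr0.
Qed.

Lemma linear_pencil (c e k : K) (u v A B : V) :
  c *: (k *: u + v) + e *: (k *: A + B) = k *: (c *: u + e *: A) + (c *: v + e *: B).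
Proof.
rewrite !scalerDr !scalerA [k * c]mulrC [k * e]mulrC !addrA.
by rewrite (ACl (1*3*2*4))%AC.
Qed.
End ScaleIdentities.

(** * The vacuum functional *)

Section VacuumFunctional.
Variables (K : fieldType) (p : bool) (P : polarized_space K p).
Local Notation eps := ((-1) ^+ p : K).

Definition proj_plus (a : P) : P := daddv_pi (ps_plus P) (ps_minus P) a.
Definition proj_minus (a : P) : P := daddv_pi (ps_minus P) (ps_plus P) a.

Lemma proj_plusP k a b : proj_plus (k *: a + b) = k *: proj_plus a + proj_plus b.
Proof. exact: linearP. Qed.

Lemma proj_minusP k a b :
  proj_minus (k *: a + b) = k *: proj_minus a + proj_minus b.
Proof. exact: linearP. Qed.

Lemma mem_proj_plus a : proj_plus a \in ps_plus P.
Proof. exact: memv_pi. Qed.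

Lemma mem_proj_minus a : proj_minus a \in ps_minus P.
Proof. exact: memv_pi. Qed.

Lemma projD a : proj_plus a + proj_minus a = a.
Proof. by apply: daddv_pi_add; rewrite ?ps_direct// ps_full memvf. Qed.

Lemma proj_plus_minus a : a \in ps_minus P -> proj_plus a = 0.
Proof.
move=> am; rewrite -(projD a); apply/eqP; rewrite -subr_eq0.
have : proj_plus a \in (ps_plus P :&: ps_minus P)%VS.
  rewrite memv_cap mem_proj_plus/=.
  have -> : proj_plus a = a - proj_minus a by rewrite -{2}(projD a) addrK.
  by rewrite memvB// mem_proj_minus.
by rewrite ps_direct memv0 projD subr0.
Qed.

Lemma proj_minus_plus a : a \in ps_plus P -> proj_minus a = 0.
Proof.
move=> am; have : proj_minus a \in (ps_plus P :&: ps_minus P)%VS.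
  rewrite memv_cap mem_proj_minus andbT.
  have -> : proj_minus a = a - proj_plus a by rewrite -{2}(projD a) addrC addKr.
  by rewrite memvB// mem_proj_plus.
by rewrite ps_direct memv0 => /eqP.
Qed.

Lemma eps2 : eps * eps = 1.
Proof. by rewrite -expr2 sqrr_sign. Qed.

Lemma ps_form_linearr k (a b c : P) :
  ps_form c (k *: a + b) = k * ps_form c a + ps_form c b.
Proof.
rewrite (ps_form_sym (k *: a + b)) ps_form_linear (ps_form_sym a c).
by rewrite (ps_form_sym b c); ring.
Qed.

Lemma ps_form0r (c : P) : ps_form c 0 = 0.
Proof. by have := ps_form_linearr (-1) 0 0 c; rewrite scaler0 addr0 mulN1r addNr. Qed.

Lemma ps_form0l (c : P) : ps_form 0 c = 0.
Proof. by rewrite ps_form_sym ps_form0r mulr0. Qed.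

Lemma ps_formDl (a b c : P) : ps_form (a + b) c = ps_form a c + ps_form b c.
Proof. by rewrite -[a in LHS]scale1r ps_form_linear mul1r. Qed.

Lemma ps_formDr (a b c : P) : ps_form c (a + b) = ps_form c a + ps_form c b.
Proof. by rewrite -[a in LHS]scale1r ps_form_linearr mul1r. Qed.

Lemma ps_formZl k (a c : P) : ps_form (k *: a) c = k * ps_form a c.
Proof. by rewrite -[k *: a]addr0 ps_form_linear ps_form0l addr0. Qed.

Lemma ps_formZr k (a c : P) : ps_form c (k *: a) = k * ps_form c a.
Proof. by rewrite -[k *: a]addr0 ps_form_linearr ps_form0r addr0. Qed.

Lemma ps_form_suml (I : Type) (r : seq I) (F : I -> P) c :
  ps_form (\sum_(i <- r) F i) c = \sum_(i <- r) ps_form (F i) c.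
Proof.
by apply: (big_morph (fun a => ps_form a c)); [move=> ? ?; exact: ps_formDl|exact: ps_form0l].
Qed.

Lemma ps_form_sumr (I : Type) (r : seq I) (F : I -> P) c :
  ps_form c (\sum_(i <- r) F i) = \sum_(i <- r) ps_form c (F i).
Proof.
by apply: (big_morph (ps_form c)); [move=> ? ?; exact: ps_formDr|exact: ps_form0r].
Qed.

(** At mode zero the polarization decides: the half [ps_plus] annihilates and the half [ps_minus]
    creates. *)
Definition ann_part (a : P) (n : int) : P :=
  if 0 < n then a else if n == 0 then proj_plus a else 0.
Definition cre_part (a : P) (n : int) : P :=
  if 0 < n then 0 else if n == 0 then proj_minus a else a.

Lemma ann_partP k a b n :
  ann_part (k *: a + b) n = k *: ann_part a n + ann_part b n.
Proof.
by rewrite /ann_part; do 2?case: ifP => // _; rewrite ?proj_plusP// scaler0 addr0.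
Qed.

Lemma cre_partP k a b n :
  cre_part (k *: a + b) n = k *: cre_part a n + cre_part b n.
Proof.
by rewrite /cre_part; do 2?case: ifP => // _; rewrite ?proj_minusP// scaler0 addr0.
Qed.

Definition contraction (a : P) (m : int) (b : P) (n : int) : K :=
  if m + n == 0 then ps_form (ann_part a m) b else 0.

Lemma contractionPl k a a' m b n : contraction (k *: a + a') m b n =
  k * contraction a m b n + contraction a' m b n.
Proof.
by rewrite /contraction ann_partP ps_form_linear; case: ifP; rewrite // mulr0 addr0.
Qed.

Lemma contractionPr k a m b b' n : contraction a m (k *: b + b') n =
  k * contraction a m b n + contraction a m b' n.
Proof.
by rewrite /contraction ps_form_linearr; case: ifP; rewrite // mulr0 addr0.
Qed.

(** This identity yields the commutation relations in the model. For nonzero [m] only one of the two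
    terms is present, the second one being turned around by the symmetry of the form. For [m = 0]
    they pair opposite halves, and isotropy removes the other parts of [ps_form a b]. *)
Lemma contraction_cre a m b n :
  contraction a m (cre_part b n) n - eps * contraction b n (cre_part a m) m =
  if m + n == 0 then ps_form a b else 0.
Proof.
rewrite /contraction [n + m]addrC; case: ifP => [/eqP|]; last by rewrite mulr0 subr0.
move=> mn; have -> : n = - m by apply/eqP; rewrite -addr_eq0 addrC mn.
rewrite /ann_part /cre_part oppr_gt0 oppr_eq0.
case: (ltgtP 0 m) => hm.
- by rewrite ps_form0r mulr0 subr0.
- by rewrite ps_form0l sub0r (ps_form_sym a b) mulNr mulrN opprK mulrA eps2 mul1r.
rewrite -[in RHS](projD a) -[in RHS](projD b) !(ps_formDl, ps_formDr).
rewrite (ps_plus_isotropic (mem_proj_plus _) (mem_proj_plus _)) add0r.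
rewrite (ps_minus_isotropic (mem_proj_minus _) (mem_proj_minus _)) addr0.
congr (_ + _).
by rewrite (ps_form_sym (proj_minus a)) mulNr mulrN opprK mulrA eps2 mul1r.
Qed.

Section FreeModel.
Variables (T : lalgType K) (g : P -> int -> T) (D : P -> int -> T -> T).
Variable ev : T -> K.
Hypothesis T_ind : forall U : T -> Prop, U 0 ->
  (forall k x y, U x -> U y -> U (k *: x + y)) -> U 1 ->
  (forall a n x, U x -> U (g a n * x)) -> forall x, U x.
Hypothesis mulZr : forall k (x y : T), x * (k *: y) = k *: (x * y).
Hypothesis DL : forall a m k x y, D a m (k *: x + y) = k *: D a m x + D a m y.
Hypothesis D1 : forall a m, D a m 1 = 0.
Hypothesis Dg : forall a m b n x, D a m (g b n * x) =
  contraction a m b n *: x + eps *: (g b n * D a m x).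
Hypothesis evL : forall k x y, ev (k *: x + y) = k * ev x + ev y.
Hypothesis ev1 : ev 1 = 1.
Hypothesis evg : forall a n x, ev (g a n * x) = 0.

Let D0 a m : D a m 0 = 0. Proof. exact: plin0 (DL a m). Qed.
Let DZ a m k x : D a m (k *: x) = k *: D a m x.
Proof. exact: plinZ (DL a m) k x. Qed.
Let DB a m x y : D a m (x - y) = D a m x - D a m y.
Proof. exact: plinB (DL a m) x y. Qed.
Let DD a m x y : D a m (x + y) = D a m x + D a m y.
Proof. exact: plinD (DL a m) x y. Qed.

Let D_commutator a m b n x : D a m (D b n x) = eps *: D b n (D a m x).
Proof.
elim/T_ind: x => [|k x y IHx IHy||c l x IH].
- by rewrite !D0 scaler0.
- by rewrite !DL IHx IHy !scalerDr !scalerA [k * _]mulrC.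
- by rewrite !D1 !D0 scaler0.
- rewrite !Dg !DD !DZ !Dg IH !scalerDr !scalerA eps2 scale1r mulZr.
  by rewrite !mul1r !addrA [X in X + _]addrC.
Qed.

(** The commutator appears here without its scalar term, so that the quotient is the
    supercommutative algebra on all modes. The scalar term comes back through the contractions. *)
Inductive free_rel : set T :=
| Free_linear x y k a b n :
    free_rel (x * ((g (k *: a + b) n - k *: g a n - g b n) * y))
| Free_commutator x y a b m n :
    free_rel (x * ((g a m * g b n - eps *: (g b n * g a m)) * y)).

Local Notation R := (lspan free_rel).

Let R_D x y : x \in R -> y \in R -> x + y \in R.
Proof. by move=> hx hy; rewrite -[x]scale1r lspan_linear. Qed.

Let R_mul x y : y \in R -> x * y \in R.
Proof.
move=> /lspanP h; apply: (h [set y | x * y \in R]) => /=.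
- by rewrite mulr0 lspan0.
- by move=> k u v; rewrite mulrDr mulZr; exact: lspan_linear.
- move=> _ [x1 y1 k a b n|x1 y1 a b m n]; apply: lspan_rel; rewrite (mulrA x x1).
    exact: Free_linear.
  exact: Free_commutator.
Qed.

(** By the Leibniz rule, differentiating the left factor only produces terms that still contain
    [r * y]. It is therefore enough to differentiate the relation itself. *)
Let R_D_rel a m r : (forall y, r * y \in R) ->
  (forall y, D a m (r * y) \in R) -> forall x y, D a m (x * (r * y)) \in R.
Proof.
move=> ry Dry x y; elim/T_ind: x => [|k x1 x2 IH1 IH2||c l x IH].
- by rewrite mul0r D0 lspan0.
- by rewrite mulrDl -scalerAl DL lspan_linear.
- by rewrite mul1r.
- rewrite -mulrA Dg; apply: lspan_linear; first by apply: R_mul.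
  by apply: lspanZ; apply: R_mul.
Qed.

Let R_der a m x : x \in R -> D a m x \in R.
Proof.
move=> /lspanP h; apply: (h [set y | D a m y \in R]) => /=.
- by rewrite D0 lspan0.
- by move=> k u v; rewrite DL; exact: lspan_linear.
- move=> _ [x1 y1 k b c n|x1 y1 b c l n]; apply: R_D_rel => z.
  + by apply: lspan_rel; rewrite -[_ * z]mul1r; exact: Free_linear.
  + have -> : D a m ((g (k *: b + c) n - k *: g b n - g c n) * z) =
        eps *: ((g (k *: b + c) n - k *: g b n - g c n) * D a m z).
      by rewrite !mulrBl -!scalerAl !DB DZ !Dg contractionPr derivation_linear_rel.
    by apply: lspanZ; apply: lspan_rel; rewrite -[_ * D _ _ _]mul1r; exact: Free_linear.
  + by apply: lspan_rel; rewrite -[_ * z]mul1r; exact: Free_commutator.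
  (* The contraction with a letter of the product cancels against the contraction with the same
     letter of the reversed product. *)
  + have -> : D a m ((g b l * g c n - eps *: (g c n * g b l)) * z) =
        (g b l * g c n - eps *: (g c n * g b l)) * D a m z.
      rewrite !mulrBl -!scalerAl -!mulrA !DB !DZ !Dg !mulrDr !mulZr.
      by rewrite derivation_commutator_rel// eps2.
    by apply: lspan_rel; rewrite -[_ * D _ _ _]mul1r; exact: Free_commutator.
Qed.

Let D_linearl k a b n x : D (k *: a + b) n x = k *: D a n x + D b n x.
Proof.
elim/T_ind: x => [|l x y IHx IHy||c m x IH].
- by rewrite !D0 scaler0 addr0.
- by rewrite !DL IHx IHy !scalerDr !scalerA [l * k]mulrC !addrA (ACl (1*3*2*4))%AC.
- by rewrite !D1 scaler0 addr0.
- by rewrite !Dg IH contractionPl mulrDr mulZr linear_in_mode.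
Qed.

Let oT a n (x : T) : T := g (cre_part a n) n * x + D a n x.

Let M := lquot free_rel.
Let pr (x : T) : M := lpi free_rel x.
Let o a n (u : M) : M := pr (oT a n (lrepr u)).

Let prL k x y : pr (k *: x + y) = k *: pr x + pr y.
Proof. exact: lpi_linear. Qed.

Let prZ k x : pr (k *: x) = k *: pr x.
Proof. exact: (plinZ prL). Qed.

Let pr_eq x y : x - y \in R -> pr x = pr y.
Proof. by move=> ?; apply/lpi_eq. Qed.

Let pr_surj u : exists x, u = pr x.
Proof. by exists (lrepr u); rewrite /pr lreprK. Qed.

Let oTL a n k x y : oT a n (k *: x + y) = k *: oT a n x + oT a n y.
Proof. by rewrite /oT DL mulrDr mulZr scalerDr !addrA (ACl (1*3*2*4))%AC. Qed.

Let o_pr a n x : o a n (pr x) = pr (oT a n x).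
Proof.
apply: pr_eq; rewrite -[X in _ - X]scale1r; set y := lrepr _.
have -> : oT a n y - 1 *: oT a n x = oT a n (y - x).
  by rewrite scale1r (plinB (oTL a n)).
have xy : y - x \in R.
  by rewrite -opprB -scaleN1r; apply: lspanZ; apply: lrepr_lpi.
by apply: R_D; [apply: R_mul|apply: R_der].
Qed.

Let o_linear a n : linear (o a n).
Proof.
move=> k u v; have [x ->] := pr_surj u; have [y ->] := pr_surj v.
by rewrite -prL !o_pr oTL prL.
Qed.

Let o_linearl k a b n u : o (k *: a + b) n u = k *: o a n u + o b n u.
Proof.
have [x ->] := pr_surj u; rewrite !o_pr -prL; apply: pr_eq.
rewrite /oT D_linearl cre_partP; set u1 := D a n x; set u2 := D b n x.
set g1 := g (_ + _) n; set g2 := g _ n; set g3 := g _ n.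
have -> : g1 * x + (k *: u1 + u2) - (k *: (g2 * x + u1) + (g3 * x + u2)) =
    1 * ((g1 - k *: g2 - g3) * x).
  rewrite mul1r !mulrBl -scalerAl scalerDr.
  by rewrite !opprD !addrA (ACl (1*4*6*(2*5)*(3*7)))%AC/= !subrr !addr0.
apply: lspan_rel; exact: Free_linear.
Qed.

Let o_commutator a b m n u : o a m (o b n u) = eps *: o b n (o a m u) +
  (if mode_index true m + mode_index true n == 0 then ps_form a b else 0) *: u.
Proof.
have [x ->] := pr_surj u; rewrite !o_pr -(prZ _ x) -prL.
have -> : (mode_index true m + mode_index true n == 0) = (m + n == 0).
  by rewrite /mode_index -intrD intr_eq0.
rewrite -contraction_cre; apply: pr_eq; rewrite /oT !DD !Dg D_commutator.
set A := cre_part a m; set B := cre_part b n; set ca := contraction a _ _ _.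
set cb := contraction b _ _ _.
have -> : g A m * (g B n * x + D b n x) +
   (ca *: x + eps *: (g B n * D a m x) + eps *: D b n (D a m x)) -
   (eps *: (g B n * (g A m * x + D a m x) +
    (cb *: x + eps *: (g A m * D b n x) + D b n (D a m x))) +
   (ca - eps * cb) *: x) = 1 * ((g A m * g B n - eps *: (g B n * g A m)) * x).
  rewrite mul1r !mulrBl -!scalerAl !mulrDr -!mulrA.
  by rewrite commutator_of_sums ?eps2// addrAC addrK.
apply: lspan_rel; exact: Free_commutator.
Qed.

Let o_vacuum a n : annihilates true a n -> o a n (pr 1) = 0.
Proof.
move=> an; rewrite o_pr /oT D1 addr0.
(* The generator attached to the zero vector is nonzero in the free algebra. Linearity with
   coefficient one and zero vectors puts its opposite into the ideal. *)
have g0 m x : g 0 m * x \in R.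
  have := Free_linear 1 x 0 0 0 m => /lspan_rel.
  rewrite mul1r scale0r addr0 scale0r subr0 => h.
  have := Free_linear 1 x 1 0 0 m => /lspan_rel.
  rewrite mul1r !scale1r addr0 subrr sub0r => {}h.
  by rewrite -[g 0 m]opprK mulNr -scaleN1r; apply: lspanZ.
have -> : cre_part a n = 0.
  move: an; rewrite /annihilates /cre_part.
  by case: ltgtP => //= _ /proj_minus_plus.
have -> : (0 : M) = pr 0 by rewrite /pr (linear0 (lpi free_rel)).
by apply: pr_eq; rewrite subr0.
Qed.

Let ev0 : ev 0 = 0.
Proof. by have := evL (-1) 0 0; rewrite scaler0 addr0 mulN1r addNr. Qed.

Let evB u v : ev (u - v) = ev u - ev v.
Proof.
have -> : u - v = -1 *: v + u by rewrite scaleN1r addrC.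
by rewrite evL mulN1r addrC.
Qed.

Let evR x : x \in R -> ev x = 0.
Proof.
move=> /lspanP h; apply: (h [set y | ev y = 0]) => //=.
  by move=> k u v uz vz; rewrite evL uz vz mulr0 addr0.
have evZ k u : ev (k *: u) = k * ev u by rewrite -[_ *: u]addr0 evL ev0 addr0.
(* A nontrivial left factor starts with a generator, where [ev] vanishes. This leaves the relation
   itself, and each of its terms starts with a generator too. *)
have key r : (forall y, ev (r * y) = 0) -> forall x y, ev (x * (r * y)) = 0.
  move=> hr u y; elim/T_ind: u => [|k u v hu hv||a n u _].
  - by rewrite mul0r.
  - by rewrite mulrDl -scalerAl evL hu hv mulr0 addr0.
  - by rewrite mul1r.
  - by rewrite -mulrA evg.
move=> _ [x1 y1 k a b n|x1 y1 a b m n]; apply: key => y.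
  by rewrite !mulrBl -scalerAl !evB evZ !evg mulr0 !subr0.
by rewrite !mulrBl -scalerAl -!mulrA !evB evZ !evg mulr0 !subr0.
Qed.

(** The functional takes the constant term of the image of a vector in the model. There a mode
    without annihilation part is left multiplication by a generator, which leaves no constant
    term. *)
Lemma vacuum_functional_free : exists phi : fock P true -> K,
  [/\ forall k u v, phi (k *: u + v) = k * phi u + phi v,
      phi vacuum = 1 &
      forall a n u, ann_part a n = 0 -> phi (mode true a n u) = 0].
Proof.
pose F : fock P true -> M := fock_lift o (pr 1).
have F1 : F vacuum = pr 1 by apply: fock_lift_vacuum.
have Fm a n u : F (mode true a n u) = o a n (F u) by apply: fock_lift_mode.
have FL k u v : F (k *: u + v) = k *: F u + F v by apply: fock_lift_linear.
have ev_pr x y : pr x = pr y -> ev x = ev y.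
  by move=> /lpi_eq /evR h; apply/eqP; rewrite -subr_eq0 -evB h.
have evK x : ev (lrepr (pr x)) = ev x by apply: ev_pr; rewrite /pr lreprK.
exists (fun u => ev (lrepr (F u))); split.
- move=> k u v; rewrite FL; have [x ->] := pr_surj (F u).
  by have [y ->] := pr_surj (F v); rewrite -prL !evK evL.
- by rewrite F1 evK.
- move=> a n u an; rewrite Fm; have [x ->] := pr_surj (F u).
  rewrite o_pr evK /oT -[g _ _ * _]scale1r evL evg mulr0 add0r.
  have -> : D a n x = 0.
    elim/T_ind: x => [|k x y hx hy||b m x hx].
    - by rewrite D0.
    - by rewrite DL hx hy scaler0 addr0.
    - by rewrite D1.
    - by rewrite Dg hx mulr0 scaler0 addr0 /contraction an ps_form0l if_same scale0r.
  exact: ev0.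
Qed.

End FreeModel.
End VacuumFunctional.

Section VacuumExpectation.
Variables (K : fieldType) (p : bool) (P : polarized_space K p).
Local Notation eps := ((-1) ^+ p : K).
Local Notation T := (malg (fmonom (P * int)%type) K).

Let cons_mon (a : P) (n : int) (s : fmonom (P * int)%type) :
  fgen a n * mkmalgU s 1 = mkmalgU (FMonom ((a, n) :: s)) 1 :> T.
Proof.
have -> : FMonom ((a, n) :: s) = monalg.mul (fmu (a, n)) s.
  by apply/eqP; rewrite fmP fmM fmU.
by rewrite -[in RHS](mulr1 1); exact: fgmulUU.
Qed.

Fixpoint word_derivation (a : P) (m : int) (s : seq (P * int)) : T :=
  if s is l :: s' then contraction a m l.1 l.2 *: mkmalgU (FMonom s') 1
    + eps *: (fgen l.1 l.2 * word_derivation a m s') else 0.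

Definition derivation (a : P) (m : int) : T -> T :=
  free_lift (fun s : fmonom (P * int)%type => word_derivation a m s).

Let der_mon a m (s : fmonom (P * int)%type) :
  derivation a m (mkmalgU s 1) = word_derivation a m s.
Proof. exact: free_liftU. Qed.

Let der_linear a m : linear (derivation a m).
Proof. exact: free_lift_linear. Qed.

Let mulP (x : T) k y z : x * (k *: y + z) = k *: (x * y) + x * z.
Proof. exact: free_mull_linear. Qed.

Lemma free_algebra_ind (U : T -> Prop) : U 0 ->
  (forall k x y, U x -> U y -> U (k *: x + y)) -> U 1 ->
  (forall a n x, U x -> U (fgen a n * x)) -> forall x, U x.
Proof.
move=> U0 UL U1 Ug x; rewrite (monalgE x); elim/big_rec: _ => // s y _ Uy.
rewrite mkmalgU_scale.
apply: UL => //; rewrite -[s]fmK; elim: (fmonom_val s) => [|l s' IHs].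
  have -> // : mkmalgU (FMonom [::]) 1 = 1 :> T.
  by congr mkmalgU; apply/eqP; rewrite fmP fm1.
by have := cons_mon l.1 l.2 (FMonom s'); case: l => a n /= <-; apply: Ug.
Qed.

Let der_gen a m b n x : derivation a m (fgen b n * x) =
  contraction a m b n *: x + eps *: (fgen b n * derivation a m x).
Proof.
apply: (@malg_ext _ _ _ (fun x => derivation a m (fgen b n * x))
  (fun x => contraction a m b n *: x + eps *: (fgen b n * derivation a m x))).
- by move=> k u v; rewrite (mulP (fgen b n) k u v) (der_linear a m k).
- move=> k u v; rewrite (der_linear a m k u v).
  rewrite (mulP (fgen b n) k (derivation a m u) (derivation a m v)).
  exact: linear_pencil.
- by case=> s; rewrite (cons_mon b n (FMonom s)) !der_mon.
Qed.

Let der_one a m : derivation a m 1 = 0.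
Proof.
transitivity (word_derivation a m (monalg.one : fmonom (P * int)%type)).
  exact: der_mon.
by rewrite fm1.
Qed.

Let ev (x : T) : K := mcoeff monalg.one x.

Let ev_linear k x y : ev (k *: x + y) = k * ev x + ev y.
Proof. by rewrite /ev mcoeffD mcoeffZ. Qed.

Let ev_one : ev 1 = 1.
Proof. exact: mcoeffUU. Qed.

Let ev_gen a n x : ev (fgen a n * x) = 0.
Proof.
have evL : linear (ev : T -> K^o) by exact: ev_linear.
apply: (@malg_ext _ _ K^o (fun x => ev (fgen a n * x)) (fun=> 0)).
- by move=> k u v; rewrite (mulP (fgen a n) k u v); exact: evL.
- by move=> k u v; rewrite scaler0 addr0.
- move=> s; rewrite cons_mon /ev mcoeffU.
  suff -> : (FMonom ((a, n) :: s) == monalg.one) = false by [].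
  by rewrite fmP fm1.
Qed.

Lemma vacuum_functional : exists phi : fock P true -> K,
  [/\ forall k u v, phi (k *: u + v) = k * phi u + phi v,
      phi vacuum = 1 &
      forall a n u, ann_part a n = 0 -> phi (mode true a n u) = 0].
Proof.
apply: (@vacuum_functional_free _ _ _ T (@fgen K p P) derivation ev) => //.
- exact: free_algebra_ind.
- by move=> k x y; exact: free_mulZr.
Qed.

End VacuumExpectation.

(** * Bases of Fock modules *)

(** A common form for the dual bases given in the theorem and for bases made of eigenvectors of a
    group element. The factor [- (-1) ^+ p] is the inverse of the pairing of [pf_plus j] with
    [pf_minus j]. *)
Record polar_frame (K : fieldType) (p : bool) (P : polarized_space K p)
    (d : nat) := PolarFrame {
  pf_plus : 'I_d -> P;
  pf_minus : 'I_d -> P;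
  pf_mem_plus : forall j, pf_plus j \in ps_plus P;
  pf_mem_minus : forall j, pf_minus j \in ps_minus P;
  pf_dual : forall i j, ps_form (pf_minus i) (pf_plus j) = (i == j)%:R;
  pf_expand : forall a, a = \sum_j ps_form (pf_minus j) a *: pf_plus j
     + \sum_j (- (-1) ^+ p * ps_form (pf_plus j) a) *: pf_minus j }.

(** The index [(b, j, n)] stands for the creation operator
    [a_j^+(- (n + 1))] if [b] and [a_j^-(- n)] otherwise. *)
Definition fock_mode (d : nat) : choiceType := (bool * 'I_d * nat)%type.

(** A multiset records occupation numbers; in the Clifford case the exclusion principle allows each
    mode at most once. *)
Definition state_valid (p : bool) (I : choiceType) (s : multiset I) : bool :=
  p ==> uniq (enum_mset s).

(** Independence is encoded by linear coordinate functionals. They multiply in tensor products, and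
    they read off coefficients when joint eigenspaces are determined. *)
Definition is_basis (K : fieldType) (W : lmodType K) (S : choiceType)
    (valid : pred S) (w : S -> W) : Prop :=
  (forall u, u \in lspan (w @` [set s | valid s])) /\
  exists co : S -> W -> K,
    (forall s k u v, co s (k *: u + v) = k * co s u + co s v) /\
    (forall s t, valid s -> valid t -> co s (w t) = (s == t)%:R).

Section FockBasis.
Variables (K : numFieldType) (p : bool) (P : polarized_space K p).
Local Notation eps := ((-1) ^+ p : K).
Variables (V : lmodType K) (o : P -> int -> V -> V) (v0 : V) (phi : V -> K).
Hypothesis oL : forall a n, linear (o a n).
Hypothesis oA : forall k a b n u, o (k *: a + b) n u = k *: o a n u + o b n u.
Hypothesis oC : forall a b m n u, o a m (o b n u) = eps *: o b n (o a m u) +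
  (if m + n == 0 then ps_form a b else 0) *: u.
Hypothesis oV : forall a n, annihilates true a n -> o a n v0 = 0.
Hypothesis V_ind : forall U : set V, U 0 ->
  (forall k u v, U u -> U v -> U (k *: u + v)) -> U v0 ->
  (forall a n u, U u -> U (o a n u)) -> forall u, U u.
Hypothesis phiL : forall k u v, phi (k *: u + v) = k * phi u + phi v.
Hypothesis phi1 : phi v0 = 1.
Hypothesis phi_cre : forall a n u, ann_part a n = 0 -> phi (o a n u) = 0.

Variables (d : nat) (F : polar_frame P d).
Local Notation I := (fock_mode d).

Definition mode_vector (x : I) : P :=
  if x.1.1 then pf_plus F x.1.2 else pf_minus F x.1.2.
Definition mode_degree (x : I) : nat := if x.1.1 then x.2.+1 else x.2.
Definition dual_vector (x : I) : P :=
  if x.1.1 then pf_minus F x.1.2 else pf_plus F x.1.2.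
Definition dual_norm (x : I) : K := if x.1.1 then 1 else - eps.

Definition cre (x : I) : V -> V := o (mode_vector x) (- (mode_degree x)%:Z).
Definition ann (x : I) : V -> V := o (dual_vector x) (mode_degree x)%:Z.
Definition fock_word (s : seq I) : V := foldr cre v0 s.

Let plus_plus i j : ps_form (pf_plus F i) (pf_plus F j) = 0.
Proof. by apply: ps_plus_isotropic; apply: pf_mem_plus. Qed.
Let minus_minus i j : ps_form (pf_minus F i) (pf_minus F j) = 0.
Proof. by apply: ps_minus_isotropic; apply: pf_mem_minus. Qed.
Let plus_minus i j : ps_form (pf_plus F i) (pf_minus F j) = - eps * (i == j)%:R.
Proof. by rewrite ps_form_sym pf_dual eq_sym. Qed.

Let creL x : linear (cre x). Proof. exact: oL. Qed.
Let annL x : linear (ann x). Proof. exact: oL. Qed.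

Lemma dual_norm_neq0 x : dual_norm x != 0.
Proof. by rewrite /dual_norm; case: ifP; rewrite ?oner_eq0// oppr_eq0 signr_eq0. Qed.

Lemma ann_cre x y u :
  ann x (cre y u) = eps *: cre y (ann x u) + ((x == y)%:R * dual_norm x) *: u.
Proof.
rewrite /ann /cre oC; congr (_ + _ *: _).
case: x y => [[b i] m] [[c j] n]; rewrite /mode_vector /dual_vector /mode_degree.
rewrite /dual_norm/= subr_eq0 eqz_nat !xpair_eqE.
case: b c => [] [] /=; rewrite ?pf_dual ?plus_plus ?minus_minus ?plus_minus.
- by rewrite eqSS andbC; case: (m == n); rewrite ?mulr1 // mul0r.
- by rewrite if_same mul0r.
- by rewrite if_same mul0r.
- by rewrite andbC; case: (m == n); rewrite ?mulr1 /= ?mul0r// mulrC.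
Qed.

(** Two creation modes could pair only if both have degree zero, and then both vectors lie in the
    isotropic half [ps_minus]. *)
Lemma cre_cre x y u : cre x (cre y u) = eps *: cre y (cre x u).
Proof.
rewrite /cre oC; set f := if _ then _ else 0.
suff -> : f = 0 by rewrite scale0r addr0.
rewrite /f; case: ifP => // {f}.
case: x y => [[b i] m] [[c j] n]; rewrite /mode_vector /mode_degree /=.
rewrite -opprD oppr_eq0 -PoszD eqz_nat addn_eq0.
by case: b c => [] [] //=; rewrite ?plus_plus// ?minus_minus// ?andbF.
Qed.

Lemma ann_vacuum x : ann x v0 = 0.
Proof.
apply: oV; rewrite /annihilates /dual_vector /mode_degree.
case: x => [[[] j] n] //=.
by case: n => [|n] //; rewrite pf_mem_plus orbT.
Qed.

Lemma phi_creation x u : phi (cre x u) = 0.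
Proof.
apply: phi_cre; rewrite /ann_part /mode_vector /mode_degree.
case: x => [[[] j] n] //=; rewrite oppr_gt0 /=.
by case: n => [|n] //=; rewrite proj_plus_minus ?pf_mem_minus.
Qed.

Lemma fock_word_move s x t :
  fock_word (s ++ x :: t) = eps ^+ size s *: fock_word (x :: s ++ t).
Proof.
elim: s => [|y s IHs] /=; first by rewrite expr0 scale1r.
by rewrite IHs /= (plinZ (creL y)) cre_cre scalerA exprSr.
Qed.

Lemma fock_word_perm s t : perm_eq s t ->
  exists k : nat, fock_word s = eps ^+ k *: fock_word t.
Proof.
elim: s t => [|x s IHs] t st.
  by exists 0%N; rewrite expr0 scale1r; move: st; rewrite perm_sym => /perm_nilP ->.
have xt : x \in t by rewrite -(perm_mem st) mem_head.
move: st; case/splitPr: xt => t1 t2; rewrite perm_sym perm_catC cat_cons.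
rewrite perm_cons perm_catC perm_sym => /IHs[k hk]; exists (k + size t1)%N.
rewrite fock_word_move /= hk (plinZ (creL x)) scalerA exprD -mulrA.
by rewrite -exprD addnn -mul2n exprM expr2 eps2 expr1n mulr1.
Qed.

(** A repeated mode can be moved next to itself, and its square equals its own opposite, hence
    vanishes in characteristic zero. *)
Lemma fock_word_nonuniq s : p -> ~~ uniq s -> fock_word s = 0.
Proof.
move=> hp; elim: s => //= x s IHs; rewrite negb_and negbK => /orP[xs|/IHs ->].
  move/perm_to_rem: xs => /fock_word_perm[k ->].
  rewrite (plinZ (creL x)) /=; set u := cre x _.
  suff -> : u = 0 by rewrite scaler0.
  have := cre_cre x x (fock_word (rem x s)); rewrite hp expr1 scaleN1r => /eqP.
  by rewrite -addr_eq0 -mulr2n -scaler_nat scaler_eq0 pnatr_eq0 => /eqP.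
exact: plin0 (creL x).
Qed.

Let ann_word_clifford x s : p -> uniq s -> exists c : K,
  (c == 0) = (x \notin s) /\ ann x (fock_word s) = c *: fock_word (rem x s).
Proof.
move=> hp; elim: s => [|y s IHs] /=.
  by move=> _; exists 0; rewrite eqxx ann_vacuum scale0r.
case/andP=> ys us; have [c [c0 hc]] := IHs us; rewrite ann_cre hc.
move: c0; rewrite inE [x == y]eq_sym; have [<-|xy] := eqVneq y x => /= c0.
  exists (dual_norm y); rewrite (negbTE (dual_norm_neq0 y)) mul1r.
  by move: c0; rewrite ys => /eqP ->; rewrite scale0r (plin0 (creL y)) scaler0 add0r.
exists (eps * c); rewrite mul0r scale0r addr0 (plinZ (creL y)) scalerA.
by rewrite mulf_eq0 signr_eq0.
Qed.

Let ann_word_weyl x s : ~~ p ->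
  ann x (fock_word s) = (dual_norm x * (count_mem x s)%:R) *: fock_word (rem x s).
Proof.
move=> hp; elim: s => [|y s IHs] /=.
  by rewrite ann_vacuum mulr0 scale0r.
rewrite ann_cre IHs (negbTE hp) expr0 scale1r (plinZ (creL y)).
rewrite [x == y]eq_sym; have [<-|xy] := eqVneq y x => /=; last first.
  by rewrite mul0r scale0r addr0 add0n.
rewrite mul1r natrD mulrDr mulr1 addrC scalerDl; congr (_ + _).
have [ys|ys] := boolP (y \in s); last first.
  by move/count_memPn: ys => ->; rewrite mulr0 !scale0r.
move/perm_to_rem: ys => /fock_word_perm[k hk]; congr (_ *: _).
by rewrite hk (negbTE hp) expr0 expr1n scale1r.
Qed.

Let ann_word x s : p ==> uniq s -> exists c : K,
  (c == 0) = (x \notin s) /\ ann x (fock_word s) = c *: fock_word (rem x s).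
Proof.
have [hp us|hp _] := boolP p; first exact: ann_word_clifford.
exists (dual_norm x * (count_mem x s)%:R); split; last exact: ann_word_weyl.
rewrite mulf_eq0 (negbTE (dual_norm_neq0 x)) /= pnatr_eq0.
exact: sameP eqP count_memPn.
Qed.

Definition ann_seq (s : seq I) (u : V) : V := foldl (fun u x => ann x u) u s.

Let pairing s u : K := phi (ann_seq s u).

Let pairingL s k u v : pairing s (k *: u + v) = k * pairing s u + pairing s v.
Proof.
rewrite /pairing; elim: s u v => [|x s IHs] u v; first exact: phiL.
by rewrite /= annL IHs.
Qed.

Let pairing0 s : pairing s 0 = 0.
Proof. by have := pairingL s (-1) 0 0; rewrite scaler0 addr0 mulN1r addNr. Qed.

(** Each annihilator removes one matching letter up to a nonzero scalar, and kills the word if there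
    is none. Once the letters of [s] are used up, [phi] tells the vacuum from a word that still
    contains a creation mode. Normalized, these pairings are the coordinates. *)
Let pairingP s t : p ==> uniq t ->
  (pairing s (fock_word t) == 0) = ~~ perm_eq s t.
Proof.
elim: s t => [|x s IHs] t vt.
  rewrite /pairing /=; case: t vt => [|y t] vt /=.
    by rewrite phi1 oner_eq0.
  by rewrite phi_creation eqxx; apply/esym/negP => /perm_size.
have [c [c0 hc]] := ann_word x vt; rewrite /pairing /= hc.
rewrite -/(pairing s (c *: _)) -[c *: _]addr0 pairingL pairing0 addr0 mulf_eq0 c0.
have [xt|xt] /= := boolP (x \in t); last first.
  by symmetry; apply/negP => /perm_mem/(_ x); rewrite mem_head (negbTE xt).
rewrite IHs; first by rewrite (permPr (perm_to_rem xt)) perm_cons.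
by apply/implyP => hp; apply: rem_uniq; move: vt; rewrite hp.
Qed.

Let expand_mode a n u : o a n u =
  \sum_j ps_form (pf_minus F j) a *: o (pf_plus F j) n u
  + \sum_j (- eps * ps_form (pf_plus F j) a) *: o (pf_minus F j) n u.
Proof.
have o0 : o 0 n u = 0.
  by have := oA (-1) 0 0 n u; rewrite scaler0 addr0 scaleN1r addNr.
have oD b c : o (b + c) n u = o b n u + o c n u.
  by rewrite -[b in LHS]scale1r oA scale1r.
have oZ k b : o (k *: b) n u = k *: o b n u.
  by rewrite -[k *: b]addr0 oA o0 addr0.
rewrite {1}(pf_expand F a) oD.
have oS (G : 'I_d -> P) : o (\sum_j G j) n u = \sum_j o (G j) n u.
  exact: (big_morph (fun b => o b n u)).
by rewrite !oS; congr (_ + _); apply: eq_bigr => j _; rewrite oZ.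
Qed.

Lemma fock_word_basis :
  is_basis (@state_valid p I) (fun s : multiset I => fock_word (enum_mset s)).
Proof.
pose w (s : multiset I) := fock_word (enum_mset s).
pose S := lspan (w @` [set s : multiset I | state_valid p s]).
split; last first.
  exists (fun s u => (pairing (enum_mset s) (w s))^-1 * pairing (enum_mset s) u).
  split=> [s k u v|s t vs vt]; first by rewrite pairingL mulrDr mulrCA.
  have [<-|st] := eqVneq s t.
    by rewrite mulVf// (pairingP _ vs) negbK.
  have /eqP -> : pairing (enum_mset s) (w t) == 0; last by rewrite mulr0.
  rewrite (pairingP _ vt); apply: contra st => /eq_seq_msetP.
  by rewrite !seq_mset_id => ->.
have SL k u v : u \in S -> v \in S -> k *: u + v \in S by exact: lspan_linear.
have S0 : 0 \in S by exact: lspan0.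
have SZ k u : u \in S -> k *: u \in S by exact: lspanZ.
have Sw s : fock_word s \in S.
  have [us|us] := boolP (p ==> uniq s); last first.
    by move: us; rewrite negb_imply => /andP[hp us]; rewrite fock_word_nonuniq.
  have /fock_word_perm[k ->] : perm_eq s (seq_mset s).
    by rewrite perm_sym perm_eq_seq_mset.
  apply: SZ; apply: lspan_rel; exists (seq_mset s) => //=.
  by rewrite /state_valid (perm_uniq (perm_eq_seq_mset s)).
have Scre x u : u \in S -> cre x u \in S.
  move=> /lspanP h; apply: (h [set u | cre x u \in S]) => /=.
  - by rewrite (plin0 (creL x)).
  - by move=> k y z hy hz; rewrite creL; apply: SL.
  - by move=> _ [s _ <-]; exact: (Sw (x :: enum_mset s)).
have Sann x u : u \in S -> ann x u \in S.
  move=> /lspanP h; apply: (h [set u | ann x u \in S]) => /=.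
  - by rewrite (plin0 (annL x)).
  - by move=> k y z hy hz; rewrite annL; apply: SL.
  move=> _ [s _ <-]; rewrite /w /=; elim: (enum_mset s) => [|y t IHt] /=.
    by rewrite ann_vacuum.
  by rewrite ann_cre; apply: SL; [apply: Scre|apply: SZ; apply: Sw].
have Ssum (G : 'I_d -> V) : (forall j, G j \in S) -> \sum_j G j \in S.
  by move=> h; elim/big_rec: _ => // j u _ hu; rewrite -[G j]scale1r; apply: SL.
apply: V_ind => //; first exact: (Sw [::]).
move=> a n u Su; rewrite expand_mode -[X in X + _]scale1r.
(* Each mode of a frame vector either creates or annihilates, according to the sign of [n]. For
   [n = 0] the vector [pf_plus] annihilates and [pf_minus] creates. *)
have Sp j : o (pf_plus F j) n u \in S.
  have [n0|n0] := leP 0 n.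
    by have := Sann (false, j, `|n|%N) u Su; rewrite /ann /= gez0_abs.
  have := Scre (true, j, `|n|.-1%N) u Su; rewrite /cre /mode_degree /=.
  by rewrite prednK ?absz_gt0 ?lt_eqF// ltz0_abs// opprK.
have Sm j : o (pf_minus F j) n u \in S.
  have [n0|n0] := ltP 0 n.
    have := Sann (true, j, `|n|.-1%N) u Su; rewrite /ann /mode_degree /=.
    by rewrite prednK ?absz_gt0 ?gt_eqF// gtz0_abs.
  by have := Scre (false, j, `|n|%N) u Su; rewrite /cre /= lez0_abs// opprK.
by apply: SL; apply: Ssum => j; apply: SZ.
Qed.

End FockBasis.

(** * The operators J(0) and L(0) *)

Section Gbinom.
Variable K : numFieldType.

Lemma gbinom0 x : gbinom K x 0 = 1.
Proof. by rewrite /gbinom big_ord0 divr1 rmorph1. Qed.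

Lemma gbinom_half1 : gbinom K (1 / 2) 1 = 2^-1.
Proof.
by rewrite /gbinom big_ord1 subr0 divr1 mul1r fmorphV rmorph_nat.
Qed.

Lemma gbinom_half2 : gbinom K (1 / 2) 2 = - 8^-1.
Proof.
rewrite /gbinom big_ord_recl big_ord1 subr0.
have -> : 1 / 2 * (1 / 2 - (lift ord0 ord0 : 'I_2)%:R) / 2`!%:R = - 8^-1 :> rat.
  by rewrite [X in _ - X](_ : _ = 1)// [X in _ / X](_ : _ = 2)//; field.
by rewrite rmorphN fmorphV rmorph_nat.
Qed.

Lemma gbinomN1 i : (-1) ^+ i * gbinom K (-1) i = 1.
Proof.
have H : \prod_(j < i) (-1 - j%:R) = (-1) ^+ i * i`!%:R :> rat.
  elim: i => [|i IHi]; first by rewrite big_ord0 mulr1.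
  by rewrite big_ord_recr IHi /= factS natrM exprS -natr1; ring.
rewrite /gbinom H mulfK; last by rewrite pnatr_eq0 -lt0n fact_gt0.
by rewrite rmorphXn rmorphN rmorph1 -exprMn mulrNN mulr1 expr1n.
Qed.

Lemma gbinomN2 i : (-1) ^+ i * gbinom K (-2) i = i.+1%:R.
Proof.
have H : \prod_(j < i) (-2 - j%:R) = (-1) ^+ i * i.+1%:R * i`!%:R :> rat.
  elim: i => [|i IHi]; first by rewrite big_ord0 !mulr1.
  by rewrite big_ord_recr IHi /= factS natrM exprS -!natr1; ring.
rewrite /gbinom H mulfK; last by rewrite pnatr_eq0 -lt0n fact_gt0.
rewrite rmorphM rmorphXn rmorphN rmorph1 rmorph_nat mulrA -exprMn mulrNN mulr1.
by rewrite expr1n mul1r.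
Qed.

End Gbinom.

Section QuadraticOperators.
Variables (K : numFieldType) (p : bool) (P : polarized_space K p).
Local Notation eps := ((-1) ^+ p : K).
Variables (V : lmodType K) (o : P -> int -> V -> V) (v0 : V).
Hypothesis oL : forall a n, linear (o a n).
Hypothesis oA : forall k a b n u, o (k *: a + b) n u = k *: o a n u + o b n u.
Hypothesis oC : forall a b m n u, o a m (o b n u) = eps *: o b n (o a m u) +
  (if m + n == 0 then ps_form a b else 0) *: u.
Hypothesis oV : forall a n, annihilates true a n -> o a n v0 = 0.
Variables (d : nat) (F : polar_frame P d).

(** Up to a constant, [J(0)] and [L(0)] are weighted sums over [k] of these operators and of
    [quad_minus]. *)
Definition quad_plus (k : int) (u : V) : V :=
  \sum_i o (pf_plus F i) (- k) (o (pf_minus F i) k u).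
Definition quad_minus (k : int) (u : V) : V :=
  \sum_i o (pf_minus F i) (- k) (o (pf_plus F i) k u).

Let quad_commutator a b z k n u : o a (- k) (o b k (o z n u)) =
  o z n (o a (- k) (o b k u))
  + ((if n == k then eps * ps_form a z else 0) *: o b k u
  + (if n == - k then ps_form b z else 0) *: o a (- k) u).
Proof.
rewrite (oC b z k n) (oL a) (plinZ (oL a _)) (oC a z).
rewrite scalerDr !scalerA -expr2 sqrr_sign scale1r -!addrA; congr (_ + _).
rewrite [- k + n]addrC subr_eq0 [k + n]addrC addr_eq0.
by rewrite (fun_if ( *%R eps)) mulr0.
Qed.

Let sum_plus z n u : z \in ps_plus P ->
  \sum_i ps_form (pf_minus F i) z *: o (pf_plus F i) n u = o z n u.
Proof.
move=> zp; have -> : o z n u = o (\sum_i ps_form (pf_minus F i) z *: pf_plus F i) n u.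
  rewrite {1}(pf_expand F z) [X in _ + X]big1 ?addr0// => i _.
  by rewrite (ps_plus_isotropic (pf_mem_plus F i) zp) mulr0 scale0r.
have oaL : linear (fun a => o a n u) by move=> k a b; exact: oA.
by rewrite (plin_sum oaL); apply: eq_bigr => i _; rewrite (plinZ oaL).
Qed.

Let sum_minus z n u : z \in ps_minus P ->
  \sum_i (eps * ps_form (pf_plus F i) z) *: o (pf_minus F i) n u = - o z n u.
Proof.
move=> zm; have -> : o z n u =
    o (\sum_i (- eps * ps_form (pf_plus F i) z) *: pf_minus F i) n u.
  rewrite {1}(pf_expand F z) [X in X + _]big1 ?add0r// => i _.
  by rewrite (ps_minus_isotropic (pf_mem_minus F i) zm) scale0r.
have oaL : linear (fun a => o a n u) by move=> k a b; exact: oA.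
rewrite (plin_sum oaL) -sumrN; apply: eq_bigr => i _.
by rewrite (plinZ oaL) mulNr scaleNr opprK.
Qed.

(** Of the two contractions with [z] one vanishes by isotropy, and the other sums over the frame to
    [z] itself. The three lemmas that follow rest on the same argument. *)
Lemma quad_plus_plus z k n u : z \in ps_plus P -> quad_plus k (o z n u) =
  o z n (quad_plus k u) + (n == - k)%:R *: o z n u.
Proof.
move=> zp; rewrite /quad_plus (plin_sum (oL z n)).
under eq_bigr do rewrite quad_commutator.
rewrite big_split; congr (_ + _) => /=.
under eq_bigr => i _ do rewrite (ps_plus_isotropic (pf_mem_plus F i) zp) mulr0
  if_same scale0r add0r.
have [->|_] := eqVneq n (- k); last first.
  by rewrite scale0r big1// => i _; rewrite scale0r.
by rewrite sum_plus// scale1r.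
Qed.

Lemma quad_plus_minus z k n u : z \in ps_minus P -> quad_plus k (o z n u) =
  o z n (quad_plus k u) - (n == k)%:R *: o z n u.
Proof.
move=> zm; rewrite /quad_plus (plin_sum (oL z n)).
under eq_bigr do rewrite quad_commutator.
rewrite big_split; congr (_ + _) => /=.
under eq_bigr => i _ do rewrite (ps_minus_isotropic (pf_mem_minus F i) zm)
  if_same scale0r addr0.
have [->|_] := eqVneq n k; last first.
  by rewrite scale0r oppr0 big1// => i _; rewrite scale0r.
by rewrite sum_minus// scale1r.
Qed.

Lemma quad_minus_plus z k n u : z \in ps_plus P -> quad_minus k (o z n u) =
  o z n (quad_minus k u) + (eps * (n == k)%:R) *: o z n u.
Proof.
move=> zp; rewrite /quad_minus (plin_sum (oL z n)).
under eq_bigr do rewrite quad_commutator.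
rewrite big_split; congr (_ + _) => /=.
under eq_bigr => i _ do rewrite (ps_plus_isotropic (pf_mem_plus F i) zp)
  if_same scale0r addr0.
have [->|_] := eqVneq n k; last first.
  by rewrite mulr0 scale0r big1// => i _; rewrite scale0r.
rewrite mulr1 -(sum_plus k u zp) scaler_sumr; apply: eq_bigr => i _.
by rewrite scalerA.
Qed.

Lemma quad_minus_minus z k n u : z \in ps_minus P -> quad_minus k (o z n u) =
  o z n (quad_minus k u) - (eps * (n == - k)%:R) *: o z n u.
Proof.
move=> zm; rewrite /quad_minus (plin_sum (oL z n)).
under eq_bigr do rewrite quad_commutator.
rewrite big_split; congr (_ + _) => /=.
under eq_bigr => i _ do rewrite (ps_minus_isotropic (pf_mem_minus F i) zm)
  mulr0 if_same scale0r add0r.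
have [->|_] := eqVneq n (- k); last first.
  by rewrite mulr0 scale0r oppr0 big1// => i _; rewrite scale0r.
rewrite mulr1 -scalerN -sum_minus// scaler_sumr; apply: eq_bigr => i _.
by rewrite scalerA mulrA eps2 mul1r.
Qed.

Lemma quad_minus_vacuum k : 0 <= k -> quad_minus k v0 = 0.
Proof.
move=> k0; rewrite /quad_minus big1// => i _.
by rewrite oV ?(plin0 (oL _ _))// /annihilates pf_mem_plus andbT orbC eq_sym -le_eqVlt.
Qed.

Lemma quad_plus_vacuum k : 0 < k -> quad_plus k v0 = 0.
Proof.
move=> k0; rewrite /quad_plus big1// => i _.
by rewrite oV ?(plin0 (oL _ _))// /annihilates k0.
Qed.

(** For [k = 0] the annihilator [pf_plus i] stands on the left; moving it to the vacuum produces the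
    scalar [- eps] for each [i]. *)
Lemma quad_plus_vacuum0 : quad_plus 0 v0 = (- eps * d%:R) *: v0.
Proof.
rewrite /quad_plus oppr0 (eq_bigr (fun=> - eps *: v0)); last first.
  move=> i _; rewrite oC addr0 eqxx.
  have -> : o (pf_plus F i) 0 v0 = 0.
    by apply: oV; rewrite /annihilates pf_mem_plus orbT.
  by rewrite (plin0 (oL _ _)) scaler0 add0r ps_form_sym pf_dual eqxx mulr1.
by rewrite sumr_const card_ord -scaler_nat scalerA mulrC.
Qed.

Variables (J L : V -> V).
Hypothesis JE : forall w, exists N0 : nat, forall N : nat, (N0 <= N)%N ->
  J w = \sum_(k < N) (quad_plus k%:Z w + eps *: quad_minus k.+1%:Z w)
        + (eps * d%:R / 2) *: w.
Hypothesis LE : forall w, exists N0 : nat, forall N : nat, (N0 <= N)%N ->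
  L w = \sum_(k < N) (k.+1%:R *: (quad_plus k.+1%:Z w - eps *: quad_minus k.+1%:Z w))
        - (eps * d%:R / 8) *: w.

Let sum_delta (R : pzRingType) (g : nat -> R) m N : (m < N)%N ->
  \sum_(k < N) g k * (k == m :> nat)%:R = g m.
Proof.
move=> mN; rewrite (bigD1 (Ordinal mN))//= eqxx mulr1 big1 ?addr0// => i.
by rewrite -val_eqE /= => /negbTE ->; rewrite mulr0.
Qed.

Let eqNz (m k : nat) : (Posz m == - k%:Z) = (m == 0)%N && (k == 0)%N.
Proof. by rewrite -addr_eq0 -PoszD eqz_nat addn_eq0. Qed.

Let sum_sign_delta (g : nat -> K) (n : int) N : (`|n| < N)%N ->
  \sum_(k < N) g k.+1 * ((n == - k.+1%:Z)%:R - (n == k.+1%:Z)%:R) =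
  if n == 0 then 0 else if 0 < n then - g `|n|%N else g `|n|%N.
Proof.
move=> nN; case: n nN => [[|n]|n] nN.
- by rewrite big1// => i _; rewrite eqNz andbF eqz_nat subrr mulr0.
- under eq_bigr => i _ do rewrite eqNz andbF sub0r mulrN eqz_nat eqSS eq_sym.
  by rewrite sumrN (sum_delta (fun k => g k.+1))//; apply: ltnW.
- under eq_bigr => i _ do rewrite [X in _ - X](_ : _ = 0)// subr0 NegzE eqr_opp eqz_nat eqSS eq_sym.
  by rewrite (sum_delta (fun k => g k.+1))//; apply: ltnW.
Qed.

(** Every integer equals [- k] or [k + 1] for exactly one natural number [k]. *)
Let sum_delta2 (n : int) N : (`|n| < N)%N ->
  \sum_(k < N) ((n == - k%:Z)%:R + (n == k.+1%:Z)%:R) = 1 :> K.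
Proof.
move=> nN; rewrite big_split /=; case: n nN => [[|n]|n] nN.
- rewrite [X in _ + X]big1 ?addr0; last by move=> i _; rewrite eqz_nat.
  under eq_bigr => i _ do rewrite eqNz eqxx /= -[_%:R]mul1r.
  by rewrite (sum_delta (fun=> 1)).
- rewrite [X in X + _]big1 ?add0r; last by move=> i _; rewrite eqNz.
  under eq_bigr => i _ do rewrite eqz_nat eqSS eq_sym -[_%:R]mul1r.
  by rewrite (sum_delta (fun=> 1))//; apply: ltnW.
- rewrite [X in _ + X]big1 ?addr0; last by move=> i _.
  under eq_bigr => i _ do rewrite NegzE eqr_opp eqz_nat eq_sym -[_%:R]mul1r.
  by rewrite (sum_delta (fun=> 1)).
Qed.

Let sum_delta3 (n : int) N : (`|n| < N)%N ->
  \sum_(k < N) ((n == k%:Z)%:R + (n == - k.+1%:Z)%:R) = 1 :> K.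
Proof.
move=> nN; rewrite -[RHS](@sum_delta2 (- n) N) ?abszN//; apply: eq_bigr => i _.
by rewrite eqr_opp eqr_oppLR.
Qed.

Lemma current_plus z n u : z \in ps_plus P ->
  J (o z n u) = o z n (J u) + o z n u.
Proof.
move=> zp; have [N1 h1] := JE (o z n u); have [N2 h2] := JE u.
(* Beyond both truncation bounds, and beyond the absolute value of [n], so that the single term
   which contracts with [z] occurs in the sum. *)
pose N := maxn (maxn N1 N2) `|n|.+1.
have N1N : (N1 <= N)%N by rewrite /N !leq_max leqnn.
have N2N : (N2 <= N)%N by rewrite /N !leq_max leqnn !orbT.
rewrite (h1 N N1N) (h2 N N2N) (plinD (oL z n)) (plinZ (oL z n)) addrAC.
congr (_ + _); rewrite (plin_sum (oL z n)).
have E : o z n u = (\sum_(k < N) ((n == - k%:Z)%:R + (n == k.+1%:Z)%:R)) *: o z n u.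
  by rewrite sum_delta2 ?scale1r// /N leq_max leqnn orbT.
rewrite [X in _ + X]E.
rewrite scaler_suml -big_split; apply: eq_bigr => k _ /=.
rewrite quad_plus_plus// quad_minus_plus// (plinD (oL z n)) (plinZ (oL z n)).
rewrite scalerDr scalerA mulrA eps2 mul1r scalerDl !addrA.
by rewrite (ACl (1*3*2*4))%AC.
Qed.

Lemma current_minus z n u : z \in ps_minus P ->
  J (o z n u) = o z n (J u) - o z n u.
Proof.
move=> zp; have [N1 h1] := JE (o z n u); have [N2 h2] := JE u.
pose N := maxn (maxn N1 N2) `|n|.+1.
have N1N : (N1 <= N)%N by rewrite /N !leq_max leqnn.
have N2N : (N2 <= N)%N by rewrite /N !leq_max leqnn !orbT.
rewrite (h1 N N1N) (h2 N N2N) (plinD (oL z n)) (plinZ (oL z n)) addrAC.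
congr (_ + _); rewrite (plin_sum (oL z n)).
have E : o z n u = (\sum_(k < N) ((n == k%:Z)%:R + (n == - k.+1%:Z)%:R)) *: o z n u.
  by rewrite sum_delta3 ?scale1r// /N leq_max leqnn orbT.
rewrite [X in _ - X]E.
rewrite scaler_suml -sumrN -big_split; apply: eq_bigr => k _ /=.
rewrite quad_plus_minus// quad_minus_minus// (plinD (oL z n)) (plinZ (oL z n)).
rewrite scalerBr scalerA mulrA eps2 mul1r scalerDl opprD !addrA.
by rewrite (ACl (1*3*2*4))%AC.
Qed.

Let conformal_mode z n u (zP : forall k, 
    quad_plus k (o z n u) - eps *: quad_minus k (o z n u) =
    o z n (quad_plus k u - eps *: quad_minus k u)
    + ((n == - k)%:R - (n == k)%:R) *: o z n u) :
  L (o z n u) = o z n (L u) - n%:~R *: o z n u.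
Proof.
have [N1 h1] := LE (o z n u); have [N2 h2] := LE u.
pose N := maxn (maxn N1 N2) `|n|.+1.
have N1N : (N1 <= N)%N by rewrite /N !leq_max leqnn.
have N2N : (N2 <= N)%N by rewrite /N !leq_max leqnn !orbT.
rewrite (h1 N N1N) (h2 N N2N) (plinB (oL z n)) (plinZ (oL z n)) addrAC.
congr (_ - _); rewrite (plin_sum (oL z n)).
have -> : - (n%:~R *: o z n u) = (\sum_(k < N) k.+1%:R *
    ((n == - k.+1%:Z)%:R - (n == k.+1%:Z)%:R)) *: o z n u.
  rewrite (@sum_sign_delta (fun k => k%:R)); last by rewrite /N leq_max leqnn orbT.
  rewrite -scaleNr; congr (_ *: _).
  case: ltgtP => [n0|n0|<-]; rewrite ?oppr0//.
    by rewrite -{1}(gtz0_abs n0).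
  by rewrite -mulrNz -(ltz0_abs n0).
rewrite scaler_suml -big_split; apply: eq_bigr => k _ /=.
by rewrite zP scalerDr (plinZ (oL z n)) scalerA.
Qed.

Lemma conformal_plus z n u : z \in ps_plus P ->
  L (o z n u) = o z n (L u) - n%:~R *: o z n u.
Proof.
move=> zp; apply: conformal_mode => k.
rewrite quad_plus_plus// quad_minus_plus// (plinB (oL z n)) (plinZ (oL z n)).
rewrite scalerDr scalerA mulrA eps2 mul1r scalerBl opprD !addrA.
by rewrite (ACl (1*3*2*4))%AC.
Qed.

Lemma conformal_minus z n u : z \in ps_minus P ->
  L (o z n u) = o z n (L u) - n%:~R *: o z n u.
Proof.
move=> zp; apply: conformal_mode => k.
rewrite quad_plus_minus// quad_minus_minus// (plinB (oL z n)) (plinZ (oL z n)).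
rewrite scalerBr scalerA mulrA eps2 mul1r scalerBl opprB !addrA.
by rewrite (ACl (1*4*3*2))%AC.
Qed.

(** Only the zero modes at [k = 0] survive. They give [- eps * d], half of which is offset by the
    constant [eps * d / 2]. *)
Lemma current_vacuum : J v0 = (- eps * d%:R / 2) *: v0.
Proof.
have [N1 h] := JE v0; rewrite (h N1.+1)// big_ord_recl /= big1 => [|i _].
  rewrite addr0 quad_plus_vacuum0 quad_minus_vacuum// scaler0 addr0 -scalerDl.
  by congr (_ *: _); field.
by rewrite quad_plus_vacuum// quad_minus_vacuum// scaler0 addr0.
Qed.

Lemma conformal_vacuum : L v0 = (- eps * d%:R / 8) *: v0.
Proof.
have [N1 h] := LE v0; rewrite (h N1)// big1 => [|i _].
  by rewrite add0r -scaleNr !mulNr.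
by rewrite quad_plus_vacuum// quad_minus_vacuum// scaler0 subr0 scaler0.
Qed.

Variable (d' : nat) (F' : polar_frame P d').

(** The words are built from a second frame [F']: the operators come from given dual bases, whereas
    the words are to be eigenvectors of a group element. Only membership of a vector in one of the
    two halves matters. *)
Lemma current_word s : J (fock_word o v0 F' s) =
  (- eps * d%:R / 2 + (\sum_(x <- s) (-1) ^+ (~~ x.1.1) : int)%:~R) *:
  fock_word o v0 F' s.
Proof.
elim: s => [|x s IHs].
  by rewrite big_nil addr0 current_vacuum.
rewrite big_cons intrD /= /cre /mode_vector.
case: x => [[[] j] n] /=.
  rewrite current_plus ?pf_mem_plus// IHs (plinZ (oL _ _)) expr0.
  by rewrite [1%:~R + _]addrC [in RHS]addrA [RHS]scalerDl scale1r.
rewrite current_minus ?pf_mem_minus// IHs (plinZ (oL _ _)) expr1 mulrN1z.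
by rewrite [-1 + _]addrC [in RHS]addrA [RHS]scalerDl scaleN1r.
Qed.

Lemma conformal_word s : L (fock_word o v0 F' s) =
  (- eps * d%:R / 8 + (\sum_(x <- s) mode_degree x)%N%:R) *:
  fock_word o v0 F' s.
Proof.
elim: s => [|x s IHs].
  by rewrite big_nil addr0 conformal_vacuum.
rewrite big_cons natrD /= /cre.
have E z n u : z = mode_vector F' x -> L (o z n u) = o z n (L u) - n%:~R *: o z n u.
  rewrite /mode_vector => ->; case: ifP => _.
    by apply: conformal_plus; apply: pf_mem_plus.
  by apply: conformal_minus; apply: pf_mem_minus.
rewrite E// IHs (plinZ (oL _ _)) [(mode_degree x)%:R + _]addrC addrA [RHS]scalerDl.
by rewrite mulrNz scaleNr opprK.
Qed.

End QuadraticOperators.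

(** * Quadratic fields from the Jacobi identity *)

Section TwistedFields.
Variables (K : numFieldType) (p : bool) (P : polarized_space K p).
Local Notation eps := ((-1) ^+ p : K).
Variables (V0 V : lmodType K) (m0 : P -> int -> V0 -> V0) (vac : V0).
Variables (o : P -> int -> V -> V) (Y0 : fields V0 V0) (Y : fields V0 V).
Hypothesis mL : forall a n, linear (m0 a n).
Hypothesis mC : forall a b m n u, m0 a m (m0 b n u) = eps *: m0 b n (m0 a m u) +
  (if m + n + 1 == 0 then ps_form a b else 0) *: u.
Hypothesis mV : forall a n, 0 <= n -> m0 a n vac = 0.
Local Notation gen a := (m0 a (-1) vac).
Hypothesis Y0_gen : forall a (n : int) u, Y0 (gen a) n%:~R u = m0 a n u.
Hypothesis Y_gen : forall a (n : int) u, Y (gen a) (n%:~R - 1 / 2) u = o a n u.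
Hypothesis Y_vac : forall n w, Y vac n w = if n == -1 then w else 0.
Hypothesis Y_linear : forall n w, linear (fun a => Y a n w).
Hypothesis Y_jacobi : forall a b w (l : int) (m n : rat),
  m - 1 / 2 \is a Num.int -> n - 1 / 2 \is a Num.int ->
  exists N0 : nat, forall N : nat, (N0 <= N)%N ->
  \sum_(i < N) gbinom K m i *: Y (Y0 (gen a) (l%:~R + i%:R) (gen b)) (m + n - i%:R) w =
  \sum_(i < N) ((-1) ^+ i * gbinom K l%:~R i) *:
    (Y (gen a) (m + l%:~R - i%:R) (Y (gen b) (n + i%:R) w)
     - (eps * (-1) ^ l) *: Y (gen b) (n + l%:~R - i%:R) (Y (gen a) (m + i%:R) w)).

Let gen_pos a b k : m0 a k%:Z (gen b) = (if k == 0%N then ps_form a b else 0) *: vac.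
Proof.
rewrite mC mV// (plin0 (mL _ _)) scaler0 add0r.
by rewrite -addrA addNr addr0 eqz_nat.
Qed.

(** This is the Jacobi identity with [l = -1], [m = 1/2], [n = -1/2], for which every coefficient on
    the right is one. On the left only two terms survive; the second is a multiple of the vacuum,
    and its coefficient [binom(1/2, 1) = 1/2] explains the constant. *)
Lemma current_field a b w : exists N0 : nat, forall N : nat, (N0 <= N)%N ->
  Y (m0 a (-1) (gen b)) 0 w + (ps_form a b / 2) *: w =
  \sum_(k < N) (o a (- k%:Z) (o b k%:Z w)
    + eps *: o b (- k.+1%:Z) (o a k.+1%:Z w)).
Proof.
have h1 : (1 / 2 : rat) - 1 / 2 \is a Num.int by rewrite subrr.
have h2 : (- (1 / 2) : rat) - 1 / 2 \is a Num.int.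
  by rewrite (_ : _ - _ = -1)// ?rpredN ?rpred1//; field.
have [N0 h] := Y_jacobi a b w (-1) h1 h2; exists N0.+2 => N hN.
have N0N : (N0 <= N)%N by do 2 apply: ltnW.
have := h N N0N; case: N hN {N0N} => [//|[//|N]] hN.
rewrite [in LHS]big_ord_recl [in LHS]big_ord_recl /= big1 => [|i _]; last first.
  have -> : (-1)%:~R + (bump 0 (bump 0 i))%:R = i.+1%:Z%:~R :> rat.
    by rewrite /bump /= !add1n -!natr1; ring.
  by rewrite Y0_gen gen_pos /= scale0r (plin0 (Y_linear _ _)) scaler0.
rewrite gbinom0 gbinom_half1 scale1r addr0 addr0.
rewrite Y0_gen; have -> : (-1)%:~R + (bump 0 0)%:R = 0%:Z%:~R :> rat by [].
rewrite Y0_gen gen_pos /= (plinZ (Y_linear _ _)) Y_vac addr0 subrr sub0r eqxx.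
rewrite scalerA [2^-1 * _]mulrC => ->; apply: eq_bigr => i _.
rewrite gbinomN1 scale1r.
have -> : 1 / 2 + (-1)%:~R - i%:R = (- i%:Z)%:~R - 1 / 2 :> rat.
  by rewrite !mulrNz -!pmulrn; field.
have -> : - (1 / 2) + i%:R = i%:Z%:~R - 1 / 2 :> rat by rewrite -pmulrn addrC.
have -> : - (1 / 2) + (-1)%:~R - i%:R = (- i.+1%:Z)%:~R - 1 / 2 :> rat.
  by rewrite !mulrNz -!pmulrn -natr1; field.
have -> : 1 / 2 + i%:R = i.+1%:Z%:~R - 1 / 2 :> rat.
  by rewrite -!pmulrn -natr1; field.
rewrite !Y_gen; congr (_ + _).
by rewrite -scaleNr; congr (_ *: _); rewrite exprN1 invrN1 mulrN1 opprK.
Qed.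

(** This is the Jacobi identity with [l = -2] and [m = n = 1/2], for which the coefficients on the
    right are [k + 1]. The constant comes from [binom(1/2, 2) = - 1/8], the coefficient of the
    vacuum term on the left. *)
Lemma conformal_field a b w : exists N0 : nat, forall N : nat, (N0 <= N)%N ->
  Y (m0 a (-2) (gen b)) 1 w + 2^-1 *: Y (m0 a (-1) (gen b)) 0 w
    - (ps_form a b / 8) *: w =
  \sum_(k < N) k.+1%:R *: (o a (- k.+1%:Z) (o b k.+1%:Z w)
    - eps *: o b (- k.+1%:Z) (o a k.+1%:Z w)).
Proof.
have h1 : (1 / 2 : rat) - 1 / 2 \is a Num.int by rewrite subrr.
have [N0 h] := Y_jacobi a b w (-2) h1 h1; exists N0.+3 => N hN.
have N0N : (N0 <= N)%N by do 3 apply: ltnW.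
have := h N N0N; case: N hN {N0N} => [//|[//|[//|N]]] hN.
rewrite 3![in LHS]big_ord_recl /= big1 => [|i _]; last first.
  have -> : (-2)%:~R + (bump 0 (bump 0 (bump 0 i)))%:R = i.+1%:Z%:~R :> rat.
    by rewrite /bump /= !add1n -!natr1 /=; ring.
  by rewrite Y0_gen gen_pos /= scale0r (plin0 (Y_linear _ _)) scaler0.
rewrite gbinom0 gbinom_half1 gbinom_half2 scale1r addr0 addr0.
rewrite Y0_gen; have -> : (-2)%:~R + (bump 0 0)%:R = (-1 : int)%:~R :> rat by [].
rewrite Y0_gen.
have -> : (-2)%:~R + (bump 0 (bump 0 0))%:R = 0%:Z%:~R :> rat by [].
rewrite Y0_gen gen_pos /= (plinZ (Y_linear _ _)) Y_vac addr0.
have -> : 1 / 2 + 1 / 2 = 1 :> rat by field.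
have -> : 1 - (bump 0 0)%:R = 0 :> rat by rewrite subrr.
have -> : (1 - (bump 0 (bump 0 0))%:R == -1 :> rat) = true by [].
rewrite scalerA mulNr [8^-1 * _]mulrC scaleNr addrA => ->; apply: eq_bigr => i _.
rewrite gbinomN2.
have -> : 1 / 2 + (-2)%:~R - i%:R = (- i.+1%:Z)%:~R - 1 / 2 :> rat.
  by rewrite !mulrNz -!pmulrn -natr1; field.
have -> : 1 / 2 + i%:R = i.+1%:Z%:~R - 1 / 2 :> rat.
  by rewrite -!pmulrn -natr1; field.
rewrite !Y_gen; congr (_ *: (_ - _ *: _)).
have -> : (-1) ^ (-2) = ((-1) ^+ 2)^-1 :> K by [].
by rewrite sqrrN expr1n invr1 mulr1.
Qed.

Variables (d : nat) (F : polar_frame P d).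

Definition current_state : V0 :=
  \sum_i m0 (pf_plus F i) (-1) (m0 (pf_minus F i) (-1) vac).
Definition conformal_state : V0 := 2^-1 *: \sum_i
  (m0 (pf_plus F i) (-2) (m0 (pf_minus F i) (-1) vac)
   - m0 (pf_plus F i) (-1) (m0 (pf_minus F i) (-2) vac)).

Let uniform_rank (Q : 'I_d -> nat -> Prop) :
  (forall i, exists N0 : nat, forall N, (N0 <= N)%N -> Q i N) ->
  exists N0 : nat, forall N, (N0 <= N)%N -> forall i, Q i N.
Proof.
move=> h; have /choice[f hf] := h.
exists (\max_i f i)%N => N hN i; apply: hf; apply: leq_trans hN.
exact: (leq_bigmax i).
Qed.

Let plus_minus i : ps_form (pf_plus F i) (pf_minus F i) = - eps.
Proof. by rewrite ps_form_sym pf_dual eqxx mulr1. Qed.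

Lemma current_field_sum w : exists N0 : nat, forall N : nat, (N0 <= N)%N ->
  Y current_state 0 w =
  \sum_(k < N) (quad_plus o F k%:Z w + eps *: quad_minus o F k.+1%:Z w)
        + (eps * d%:R / 2) *: w.
Proof.
have [N0 h] := uniform_rank (fun i => current_field (pf_plus F i) (pf_minus F i) w).
exists N0 => N /h{}h; rewrite (plin_sum (Y_linear _ _)).
have -> : (eps * d%:R / 2) *: w = \sum_(i < d) (eps / 2) *: w.
  by rewrite sumr_const card_ord scalerMnl -[in RHS]mulr_natr mulrAC.
apply/eqP; rewrite -subr_eq -sumrB; apply/eqP.
under [RHS]eq_bigr => k _ do rewrite /quad_plus /quad_minus scaler_sumr -big_split.
rewrite [RHS]exchange_big; apply: eq_bigr => i _ /=.
by rewrite -h plus_minus mulNr scaleNr.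
Qed.

(** Exchanging its modes turns the second half of the conformal state into the first half with the
    roles of the two bases swapped. In the combination of the two instances of [conformal_field] the
    fields of [a(-1) b] cancel, while the quadratic sums and the constants reinforce each other. *)
Lemma conformal_field_sum w : exists N0 : nat, forall N : nat, (N0 <= N)%N ->
  Y conformal_state 1 w =
  \sum_(k < N) (k.+1%:R *:
     (quad_plus o F k.+1%:Z w - eps *: quad_minus o F k.+1%:Z w))
        - (eps * d%:R / 8) *: w.
Proof.
have [N1 h1] := uniform_rank (fun i => conformal_field (pf_plus F i) (pf_minus F i) w).
have [N2 h2] := uniform_rank (fun i => conformal_field (pf_minus F i) (pf_plus F i) w).
exists (maxn N1 N2) => N; rewrite geq_max => /andP[/h1{}h1 /h2{}h2].
rewrite /conformal_state (plinZ (Y_linear _ _)) (plin_sum (Y_linear _ _)).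
have -> : (eps * d%:R / 8) *: w = \sum_(i < d) (eps / 8) *: w.
  by rewrite sumr_const card_ord scalerMnl -[in RHS]mulr_natr mulrAC.
under [X in _ = X - _]eq_bigr => k _ do rewrite /quad_plus /quad_minus scaler_sumr -sumrB scaler_sumr.
rewrite [X in _ = X - _]exchange_big -sumrB scaler_sumr; apply: eq_bigr => i _ /=.
set a := pf_plus F i; set b := pf_minus F i.
have E1 : m0 a (-1) (m0 b (-2) vac) = eps *: m0 b (-2) (gen a).
  by rewrite mC scale0r addr0.
have E2 : m0 b (-1) (gen a) = eps *: m0 a (-1) (gen b).
  by rewrite mC scale0r addr0.
rewrite E1 (plinB (Y_linear _ _)) (plinZ (Y_linear _ _)).
have := h1 i; have := h2 i; rewrite -/a -/b E2 (plinZ (Y_linear _ _)).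
rewrite plus_minus pf_dual eqxx.
set A := Y (m0 b (-2) _) 1 w; set C := Y (m0 a (-2) _) 1 w.
set G := Y (m0 a (-1) _) 0 w => hA hC.
pose S := \sum_(k < N) k.+1%:R *: (o a (- k.+1%:Z) (o b k.+1%:Z w)
    - eps *: o b (- k.+1%:Z) (o a k.+1%:Z w)).
have SA : A + 2^-1 *: (eps *: G) - (1 / 8) *: w = - eps *: S.
  rewrite hA scaler_sumr; apply: eq_bigr => k _.
  rewrite scalerA mulrC -scalerA; congr (_ *: _).
  by rewrite scalerBr scalerA mulNr eps2 scaleNr scaleN1r opprK addrC.
have SC : C + 2^-1 *: G - (- eps / 8) *: w = S by rewrite hC.
have -> : A = - eps *: S + (1 / 8) *: w - 2^-1 *: (eps *: G).
  by rewrite -SA subrK addrK.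
have -> : C = S + (- eps / 8) *: w - 2^-1 *: G by rewrite -SC subrK addrK.
rewrite -/S !scalerBr !scalerDr !scalerA.
have e1 : eps * (- eps) = -1 by rewrite mulrN eps2.
have e3 : eps * 2^-1 * eps = 2^-1 by rewrite mulrAC eps2 mul1r.
rewrite -[2^-1 * eps / 2 * eps]mulrA.
have -> : 2^-1 * eps * (2^-1 * eps) = 2^-1 * 2^-1 by rewrite mulrACA eps2 mulr1.
rewrite -[2^-1 * eps * - eps]mulrA e1 opprB opprD !addrA.
rewrite (ACl ((1*5)*(2*6)*(3*4)))%AC/= addNr addr0 -!scalerBl.
rewrite -[in RHS]scaleNr; have -> : 2^-1 - 2^-1 * -1 = 1 :> K by field.
by rewrite scale1r; congr (_ + _ *: _); field.
Qed.

End TwistedFields.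

(** * Functoriality, the canonical involution and the parity *)

Section FockMaps.
Variables (K : fieldType) (p : bool) (P : polarized_space K p) (tw : bool).
Variables (f : P -> P) (f_linear : linear f).
Hypothesis f_form : forall a b, ps_form (f a) (f b) = ps_form a b.
Hypothesis f_plus : forall a, a \in ps_plus P -> f a \in ps_plus P.

Let annihilates_f a n : annihilates tw a n -> annihilates tw (f a) n.
Proof.
rewrite /annihilates; case: ifP => _; last by [].
by case/orP=> [->|/andP[-> /f_plus ->]]; rewrite ?orbT.
Qed.

Let o a n := mode tw (f a) n.

Let fock_mapE : fock_map tw f = fock_lift o vacuum.
Proof.
have E : (fun s : fmonom (P * int)%type => word tw [seq (f l.1, l.2) | l <- s]) =
    (fun s => word_act o s vacuum).
  apply/funext => s; elim: (fmonom_val s) => [//|l s' IHs].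
  exact: (congr1 (mode tw (f l.1) l.2) IHs).
apply/funext => u; exact: (congr1 (fun h => free_lift h (lrepr u)) E).
Qed.

Let oL a n : linear (o a n). Proof. exact: mode_is_linear. Qed.
Let oA k a b n u : o (k *: a + b) n u = k *: o a n u + o b n u.
Proof. by rewrite /o f_linear mode_linearl. Qed.
Let oC a b m n u : o a m (o b n u) = (-1) ^+ p *: o b n (o a m u) +
  (if mode_index tw m + mode_index tw n == 0 then ps_form a b else 0) *: u.
Proof. by rewrite /o mode_commutator f_form. Qed.
Let oV a n : annihilates tw a n -> o a n vacuum = 0.
Proof. by move=> h; apply: mode_vacuum; exact: annihilates_f. Qed.

Lemma fock_map_linear : linear (fock_map tw f).
Proof. by rewrite fock_mapE; exact: fock_lift_linear. Qed.

Lemma fock_map_vacuum : fock_map tw f vacuum = vacuum.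
Proof. by rewrite fock_mapE; exact: fock_lift_vacuum. Qed.

Lemma fock_map_mode a n u :
  fock_map tw f (mode tw a n u) = mode tw (f a) n (fock_map tw f u).
Proof. by rewrite fock_mapE; exact: fock_lift_mode. Qed.

End FockMaps.

Section CanonicalInvolution.
Variables (K : numFieldType) (p : bool) (P : polarized_space K p) (tw : bool).
Local Notation theta := (@canonical_involution K p P tw).

Let oppL : linear (fun a : P => - a).
Proof. by move=> k a b; rewrite opprD scalerN. Qed.
Let opp_form (a b : P) : ps_form (- a) (- b) = ps_form a b.
Proof. by rewrite -(scaleN1r a) -(scaleN1r b) ps_formZl ps_formZr !mulN1r opprK. Qed.
Let opp_plus (a : P) : a \in ps_plus P -> - a \in ps_plus P.
Proof. by rewrite memvN. Qed.

Lemma canonical_involution_linear : linear theta.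
Proof. exact: fock_map_linear. Qed.

Lemma canonical_involution_vacuum : theta vacuum = vacuum.
Proof. exact: fock_map_vacuum. Qed.

Lemma canonical_involution_mode a n u :
  theta (mode tw a n u) = - mode tw a n (theta u).
Proof.
have -> : theta (mode tw a n u) = mode tw (- a) n (theta u) by exact: fock_map_mode.
have oaL : linear (fun a => mode tw a n (theta u)) by move=> k x y; exact: mode_linearl.
by rewrite -scaleN1r (plinZ oaL) scaleN1r.
Qed.

Lemma canonical_involutionK : involutive theta.
Proof.
have key (th : fock P tw -> fock P tw) : linear th -> th vacuum = vacuum ->
    (forall a n u, th (mode tw a n u) = - mode tw a n (th u)) -> involutive th.
  move=> thL thV thm; apply: (@fock_ind _ _ _ _ (fun u => th (th u) = u)).
  - by rewrite !(plin0 thL).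
  - by move=> k u v hu hv; rewrite (thL k u v) (thL k (th u)) hu hv.
  - by rewrite !thV.
  - move=> a n u hu; rewrite (thm a n u) -scaleN1r (plinZ thL).
    by rewrite (thm a n (th u)) hu scaleN1r opprK.
apply: key; first exact: canonical_involution_linear.
- exact: canonical_involution_vacuum.
- exact: canonical_involution_mode.
Qed.

Lemma parity_linear : linear (@parity K p P tw).
Proof.
(* The flag tested by [parity] also occurs in the type of the space; a free boolean [q] allows a
   case analysis on the test alone. *)
have key q : linear (if q then theta else id : fock P tw -> fock P tw).
  by case: q => //; exact: canonical_involution_linear.
exact: key.
Qed.

Lemma parity_vacuum : @parity K p P tw vacuum = vacuum.
Proof.
have key q : (if q then theta else id : fock P tw -> fock P tw) vacuum = vacuum.
  by case: q; [exact: canonical_involution_vacuum|].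
exact: key.
Qed.

Lemma parity_mode a n u :
  @parity K p P tw (mode tw a n u) = (-1) ^+ p *: mode tw a n (@parity K p P tw u).
Proof.
have key q : (if q then theta else id : fock P tw -> fock P tw) (mode tw a n u) =
    (-1) ^+ q *: mode tw a n ((if q then theta else id) u).
  case: q; last by rewrite expr0 scale1r.
  rewrite expr1 scaleN1r; exact: canonical_involution_mode.
exact: key.
Qed.

End CanonicalInvolution.

Lemma mode_index_true (m n : int) :
  (mode_index true m + mode_index true n == 0) = (m + n == 0).
Proof. by rewrite /mode_index -intrD intr_eq0. Qed.

Lemma mode_index_false (m n : int) :
  (mode_index false m + mode_index false n == 0) = (m + n + 1 == 0).
Proof.
have -> : mode_index false m + mode_index false n = (m + n + 1)%:~R.
  by rewrite /mode_index !intrD; field.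
by rewrite intr_eq0.
Qed.

Section FrameOfDualBases.
Variables (K : numFieldType) (p : bool) (P : polarized_space K p).
Local Notation eps := ((-1) ^+ p : K).

Lemma span_codom (d : nat) (f : 'I_d -> P) v : v \in <<codom f>>%VS ->
  exists c : 'I_d -> K, v = \sum_i c i *: f i.
Proof.
rewrite /codom span_def big_map big_enum => /memv_sumP[vs vsP ->].
have h i : exists k, vs i = k *: f i by apply/vlineP/vsP.
have [c hc] := choice h; exists c; apply: eq_bigr => i _; exact: hc.
Qed.

Variables (d : nat) (f g : 'I_d -> P).
Hypothesis f_plus : forall i, f i \in ps_plus P.
Hypothesis g_minus : forall i, g i \in ps_minus P.
Hypothesis f_span : forall a, a \in ps_plus P ->
  exists c : 'I_d -> K, a = \sum_i c i *: f i.
Hypothesis g_span : forall a, a \in ps_minus P ->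
  exists c : 'I_d -> K, a = \sum_i c i *: g i.
Hypothesis gf : forall i j, ps_form (g i) (f j) = (i == j)%:R.

Lemma frame_expand a : a = \sum_j ps_form (g j) a *: f j
     + \sum_j (- (-1) ^+ p * ps_form (f j) a) *: g j.
Proof.
have fg i j : ps_form (f i) (g j) = - eps * (i == j)%:R.
  by rewrite ps_form_sym gf eq_sym.
have [c hc] := f_span (mem_proj_plus a).
have [c' hc'] := g_span (mem_proj_minus a).
rewrite -{1}(projD a); congr (_ + _).
  rewrite hc; apply: eq_bigr => i _; congr (_ *: _).
  rewrite -(projD a) ps_formDr (ps_minus_isotropic (g_minus i) (mem_proj_minus a)).
  rewrite addr0 hc ps_form_sumr (bigD1 i)//= ps_formZr gf eqxx mulr1.
  rewrite big1 ?addr0// => j ji; rewrite ps_formZr gf eq_sym.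
  by rewrite (negbTE ji) mulr0.
rewrite hc'; apply: eq_bigr => i _; congr (_ *: _).
rewrite -(projD a) ps_formDr (ps_plus_isotropic (f_plus i) (mem_proj_plus a)).
rewrite add0r hc' ps_form_sumr (bigD1 i)//= ps_formZr fg eqxx mulr1.
rewrite big1 ?addr0 => [|j ji]; last first.
  by rewrite ps_formZr fg eq_sym (negbTE ji) !mulr0.
by rewrite mulrN mulNr mulrN opprK mulrCA eps2 mulr1.
Qed.

Definition make_frame : polar_frame P d :=
  PolarFrame f_plus g_minus gf frame_expand.

End FrameOfDualBases.

Section DualBasesFrame.
Variables (K : numFieldType) (p : bool) (P : polarized_space K p).
Variable b : dual_bases P.

Local Notation bp := (@db_plus _ _ _ b).
Local Notation bm := (@db_minus _ _ _ b).

Let plus_mem i : bp i \in ps_plus P.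
Proof. by apply: (basis_mem (db_plus_basis b)); apply: codom_f. Qed.
Let minus_mem i : bm i \in ps_minus P.
Proof. by apply: (basis_mem (db_minus_basis b)); apply: codom_f. Qed.
Let plus_span a : a \in ps_plus P ->
  exists c : 'I_(db_size b) -> K, a = \sum_i c i *: bp i.
Proof. by rewrite -(span_basis (db_plus_basis b)); exact: span_codom. Qed.
Let minus_span a : a \in ps_minus P ->
  exists c : 'I_(db_size b) -> K, a = \sum_i c i *: bm i.
Proof. by rewrite -(span_basis (db_minus_basis b)); exact: span_codom. Qed.

Definition dual_frame : polar_frame P (db_size b) :=
  make_frame plus_mem minus_mem plus_span minus_span (@db_dual _ _ _ b).

Lemma dual_bases_size : \dim {: P} = (db_size b).*2.
Proof.
rewrite -(ps_full P) dimv_disjoint_sum ?ps_direct//.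
rewrite (size_basis (db_plus_basis b)) (size_basis (db_minus_basis b)).
by rewrite !card_ord addnn.
Qed.

End DualBasesFrame.

Section FockFactor.
Variables (K : numFieldType) (p : bool) (P : polarized_space K p).
Variables (vs : vertex_structure P) (b : dual_bases P).
Variables (d : nat) (F : polar_frame P d).
Local Notation eps := ((-1) ^+ p : K).

Definition fock_state (s : multiset (fock_mode d)) : fock P true :=
  fock_word (mode true) vacuum F (enum_mset s).

Let oC a a' m n (u : fock P true) : mode true a m (mode true a' n u) =
  eps *: mode true a' n (mode true a m u) +
  (if m + n == 0 then ps_form a a' else 0) *: u.
Proof. by rewrite mode_commutator mode_index_true. Qed.

Let mC a a' m n (u : fock P false) : mode false a m (mode false a' n u) =
  eps *: mode false a' n (mode false a m u) +
  (if m + n + 1 == 0 then ps_form a a' else 0) *: u.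
Proof. by rewrite mode_commutator mode_index_false. Qed.

Lemma fock_state_basis : is_basis (@state_valid p _) fock_state.
Proof.
have [phi [phiL phi1 phi_cre]] := vacuum_functional P.
apply: (@fock_word_basis K p P (fock P true) (mode true) vacuum phi) => //.
- exact: mode_is_linear.
- by move=> k x y n u; exact: mode_linearl.
- exact: mode_vacuum.
- exact: fock_ind.
Qed.

Let jacobi a a' (w : fock P true) (l : int) (m n : rat) :
  m - 1 / 2 \is a Num.int -> n - 1 / 2 \is a Num.int ->
  exists N0 : nat, forall N : nat, (N0 <= N)%N ->
  \sum_(i < N) gbinom K m i *: vs_twisted vs
    (vs_fields vs (gen_state a) (l%:~R + i%:R) (gen_state a')) (m + n - i%:R) w =
  \sum_(i < N) ((-1) ^+ i * gbinom K l%:~R i) *: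
    (vs_twisted vs (gen_state a) (m + l%:~R - i%:R)
       (vs_twisted vs (gen_state a') (n + i%:R) w)
     - (eps * (-1) ^ l) *: vs_twisted vs (gen_state a') (n + l%:~R - i%:R)
          (vs_twisted vs (gen_state a) (m + i%:R) w)).
Proof.
move=> hm hn.
(* A generator has parity [p] and is negated by the canonical involution. Hence the sign [eps] in
   the Jacobi identity and the half-integral exponents. *)
have par_gen c : @parity K p P false (gen_state c) = (-1) ^+ p *: gen_state c.
  by rewrite /gen_state parity_mode parity_vacuum.
have theta_gen c : @canonical_involution K p P false (gen_state c) =
    (-1) ^+ true *: gen_state c.
  by rewrite /gen_state canonical_involution_mode canonical_involution_vacuum scaleN1r.
have [N0 _ h] := tm_jacobi (vs_module vs) w l (par_gen a) (par_gen a')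
  (theta_gen a) (theta_gen a') hm hn.
by exists N0 => N hN; have := h N hN; rewrite /= andbb.
Qed.

Let mL a n : linear (mode false a n : fock P false -> fock P false).
Proof. exact: mode_is_linear. Qed.
Let mV (a : P) (n : int) : 0 <= n -> mode false a n vacuum = 0.
Proof. by move=> n0; apply: mode_vacuum. Qed.
Let oL a n : linear (mode true a n : fock P true -> fock P true).
Proof. exact: mode_is_linear. Qed.
Let oA k (x y : P) n (u : fock P true) :
  mode true (k *: x + y) n u = k *: mode true x n u + mode true y n u.
Proof. exact: mode_linearl. Qed.
Let oV (a : P) n : annihilates true a n -> mode true a n vacuum = 0.
Proof. exact: mode_vacuum. Qed.

Let current_sum := current_field_sum mL mC mV (@vs_generator _ _ _ vs)
  (@vs_twisted_generator _ _ _ vs) (tm_vacuum (vs_module vs))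
  (tm_linear_state (vs_module vs)) jacobi (dual_frame b).

Let conformal_sum := conformal_field_sum mL mC mV (@vs_generator _ _ _ vs)
  (@vs_twisted_generator _ _ _ vs) (tm_vacuum (vs_module vs))
  (tm_linear_state (vs_module vs)) jacobi (dual_frame b).

Lemma current_state_word s :
  vs_twisted vs (current b) 0 (fock_word (mode true) vacuum F s) =
  (- eps * (db_size b)%:R / 2 + (\sum_(x <- s) (-1) ^+ (~~ x.1.1) : int)%:~R) *:
  fock_word (mode true) vacuum F s.
Proof. exact: (current_word oL oA oC oV current_sum F s). Qed.

Lemma conformal_state_word s :
  vs_twisted vs (conformal b) 1 (fock_word (mode true) vacuum F s) =
  (- eps * (db_size b)%:R / 8 + (\sum_(x <- s) mode_degree x)%N%:R) *:
  fock_word (mode true) vacuum F s.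
Proof. exact: (conformal_word oL oA oC oV conformal_sum F s). Qed.

End FockFactor.

(** * The action of the linear group *)

Section FiniteOrder.
Variable K : numClosedFieldType.

(** The minimal polynomial divides [X^k - 1], which has simple roots in characteristic zero. *)
Lemma finite_order_diag n (M : 'M[K]_n) k : (0 < k)%N ->
  iter k (mulmx M) 1%:M = 1%:M ->
  exists Q : 'M[K]_n, exists D : 'rV[K]_n,
    Q \in unitmx /\ Q *m M = diag_mx D *m Q.
Proof.
move=> k0; case: n M => [|n] M Mk.
  by exists 1%:M, 0; rewrite unitmx1; split=> //; apply/matrixP => -[].
have MkX : M ^+ k = 1.
  by rewrite -[RHS]Mk; elim: (k) => [//|m IHm]; rewrite exprS IHm.
have [r Dr] := closed_field_poly_normal ('X^k - 1 : {poly K}).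
rewrite lead_coefDl ?size_polyXn ?size_polyN ?size_poly1// lead_coefXn scale1r in Dr.
have sep : separable_poly ('X^k - 1 : {poly K}).
  by apply: separable_Xn_sub_1; rewrite pnatr_eq0 -lt0n.
have ur : uniq r by move: sep; rewrite Dr separable_prod_XsubC.
have /diagonalizableP : exists2 rs : seq K, uniq rs &
    mxminpoly M %| \prod_(x <- rs) ('X - x%:P).
  exists r => //; rewrite -Dr; apply: mxminpoly_min.
  by rewrite rmorphB rmorphXn /= horner_mx_X MkX rmorph1 subrr.
case=> Q Qu /diagonalizable_forPex[D hD]; exists Q, D; split=> //.
by apply: simmxPp hD; rewrite stablemx_unit.
Qed.

Lemma prod3_newton (a b : 'I_3 -> K) :
  (forall e : nat, \sum_j a j ^+ e = \sum_j b j ^+ e) ->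
  forall x, \prod_j (1 - a j * x) = \prod_j (1 - b j * x).
Proof.
move=> h x; have h1 := h 1%N; have h2 := h 2%N; have h3 := h 3%N.
move: h1 h2 h3; rewrite !big_ord_recl !big_ord0 !addr0 !mulr1 !expr1.
set a1 := a _; set a2 := a _; set a3 := a _.
set b1 := b _; set b2 := b _; set b3 := b _ => h1 h2 h3.
(* Newton's identities: the three elementary symmetric functions written in terms of the power
   sums. *)
have E (u v w : K) : (1 - u * x) * ((1 - v * x) * (1 - w * x)) =
  1 - (u + (v + w)) * x
  + ((u + (v + w)) ^+ 2 - (u ^+ 2 + (v ^+ 2 + w ^+ 2))) / 2 * x ^+ 2
  - ((u + (v + w)) ^+ 3 - 3 * (u + (v + w)) * (u ^+ 2 + (v ^+ 2 + w ^+ 2))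
     + 2 * (u ^+ 3 + (v ^+ 3 + w ^+ 3))) / 6 * x ^+ 3 by field.
by rewrite !E h1 h2 h3.
Qed.

End FiniteOrder.

Section GlAct.
Variables (K : numFieldType) (p : bool) (P : polarized_space K p).
Local Notation eps := ((-1) ^+ p : K).
Variables (d : nat) (F : polar_frame P d).
Local Notation fp := (pf_plus F).
Local Notation fm := (pf_minus F).

Let mp i : fp i \in ps_plus P. Proof. exact: pf_mem_plus. Qed.
Let mm i : fm i \in ps_minus P. Proof. exact: pf_mem_minus. Qed.
Let pp i j : ps_form (fp i) (fp j) = 0.
Proof. exact: ps_plus_isotropic. Qed.
Let mmf i j : ps_form (fm i) (fm j) = 0.
Proof. exact: ps_minus_isotropic. Qed.
Let mpf i j : ps_form (fm i) (fp j) = (i == j)%:R.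
Proof. exact: pf_dual. Qed.
Let pmf i j : ps_form (fp i) (fm j) = - eps * (i == j)%:R.
Proof. by rewrite ps_form_sym mpf eq_sym. Qed.

Definition comb (x z : 'I_d -> K) : P := \sum_j x j *: fp j + \sum_j z j *: fm j.

Let sum_delta (g : 'I_d -> K) i : \sum_j g j * (j == i)%:R = g i.
Proof.
rewrite (bigD1 i)//= eqxx mulr1 big1 ?addr0// => j /negbTE ->.
by rewrite mulr0.
Qed.

Lemma form_plus_comb i x z : ps_form (fp i) (comb x z) = - eps * z i.
Proof.
rewrite /comb ps_formDr !ps_form_sumr big1 ?add0r => [|j _]; last first.
  by rewrite ps_formZr pp mulr0.
under eq_bigr => j _ do rewrite ps_formZr pmf mulrCA eq_sym.
by rewrite -mulr_sumr sum_delta.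
Qed.

Lemma form_minus_comb i x z : ps_form (fm i) (comb x z) = x i.
Proof.
rewrite /comb ps_formDr !ps_form_sumr [X in _ + X]big1 ?addr0 => [|j _]; last first.
  by rewrite ps_formZr mmf mulr0.
under eq_bigr => j _ do rewrite ps_formZr mpf eq_sym.
by rewrite sum_delta.
Qed.

Lemma form_comb x z x' z' : ps_form (comb x z) (comb x' z') =
  \sum_j (- eps * (x j * z' j) + z j * x' j).
Proof.
rewrite {1}/comb ps_formDl !ps_form_suml -big_split; apply: eq_bigr => j _ /=.
by rewrite !ps_formZl form_plus_comb form_minus_comb mulrCA.
Qed.

Lemma comb_form a :
  a = comb (fun j => ps_form (fm j) a) (fun j => - eps * ps_form (fp j) a).
Proof. exact: pf_expand. Qed.

Lemma comb_linear k x z x' z' : k *: comb x z + comb x' z' =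
  comb (fun j => k * x j + x' j) (fun j => k * z j + z' j).
Proof.
rewrite /comb scalerDr !scaler_sumr addrACA.
by congr (_ + _); rewrite -big_split; apply: eq_bigr => j _ /=; rewrite scalerDl scalerA.
Qed.

Lemma comb_ext x z x' z' : x =1 x' -> z =1 z' -> comb x z = comb x' z'.
Proof.
by move=> hx hz; congr (_ + _); apply: eq_bigr => j _; rewrite ?hx ?hz.
Qed.

Lemma plus_comb a : a \in ps_plus P ->
  a = \sum_j ps_form (fm j) a *: fp j.
Proof.
move=> ap; rewrite {1}(pf_expand F a) [X in _ + X]big1 ?addr0// => i _.
by rewrite (ps_plus_isotropic (mp i) ap) mulr0 scale0r.
Qed.

Variables (g : 'End(subvs_of (ps_plus P))) (nu : 'I_d -> K).
Hypothesis nu0 : forall j, nu j != 0.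
Hypothesis g_nu : forall j,
  g (vsproj (ps_plus P) (fp j)) = nu j *: vsproj (ps_plus P) (fp j).

Let vsval_g a : a \in ps_plus P ->
  vsval (g (vsproj (ps_plus P) a)) = \sum_j (nu j * ps_form (fm j) a) *: fp j.
Proof.
move=> ap; rewrite {1}(plus_comb ap) !linear_sum; apply: eq_bigr => j _.
by rewrite !linearZ /= g_nu linearZ /= vsprojK// scalerA mulrC.
Qed.

(** Preservation of the pairing forces the inverse eigenvalue on the dual vector of each
    eigenvector. *)
Lemma gl_actE a : gl_act g a = comb (fun j => nu j * ps_form (fm j) a)
  (fun j => - eps * (nu j)^-1 * ps_form (fp j) a).
Proof.
rewrite /gl_act -/(proj_plus a) -/(proj_minus a).
rewrite vsval_g ?mem_proj_plus//; congr (_ + _).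
  apply: eq_bigr => j _; congr (_ * _ *: _); rewrite -[in RHS](projD a) ps_formDr.
  by rewrite (ps_minus_isotropic (mm j) (mem_proj_minus a)) addr0.
have form_proj j : ps_form (fp j) (proj_minus a) = ps_form (fp j) a.
  rewrite -[in RHS](projD a) ps_formDr.
  by rewrite (ps_plus_isotropic (mp j) (mem_proj_plus a)) add0r.
set y := \sum_j _ *: fm j.
have yE : y = comb (fun=> 0) (fun j => - eps * (nu j)^-1 * ps_form (fp j) a).
  by rewrite /comb [X in X + _]big1 ?add0r// => j _; rewrite scale0r.
have y_minus : y \in ps_minus P by apply: memv_suml => j _; apply: memvZ.
have form_g (x : subvs_of (ps_plus P)) u : ps_form (vsval (g x)) u =
    \sum_j nu j * ps_form (fm j) (vsval x) * ps_form (fp j) u.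
  rewrite -[x in LHS]vsvalK vsval_g ?subvsP// ps_form_suml.
  by apply: eq_bigr => j _; rewrite ps_formZl.
(* The condition that defines the second component has a single solution, since its pairings with
   the eigenvectors are its coordinates up to nonzero scalars. *)
apply: xget_unique; first split=> // x.
  rewrite form_g {2}(plus_comb (subvsP x)) ps_form_suml; apply: eq_bigr => j _.
  rewrite yE form_plus_comb ps_formZl form_proj !mulNr !mulrN opprK.
  rewrite [eps * (eps * _ * _)]mulrA [eps * (eps * _)]mulrA eps2 mul1r.
  by rewrite mulrACA divff// mul1r.
move=> u [um hu]; rewrite (comb_form u) yE; apply: comb_ext => j.
  by rewrite (ps_minus_isotropic (mm j) um).
have := hu (vsproj (ps_plus P) (fp j)); rewrite vsval_g// vsprojK//.
rewrite ps_form_suml (bigD1 j)//= mpf eqxx mulr1 ps_formZl big1 => [|i ij].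
  by rewrite addr0 form_proj => <-; rewrite mulrA divfK.
by rewrite mpf (negbTE ij) mulr0 scale0r ps_form0l.
Qed.

Lemma gl_act_linear : linear (gl_act g).
Proof.
move=> k a b; rewrite !gl_actE comb_linear; apply: comb_ext => j.
  by rewrite ps_form_linearr mulrDr mulrCA.
by rewrite ps_form_linearr mulrDr mulrCA.
Qed.

Lemma gl_act_form a b : ps_form (gl_act g a) (gl_act g b) = ps_form a b.
Proof.
rewrite !gl_actE [in RHS](comb_form a) [in RHS](comb_form b) !form_comb.
apply: eq_bigr => j _.
by field; rewrite nu0.
Qed.

Lemma gl_act_plus j : gl_act g (fp j) = nu j *: fp j.
Proof.
rewrite gl_actE /comb [X in _ + X]big1 ?addr0 => [|i _]; last first.
  by rewrite pp mulr0 scale0r.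
rewrite (bigD1 j)//= mpf eqxx mulr1 big1 ?addr0// => i ij.
by rewrite mpf (negbTE ij) mulr0 scale0r.
Qed.

Lemma gl_act_minus j : gl_act g (fm j) = (nu j)^-1 *: fm j.
Proof.
rewrite gl_actE /comb [X in X + _]big1 ?add0r => [|i _]; last first.
  by rewrite mmf mulr0 scale0r.
rewrite (bigD1 j)//= pmf eqxx mulr1 big1 ?addr0 => [|i ij]; last first.
  by rewrite pmf (negbTE ij) !mulr0 scale0r.
by rewrite !mulNr mulrN opprK mulrAC eps2 mul1r.
Qed.

Lemma gl_act_mem_plus a : a \in ps_plus P -> gl_act g a \in ps_plus P.
Proof.
move=> ap; rewrite gl_actE /comb [X in _ + X]big1 ?addr0 => [|i _]; last first.
  by rewrite (ps_plus_isotropic (mp i) ap) mulr0 scale0r.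
by apply: memv_suml => j _; apply: memvZ.
Qed.

Definition mode_char (x : fock_mode d) : K :=
  if x.1.1 then nu x.1.2 else (nu x.1.2)^-1.

Lemma gl_fock_linear : linear (gl_fock g).
Proof. exact: (fock_map_linear gl_act_linear gl_act_form gl_act_mem_plus). Qed.

Lemma gl_fock_word s : gl_fock g (fock_word (mode true) vacuum F s) =
  (\prod_(x <- s) mode_char x) *: fock_word (mode true) vacuum F s.
Proof.
have gm := fock_map_mode gl_act_linear gl_act_form gl_act_mem_plus (tw := true).
have gv := fock_map_vacuum true gl_act_linear gl_act_form gl_act_mem_plus.
elim: s => [|x s IHs]; first by rewrite big_nil scale1r; exact: gv.
have E : gl_act g (mode_vector F x) = mode_char x *: mode_vector F x.
  rewrite /mode_vector /mode_char.
  by case: ifP => _; [apply: gl_act_plus|apply: gl_act_minus].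
rewrite big_cons -scalerA.
set n := (- (mode_degree x)%:Z); set w := fock_word _ _ _ s in IHs *.
transitivity (mode true (gl_act g (mode_vector F x)) n (gl_fock g w)).
  exact: gm.
have oaL u : linear (fun a : P => mode true a n u).
  by move=> k y z; exact: mode_linearl.
rewrite E (plinZ (oaL _)) IHs (plinZ (mode_is_linear (tw := true) _ n)).
exact: erefl.
Qed.

End GlAct.

Section EigenFrame.
Variables (K : numClosedFieldType) (p : bool) (P : polarized_space K p).
Local Notation eps := ((-1) ^+ p : K).
Local Notation U := (subvs_of (ps_plus P)).
Variables (b : dual_bases P) (f : nat -> 'End(U)).
Hypothesis f0 : f 0 = \1%VF.
Hypothesis fS : forall e, f e.+1 = (f 1 \o f e)%VF.

Let G := dual_frame b.
Let e := vbasis {: U}.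
Let e_basis : basis_of {: U} e. Proof. exact: vbasisP. Qed.
Let M := passmx.mxof e e (f 1).

Let mxof_f k : passmx.mxof e e (f k) = iter k (mulmx^~ M) 1%:M.
Proof.
elim: k => [|k IHk]; first by rewrite f0 passmx.mxof1// (basis_free e_basis).
by rewrite fS (passmx.mxof_comp e e e_basis) IHk.
Qed.

Let iter_comm k : iter k (mulmx^~ M) 1%:M = iter k (mulmx M) 1%:M.
Proof.
have h j : iter j (mulmx M) 1%:M *m M = M *m iter j (mulmx M) 1%:M.
  by elim: j => [|j IHj] /=; rewrite ?mul1mx ?mulmx1// -mulmxA IHj.
by elim: k => //= k ->; rewrite h.
Qed.

(** The rows of a diagonalizing matrix give eigenvectors in [ps_plus], and [ps_minus] receives the
    dual basis. The traces of all powers are recorded because they are what the characters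
    control. *)
Lemma eigenframe k d : (0 < k)%N -> f k = \1%VF -> d = \dim (ps_plus P) ->
  exists (F : polar_frame P d) (nu : 'I_d -> K),
  (forall j, f 1 (vsproj (ps_plus P) (pf_plus F j)) =
     nu j *: vsproj (ps_plus P) (pf_plus F j)) /\
  (forall m, endo_trace (f m) = \sum_j nu j ^+ m).
Proof.
move=> k0 fk dd; have dU : d = \dim {: U} by rewrite dimvf /dim /= dd.
clear dd; subst d.
have Mk : iter k (mulmx M) 1%:M = 1%:M.
  by rewrite -iter_comm -mxof_f fk passmx.mxof1// (basis_free e_basis).
have [Q [D [Qu QM]]] := finite_order_diag k0 Mk.
pose v j : U := passmx.vecof e (row j Q).
pose co (a : P) : 'rV[K]_(\dim {: U}) :=
  passmx.rVof e (vsproj (ps_plus P) a) *m invmx Q.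
have coL j c a a' : co (c *: a + a') 0 j = c * co a 0 j + co a' 0 j.
  rewrite /co (linearP (vsproj (ps_plus P))) passmx.rVof_linear mulmxDl -scalemxAl.
  by rewrite [LHS]mxE [X in X + _]mxE.
have co0 j : co 0 0 j = 0.
  have := coL j 1 0 0; rewrite scale1r addr0 mul1r => h.
  by apply: (addIr (co 0 0 j)); rewrite add0r -h.
have fv j : f 1 (v j) = D 0 j *: v j.
  rewrite /v; apply: (can_inj (passmx.rVofK e_basis)).
  rewrite (plinZ (passmx.rVof_linear _)) -(passmx.mul_mxof e e) passmx.vecofK//.
  by rewrite -row_mul QM mul_diag_mx; apply/rowP => i; rewrite !mxE.
pose fp j : P := vsval (v j).
(* The vector of [ps_minus] that represents the [j]-th coordinate with respect to the eigenbasis,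
   written in the frame [G] of the given dual bases. *)
pose fm j : P := \sum_i co (pf_plus G i) 0 j *: pf_minus G i.
have fp_mem j : fp j \in ps_plus P by exact: subvsP.
have fm_mem j : fm j \in ps_minus P.
  by apply: memv_suml => i _; apply: memvZ; apply: pf_mem_minus.
have fm_form j a : a \in ps_plus P -> ps_form (fm j) a = co a 0 j.
  move=> ap; rewrite [in RHS](plus_comb G ap) /fm ps_form_suml.
  rewrite (big_morph (fun a => co a 0 j) (id1 := 0) (op1 := +%R)) //; last first.
    by move=> x y; rewrite -[x in LHS]scale1r coL mul1r.
  apply: eq_bigr => i _; rewrite ps_formZl -[_ *: pf_plus G i]addr0 coL co0 addr0.
  by rewrite mulrC.
have dual i j : ps_form (fm i) (fp j) = (i == j)%:R.
  rewrite fm_form// /co /fp vsvalK /v passmx.vecofK// -row_mul mulmxV//.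
  by rewrite !mxE eq_sym.
have fp_span a : a \in ps_plus P -> exists c : 'I_(\dim {: U}) -> K,
    a = \sum_i c i *: fp i.
  move=> ap; exists (fun i => co a 0 i).
  have aE : vsval (passmx.vecof e (co a *m Q)) = a.
    by rewrite /co mulmxKV// passmx.rVofK// vsprojK.
  have hL : linear (fun u => vsval (passmx.vecof e u)).
    by move=> k1 u u'; rewrite passmx.vecof_linear linearP.
  rewrite -[LHS]aE mulmx_sum_row (plin_sum hL); apply: eq_bigr => i _.
  by rewrite (plinZ hL).
have fm_span a : a \in ps_minus P -> exists c : 'I_(\dim {: U}) -> K,
    a = \sum_i c i *: fm i.
  move=> am; exists (fun i => - eps * ps_form (fp i) a).
  (* The difference lies in [ps_minus], hence is orthogonal to that half; it is also orthogonal to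
     every [fp j], and these span the other half. *)
  apply/eqP; rewrite -subr_eq0; apply/eqP; apply: ps_form_nondegenerate => u.
  set y := a - _; have ym : y \in ps_minus P.
    by apply: memvB => //; apply: memv_suml => i _; apply: memvZ.
  have dual' i j : ps_form (fp j) (fm i) = - eps * (i == j)%:R.
    by rewrite (ps_form_sym (fm i)) dual.
  have fpy j : ps_form (fp j) y = 0.
    rewrite /y -scaleN1r addrC ps_form_linearr ps_form_sumr (bigD1 j)//=.
    rewrite big1 => [|i ij]; last first.
      by rewrite ps_formZr dual' (negbTE ij) !mulr0.
    rewrite addr0 ps_formZr dual' eqxx mulr1 mulrAC mulrNN eps2 mul1r.
    by rewrite mulN1r addNr.
  rewrite -(projD u) ps_formDr (ps_minus_isotropic ym (mem_proj_minus u)) addr0.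
  have [c ->] := fp_span _ (mem_proj_plus u).
  rewrite ps_form_sumr big1// => j _; rewrite ps_formZr ps_form_sym fpy.
  by rewrite !mulr0.
exists (make_frame fp_mem fm_mem fp_span fm_span dual), (fun j => D 0 j); split.
  by move=> j /=; rewrite vsvalK fv.
move=> m; rewrite /endo_trace -/e mxof_f iter_comm.
have QMm : Q *m iter m (mulmx M) 1%:M = diag_mx (\row_j D 0 j ^+ m) *m Q.
  elim: m => [|m IHm] /=.
    rewrite mulmx1; have -> : diag_mx (\row_j D 0 j ^+ 0) = 1%:M :> 'M[K]_(\dim {: U}).
      by apply/matrixP => i j; rewrite !mxE expr0.
    by rewrite mul1mx.
  rewrite mulmxA QM -mulmxA IHm mulmxA; congr (_ *m _).
  rewrite mulmx_diag; congr diag_mx.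
  by apply/rowP => i; rewrite !mxE exprS.
have -> : iter m (mulmx M) 1%:M = invmx Q *m (diag_mx (\row_j D 0 j ^+ m) *m Q).
  by rewrite -QMm mulKmx.
rewrite mxtrace_mulC -mulmxA mulmxV// mulmx1 mxtrace_diag.
by apply: eq_bigr => i _; rewrite mxE.
Qed.

End EigenFrame.

(** * Tensor products of fields *)

Section PartialLinearity.
Variables (K : fieldType) (X T U : lmodType K) (phi : X -> T -> U).
Hypothesis phiL : forall x, linear (phi x).

(** With [linear_sectionD] this starts an induction over tensors: linearity in one argument need
    only be checked when the other argument is a pure tensor. *)
Lemma linear_section0 : linear (phi^~ 0).
Proof. by move=> k x x'; rewrite !(plin0 (phiL _)) scaler0 addr0. Qed.

Lemma linear_sectionD c u v : linear (phi^~ u) -> linear (phi^~ v) ->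
  linear (phi^~ (c *: u + v)).
Proof.
move=> hu hv k x x'; rewrite /= !phiL hu hv.
by rewrite !scalerDr !scalerA [c * k]mulrC addrACA.
Qed.

End PartialLinearity.

Section TensorTheory.
Variables (K : fieldType) (V W : lmodType K).

Lemma tmul_linearl (w : W) : linear (fun v : V => tmul v w).
Proof.
move=> k v v'; rewrite /tmul; set pi := lpi _.
have piP c x y : pi (c *: x + y) = c *: pi x + pi y by exact: lpi_linear.
rewrite -piP; apply/lpi_eq; rewrite opprD addrA; apply: lspan_rel.
exact: Bilinear_l.
Qed.

Lemma tmul_linearr (v : V) : linear (fun w : W => tmul v w).
Proof.
move=> k w w'; rewrite /tmul; set pi := lpi _.
have piP c x y : pi (c *: x + y) = c *: pi x + pi y by exact: lpi_linear.
rewrite -piP; apply/lpi_eq; rewrite opprD addrA; apply: lspan_rel.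
exact: Bilinear_r.
Qed.

Lemma tensor_ind (U : tensor V W -> Prop) : U 0 ->
  (forall k x y, U x -> U y -> U (k *: x + y)) ->
  (forall v w, U (tmul v w)) -> forall t, U t.
Proof.
move=> U0 UL Um t; pose pi : malg (V * W)%type K -> tensor V W := lpi (@bilinear_rel K V W).
have -> : t = pi (lrepr t) by rewrite /pi lreprK.
have piP c x y : pi (c *: x + y) = c *: pi x + pi y by exact: lpi_linear.
have pi0 : pi 0 = 0 by exact: (plin0 (piP : linear pi)).
have key (x y : malg (V * W)%type K) c : U (pi x) -> U (pi y) -> U (pi (c *: x + y)).
  by move=> hx hy; rewrite piP; apply: UL.
move: (lrepr t) => x; rewrite (monalgE x); elim/big_rec: _ => [|s y _ Uy].
  by rewrite pi0.
by rewrite mkmalgU_scale; apply: key => //; case: s => v w; exact: Um.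
Qed.

Lemma tlift_linear (U : lmodType K) (h : V -> W -> U) :
  (forall w, linear (h^~ w)) -> (forall v, linear (h v)) -> linear (tlift h).
Proof.
move=> hl hr; pose G := free_lift (fun p : V * W => h p.1 p.2).
have GL : linear G by exact: free_lift_linear.
pose pi : malg (V * W)%type K -> tensor V W := lpi (@bilinear_rel K V W).
have piP c x y : pi (c *: x + y) = c *: pi x + pi y by exact: lpi_linear.
have E x : tlift h (pi x) = G x.
  apply: lift_lpi => // y [k v1 v2 u|k u w1 w2].
    rewrite -/G !(plinB GL) (plinZ GL) /G /pure !free_liftU /= hl.
    by rewrite addrAC addrK subrr.
  rewrite -/G !(plinB GL) (plinZ GL) /G /pure !free_liftU /= hr.
  by rewrite addrAC addrK subrr.
move=> k t t'; have -> : t = pi (lrepr t) by rewrite /pi lreprK.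
have -> : t' = pi (lrepr t') by rewrite /pi lreprK.
by rewrite -(piP k (lrepr t) (lrepr t')) !E GL.
Qed.

End TensorTheory.

Section TensorMap.
Variables (K : fieldType) (V W V' W' : lmodType K) (f : V -> V') (g : W -> W').
Hypothesis fL : linear f.
Hypothesis gL : linear g.

Let bl w : linear (fun v => tmul (f v) (g w)).
Proof. by move=> k v v'; rewrite fL (tmul_linearl _ k). Qed.
Let br v : linear (fun w => tmul (f v) (g w)).
Proof. by move=> k w w'; rewrite gL (tmul_linearr _ k). Qed.

Lemma tmapE v w : tmap f g (tmul v w) = tmul (f v) (g w).
Proof. exact: (tliftE (h := fun v w => tmul (f v) (g w)) v w bl br). Qed.

Lemma tmap_linear : linear (tmap f g).
Proof. exact: (tlift_linear bl br). Qed.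

End TensorMap.

Lemma tensor_basis (K : fieldType) (V W : lmodType K) (S T : choiceType)
    (vS : pred S) (vT : pred T) (e : S -> V) (f : T -> W) :
  is_basis vS e -> is_basis vT f ->
  is_basis (fun st : S * T => vS st.1 && vT st.2) (fun st => tmul (e st.1) (f st.2)).
Proof.
move=> [spe [coe [coeL coeP]]] [spf [cof [cofL cofP]]]; split.
  set R := (X in lspan X).
  have R0 : 0 \in lspan R by exact: lspan0.
  have RL k x y : x \in lspan R -> y \in lspan R -> k *: x + y \in lspan R.
    exact: lspan_linear.
  apply: tensor_ind => // v w.
  have /lspanP/(_ [set v | tmul v w \in lspan R]) := spe v; apply=> /=.
  - by rewrite (plin0 (tmul_linearl w)).
  - by move=> k x y hx hy; rewrite (tmul_linearl w k); apply: RL.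
  move=> _ [s vs <-]; have /lspanP/(_ [set w | tmul (e s) w \in lspan R]) := spf w; apply=> /=.
  - by rewrite (plin0 (tmul_linearr _)).
  - by move=> k x y hx hy; rewrite (tmul_linearr _ k); apply: RL.
  by move=> _ [t vt <-]; apply: lspan_rel; exists (s, t) => //=; apply/andP.
pose h (st : S * T) v w : K^o := coe st.1 v * cof st.2 w.
have hl st w : linear (h st ^~ w).
  by move=> k v v'; rewrite /h coeL mulrDl -mulrA.
have hr st v : linear (h st v).
  by move=> k w w'; rewrite /h cofL mulrDr mulrCA.
exists (fun st t => tlift (h st) t); split.
  by move=> st k u v; exact: (tlift_linear (hl st) (hr st) k u v).
move=> [s t] [s' t'] /= /andP[vs vt] /andP[vs' vt'].
rewrite (tliftE _ _ (hl (s, t)) (hr (s, t))) /h /= coeP// cofP// xpair_eqE.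
by rewrite -natrM mulnb.
Qed.

Section FieldSupport.
Variable K : numFieldType.

(** The exponents are half-integers bounded above. Two such conditions, on [i] and on [n - 1 - i],
    leave finitely many [i], so that the sum over all rationals in [tensor_fields] is a genuine
    finite sum. *)
Definition half_supported (M : lmodType K) (f : rat -> M) : Prop :=
  exists m : int, forall n, f n <> 0 -> exists k : nat, n = (m%:~R - k%:R) / 2.

Definition regular_fields (V M : lmodType K) (Y : fields V M) : Prop :=
  [/\ forall n w, linear (fun a => Y a n w), forall a n, linear (Y a n) &
      forall a w, half_supported (fun n => Y a n w)].

Lemma half_supportedD (M : lmodType K) (f g h : rat -> M) :
  half_supported f -> half_supported g ->
  (forall n, f n = 0 -> g n = 0 -> h n = 0) -> half_supported h.
Proof.
move=> [m1 h1] [m2 h2] hfg; exists (Num.max m1 m2) => n hn.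
have widen m k : m <= Num.max m1 m2 -> n = (m%:~R - k%:R) / 2 ->
    exists k, n = ((Num.max m1 m2)%:~R - k%:R) / 2.
  move=> mM ->; exists (k + `|Num.max m1 m2 - m|)%N; congr (_ / 2).
  have e : (`|Num.max m1 m2 - m|%N)%:R = (Num.max m1 m2 - m)%:~R :> rat.
    by rewrite pmulrn gez0_abs// subr_ge0.
  by rewrite natrD e rmorphB /=; ring.
have [f0|/eqP f0] := eqVneq (f n) 0; last first.
  by have [k /widen] := h1 n f0; apply; rewrite le_max lexx.
have [g0|/eqP g0] := eqVneq (g n) 0; last first.
  by have [k /widen] := h2 n g0; apply; rewrite le_max lexx orbT.
by case: hn; apply: hfg.
Qed.

(** Splitting [a] into eigenvectors of the involution shows that every exponent is integral or
    half-integral, and truncation bounds it from above. *)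
Lemma twisted_regular (V M : lmodType K) (vac : V) (par theta : V -> V)
    (Y : fields V V) (YM : fields V M) :
  linear theta -> involutive theta ->
  twisted_module vac par theta Y YM -> regular_fields YM.
Proof.
move=> thL thK tm; split; first exact: tm_linear_state tm.
  exact: tm_linear_vector tm.
move=> a w; have [N hN] := tm_truncation tm a w.
have Yl n := tm_linear_state tm n w.
pose a0 := 2^-1 *: (a + theta a); pose a1 := 2^-1 *: (a - theta a).
have aE : a = a0 + a1.
  rewrite /a0 /a1 -scalerDr [X in _ *: X](_ : _ = 2 *: a).
    by rewrite scalerA mulVf ?pnatr_eq0// scale1r.
  by rewrite addrACA subrr addr0 scaler_nat mulr2n.
have th0 : theta a0 = (-1) ^+ false *: a0.
  by rewrite /a0 (plinZ thL) (plinD thL) thK expr0 scale1r addrC.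
have th1 : theta a1 = (-1) ^+ true *: a1.
  by rewrite /a1 (plinZ thL) (plinB thL) thK expr1 scaleN1r -scalerN opprB.
exists (N.*2)%:Z => n hn.
have nN : n < N%:R by rewrite ltNge; apply/negP => /hN.
have key : exists z : int, n = z%:~R / 2.
  have [h0|h0] := boolP (n - false%:R / 2 \is a Num.int).
    move/intrP: h0 => [z]; rewrite mul0r subr0 => ->; exists (z * 2).
    by rewrite intrM mulfK.
  have [h1|h1] := boolP (n - true%:R / 2 \is a Num.int).
    move/intrP: h1 => [z] hz; exists (z * 2 + 1).
    by rewrite intrD intrM -hz /=; field.
  case: hn; rewrite [X in YM X]aE (plinD (Yl n)).
  by rewrite (tm_exponents tm _ th0 h0) (tm_exponents tm _ th1 h1) addr0.
have [z zE] := key; have zN : z <= (N.*2)%:Z.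
  have : z%:~R < (N.*2)%:Z%:~R :> rat.
    by move: nN; rewrite zE ltr_pdivrMr// -pmulrn -muln2 natrM.
  by rewrite ltr_int; apply: ltW.
exists `|(N.*2)%:Z - z|%N; rewrite zE; congr (_ / 2).
have -> : (`|(N.*2)%:Z - z|%N)%:R = ((N.*2)%:Z - z)%:~R :> rat.
  by rewrite pmulrn gez0_abs// subr_ge0.
by rewrite rmorphB /= opprB addrC subrK.
Qed.

End FieldSupport.

Section TensorFields.
Variables (K : numFieldType) (V1 M1 V2 M2 : lmodType K).
Variables (par_V : V2 -> V2) (par_M : M1 -> M1).
Variables (Y1 : fields V1 M1) (Y2 : fields V2 M2).
Hypothesis pVL : linear par_V.
Hypothesis pML : linear par_M.
Hypothesis Y1r : regular_fields Y1.
Hypothesis Y2r : regular_fields Y2.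
Local Notation TF := (tensor_fields par_V par_M Y1 Y2).

Let even_part (b : V2) := 2^-1 *: (b + par_V b).
Let odd_part (b : V2) := 2^-1 *: (b - par_V b).
Let term n a b x y i : tensor M1 M2 :=
  tmul (Y1 a i x) (Y2 (even_part b) (n - 1 - i) y)
  + tmul (Y1 a i (par_M x)) (Y2 (odd_part b) (n - 1 - i) y).
Let h n a b x y := \sum_(i \in [set: rat]) term n a b x y i.

Let even_linear : linear even_part.
Proof.
move=> k u v; rewrite /even_part pVL addrACA -(scalerDr k) [LHS]scalerDr !scalerA.
by rewrite mulrC.
Qed.
Let odd_linear : linear odd_part.
Proof.
move=> k u v; rewrite /odd_part pVL opprD addrACA -(scalerBr k) [LHS]scalerDr !scalerA.
by rewrite mulrC.
Qed.
Let Y1l n w : linear (fun a => Y1 a n w). Proof. by case: Y1r. Qed.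
Let Y1v a n : linear (Y1 a n). Proof. by case: Y1r. Qed.
Let Y2l n w : linear (fun a => Y2 a n w). Proof. by case: Y2r. Qed.
Let Y2v a n : linear (Y2 a n). Proof. by case: Y2r. Qed.

Let tmul0l (w : M2) : tmul (0 : M1) w = 0. Proof. exact: plin0 (tmul_linearl w). Qed.
Let tmul0r (v : M1) : tmul v (0 : M2) = 0. Proof. exact: plin0 (tmul_linearr v). Qed.

Let pair_finite n a b x y :
  finite_set [set i | tmul (Y1 a i x) (Y2 b (n - 1 - i) y) <> 0].
Proof.
have [_ _ /(_ a x)[m1 h1]] := Y1r; have [_ _ /(_ b y)[m2 h2]] := Y2r.
(* Adding the two exponents gives [k1 + k2 = c], which bounds [k1]. *)
pose c : rat := m1%:~R + m2%:~R - 2 * (n - 1).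
pose N := Num.bound c.
apply: (@sub_finite_set _ _ ((fun k : nat => (m1%:~R - k%:R) / 2 : rat) @` `I_N)).
  move=> i /= hi.
  have [k1 e1] : exists k : nat, i = (m1%:~R - k%:R) / 2.
    by apply: h1 => e; apply: hi; rewrite e tmul0l.
  have [k2 e2] : exists k : nat, n - 1 - i = (m2%:~R - k%:R) / 2.
    by apply: h2 => e; apply: hi; rewrite e tmul0r.
  exists k1 => //=; rewrite -(ltr_nat rat).
  have k1c : k1%:R <= c.
    have -> : c = k1%:R + k2%:R.
      rewrite /c; have -> : n - 1 = (m2%:~R - k2%:R) / 2 + i by rewrite -e2 subrK.
      by rewrite e1; field.
    by rewrite lerDl.
  by apply: (le_lt_trans k1c); apply: archi_boundP; apply: le_trans k1c.
exact/finite_image/finite_II.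
Qed.

Let term_finite n a b x y : finite_set [set i | term n a b x y i <> 0].
Proof.
apply: (@sub_finite_set _ _
  ([set i | tmul (Y1 a i x) (Y2 (even_part b) (n - 1 - i) y) <> 0]
   `|` [set i | tmul (Y1 a i (par_M x)) (Y2 (odd_part b) (n - 1 - i) y) <> 0])).
  move=> i /= hi; have [e|] := pselect (tmul (Y1 a i x)
    (Y2 (even_part b) (n - 1 - i) y) = 0); last by left.
  by right=> e'; apply: hi; rewrite /term e e' addr0.
by rewrite finite_setU; split; apply: pair_finite.
Qed.

Let fsum_linear (F G H : rat -> tensor M1 M2) (k : K) :
  finite_set [set i | F i <> 0] -> finite_set [set i | G i <> 0] ->
  (forall i, H i = k *: F i + G i) ->
  \sum_(i \in [set: rat]) H i =
  k *: (\sum_(i \in [set: rat]) F i) + \sum_(i \in [set: rat]) G i.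
Proof.
move=> /finite_fsetP[A hA] /finite_fsetP[B hB] HE.
have FA i : i \notin (A `|` B)%fset -> F i = 0.
  rewrite inE negb_or => /andP[iA _]; apply/eqP/negPn/negP => /eqP Fi.
  by move/negP: iA; apply; have : [set i | F i <> 0] i by []; rewrite hA.
have GB i : i \notin (A `|` B)%fset -> G i = 0.
  rewrite inE negb_or => /andP[_ iB]; apply/eqP/negPn/negP => /eqP Gi.
  by move/negP: iB; apply; have : [set i | G i <> 0] i by []; rewrite hB.
have HAB i : i \notin (A `|` B)%fset -> H i = 0.
  by move=> hi; rewrite HE FA// GB// scaler0 addr0.
rewrite (fsbigTE _ _ HAB) (fsbigTE _ _ FA) (fsbigTE _ _ GB) scaler_sumr -big_split.
by apply: eq_bigr => i _ /=; rewrite HE.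
Qed.

Let swapD (k : K) (u v u' v' : tensor M1 M2) :
  (k *: u + v) + (k *: u' + v') = k *: (u + u') + (v + v').
Proof. by rewrite scalerDr addrACA. Qed.

Let h_a n b x y : linear (fun a => h n a b x y).
Proof.
move=> k a a'; apply: fsum_linear => // i; rewrite /term !(Y1l _ _ k).
by rewrite !(tmul_linearl _ k) swapD.
Qed.
Let h_b n a x y : linear (fun b => h n a b x y).
Proof.
move=> k b b'; apply: fsum_linear => // i; rewrite /term even_linear odd_linear.
by rewrite !(Y2l _ _ k) !(tmul_linearr _ k) swapD.
Qed.
Let h_x n a b y : linear (fun x => h n a b x y).
Proof.
move=> k x x'; apply: fsum_linear => // i; rewrite /term pML !(Y1v _ _ k).
by rewrite !(tmul_linearl _ k) swapD.
Qed.
Let h_y n a b x : linear (fun y => h n a b x y).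
Proof.
move=> k y y'; apply: fsum_linear => // i; rewrite /term !(Y2v _ _ k).
by rewrite !(tmul_linearr _ k) swapD.
Qed.

Let inner n x y ab := tlift (fun a b => h n a b x y) ab.

Let inner_linear n x y : linear (inner n x y).
Proof. by apply: tlift_linear => ?; [apply: h_a|apply: h_b]. Qed.

Let innerE n x y a b : inner n x y (tmul a b) = h n a b x y.
Proof.
by apply: (tliftE (h := fun a b => h n a b x y)) => ?; [apply: h_a|apply: h_b].
Qed.

Let inner_x n ab y : linear (fun x => inner n x y ab).
Proof.
elim/tensor_ind: ab => [|c u v hu hv|a b].
- exact: (@linear_section0 _ _ _ _ (fun x => inner n x y) (fun x => @inner_linear n x y)).
- exact: (@linear_sectionD _ _ _ _ (fun x => inner n x y) (fun x => @inner_linear n x y) c u v hu hv).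
- by move=> k x x'; rewrite !innerE; exact: h_x.
Qed.
Let inner_y n ab x : linear (fun y => inner n x y ab).
Proof.
elim/tensor_ind: ab => [|c u v hu hv|a b].
- exact: (@linear_section0 _ _ _ _ (fun y => inner n x y) (fun y => @inner_linear n x y)).
- exact: (@linear_sectionD _ _ _ _ (fun y => inner n x y) (fun y => @inner_linear n x y) c u v hu hv).
- by move=> k y y'; rewrite !innerE; exact: h_y.
Qed.

Let TF_pure ab n x y : TF ab n (tmul x y) = inner n x y ab.
Proof.
by apply: (tliftE (h := fun x y => inner n x y ab)) => ?; [apply: inner_x|apply: inner_y].
Qed.

Let TF_vector ab n : linear (TF ab n).
Proof. by apply: tlift_linear => ?; [apply: inner_x|apply: inner_y]. Qed.

Let TF_state n w : linear (fun ab => TF ab n w).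
Proof.
elim/tensor_ind: w => [|c u v hu hv|x y].
- exact: (@linear_section0 _ _ _ _ (fun ab => TF ab n) (fun ab => @TF_vector ab n)).
- exact: (@linear_sectionD _ _ _ _ (fun ab => TF ab n) (fun ab => @TF_vector ab n) c u v hu hv).
- by move=> k ab ab'; rewrite !TF_pure (inner_linear n x y k).
Qed.

Lemma tensor_fields_regular : regular_fields TF.
Proof.
split=> // ab w.
elim/tensor_ind: w => [|c u v hu hv|x y].
- by exists 0 => n []; rewrite (plin0 (TF_vector _ _)).
- apply: half_supportedD hu hv _ => n hu hv.
  by rewrite (TF_vector _ _ c) hu hv scaler0 addr0.
elim/tensor_ind: ab => [|c u v hu hv|a b].
- by exists 0 => n []; rewrite (plin0 (TF_state _ _)).
- apply: half_supportedD hu hv _ => n hu hv.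
  by rewrite (TF_state _ _ c) hu hv scaler0 addr0.
have pair_supp b' x' : exists m : int, forall n i,
    tmul (Y1 a i x') (Y2 b' (n - 1 - i) y) <> 0 -> exists k : nat, n = (m%:~R - k%:R) / 2.
  have [_ _ /(_ a x')[m1 h1]] := Y1r; have [_ _ /(_ b' y)[m2 h2]] := Y2r.
  exists (m1 + m2 + 2) => n i hi.
  have [k1 e1] : exists k : nat, i = (m1%:~R - k%:R) / 2.
    by apply: h1 => e; apply: hi; rewrite e tmul0l.
  have [k2 e2] : exists k : nat, n - 1 - i = (m2%:~R - k%:R) / 2.
    by apply: h2 => e; apply: hi; rewrite e tmul0r.
  exists (k1 + k2)%N.
  have -> : n = (m2%:~R - k2%:R) / 2 + i + 1 by rewrite -e2 !subrK.
  by rewrite e1 !intrD natrD; field.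
have [m1 h1] := pair_supp (even_part b) x.
have [m2 h2] := pair_supp (odd_part b) (par_M x).
(* The coefficient at [n] is a sum over [i]. The functions [f1] and [f2] select a nonzero summand of
   either kind when there is one; this suffices since the bounds [m1] and [m2] are independent of
   [i]. *)
pose f1 n : tensor M1 M2 := if pselect (exists i, tmul (Y1 a i x) (Y2 (even_part b) (n - 1 - i) y) <> 0)
  is left H then tmul (Y1 a (projT1 (cid H)) x) (Y2 (even_part b) (n - 1 - projT1 (cid H)) y) else 0.
pose f2 n : tensor M1 M2 := if pselect (exists i, tmul (Y1 a i (par_M x)) (Y2 (odd_part b) (n - 1 - i) y) <> 0)
  is left H then tmul (Y1 a (projT1 (cid H)) (par_M x)) (Y2 (odd_part b) (n - 1 - projT1 (cid H)) y) else 0.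
apply: (@half_supportedD _ _ f1 f2).
- exists m1 => n; rewrite /f1; case: pselect => // H.
  by case: cid => i /= hi _; exact: h1 hi.
- exists m2 => n; rewrite /f2; case: pselect => // H.
  by case: cid => i /= hi _; exact: h2 hi.
move=> n; rewrite /f1 /f2; case: pselect => [H|H1].
  by case: cid => i /= hi /hi.
case: pselect => [H|H2]; first by case: cid => i /= hi _ /hi.
move=> _ _; rewrite TF_pure innerE /h fsbig1// => i _; rewrite /term.
have -> : tmul (Y1 a i x) (Y2 (even_part b) (n - 1 - i) y) = 0.
  by apply/eqP/negPn/negP => /eqP hi; apply: H1; exists i.
rewrite add0r; apply/eqP/negPn/negP => /eqP hi; apply: H2; exists i.
exact: hi.
Qed.

Let even_fixed b : par_V b = b -> even_part b = b.
Proof.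
move=> e; rewrite /even_part e [X in _ *: X](_ : _ = 2 *: b).
  by rewrite scalerA mulVf ?pnatr_eq0// scale1r.
by rewrite scaler_nat mulr2n.
Qed.
Let odd_fixed b : par_V b = b -> odd_part b = 0.
Proof. by move=> e; rewrite /odd_part e subrr scaler0. Qed.

(** The vacuum field is the identity concentrated in exponent [-1], so a single index survives, and
    the vacuum is even, so the parity of [x] does not enter. *)
Lemma tensor_fields_vacuumr (vac2 : V2) a n x y :
  (forall n w, Y2 vac2 n w = if n == -1 then w else 0) -> par_V vac2 = vac2 ->
  TF (tmul a vac2) n (tmul x y) = tmul (Y1 a n x) y.
Proof.
move=> Yv pv; rewrite TF_pure innerE /h.
have E i : term n a vac2 x y i = if i == n then tmul (Y1 a n x) y else 0.
  rewrite /term even_fixed// odd_fixed// (plin0 (Y2l _ _)) tmul0r addr0 Yv.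
  have -> : (n - 1 - i == -1) = (i == n).
    by rewrite addrAC -[X in _ == X]add0r (inj_eq (addIr _)) subr_eq0 eq_sym.
  by have [->|_] := eqVneq i n; rewrite // tmul0r.
rewrite (@fsbigTE _ _ _ _ [fset n]%fset) => [|i]; last first.
  by rewrite inE E => /negbTE ->.
by rewrite big_seq_fset1 E eqxx.
Qed.

Lemma tensor_fields_vacuuml (vac1 : V1) b n x y :
  (forall n w, Y1 vac1 n w = if n == -1 then w else 0) -> par_V b = b ->
  TF (tmul vac1 b) n (tmul x y) = tmul x (Y2 b n y).
Proof.
move=> Yv pv; rewrite TF_pure innerE /h.
have E i : term n vac1 b x y i = if i == -1 then tmul x (Y2 b n y) else 0.
  rewrite /term even_fixed// odd_fixed// (plin0 (Y2l _ _)) tmul0r addr0 Yv.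
  by have [->|_] := eqVneq i (-1); rewrite ?tmul0l// opprK subrK.
rewrite (@fsbigTE _ _ _ _ [fset (-1)%R]%fset) => [|i]; last first.
  by rewrite inE E => /negbTE ->.
by rewrite big_seq_fset1 E eqxx.
Qed.

Lemma tensor_fields_vacuum (vac1 : V1) (vac2 : V2) :
  (forall n w, Y1 vac1 n w = if n == -1 then w else 0) ->
  (forall n w, Y2 vac2 n w = if n == -1 then w else 0) -> par_V vac2 = vac2 ->
  forall n w, TF (tmul vac1 vac2) n w = if n == -1 then w else 0.
Proof.
move=> Yv1 Yv2 pv n w; elim/tensor_ind: w => [|c u v hu hv|x y].
- by rewrite (plin0 (TF_vector _ _)) if_same.
- by rewrite (TF_vector _ _ c) hu hv; case: ifP => // _; rewrite scaler0 addr0.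
- rewrite (tensor_fields_vacuumr _ _ _ _ Yv2 pv) Yv1.
  by case: ifP => // _; rewrite tmul0l.
Qed.

End TensorFields.

(** * Convergence of products *)

Section ComplexConvergence.
Variable R : realType.
Local Notation C := (cplx R).
Implicit Types (x y z : C) (u v : nat -> C).

(** The modulus as a real number, so that estimates take place in a totally ordered field. *)
Definition nm (z : C) : R := Normc.normc z.

Lemma normE z : `|z| = (nm z)%:C%C. Proof. by []. Qed.

Lemma nm_ge0 z : 0 <= nm z.
Proof. by have := normr_ge0 z; rewrite normE lecR. Qed.

Lemma nmM x y : nm (x * y) = nm x * nm y.
Proof. by apply: complexI; rewrite -normE normrM rmorphM. Qed.

Lemma nmD x y : nm (x + y) <= nm x + nm y.
Proof. by have := ler_normD x y; rewrite !normE -rmorphD lecR. Qed.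

Lemma nm0 : nm 0 = 0.
Proof. by apply: complexI; rewrite -normE normr0. Qed.

Lemma nm1 : nm 1 = 1.
Proof. by apply: complexI; rewrite -normE normr1. Qed.

Lemma nmN x : nm (- x) = nm x.
Proof. by apply: complexI; rewrite -!normE normrN. Qed.

Lemma nmB x y : nm (x - y) = nm (y - x).
Proof. by rewrite -nmN opprB. Qed.

Lemma nmV x : nm x^-1 = (nm x)^-1.
Proof. by apply: complexI; rewrite -normE normfV fmorphV. Qed.

Lemma nmX x n : nm (x ^+ n) = nm x ^+ n.
Proof. by elim: n => [|n IHn]; rewrite ?nm1// !exprS nmM IHn. Qed.

Lemma nm_eq0 x : (nm x == 0) = (x == 0).
Proof. by rewrite -[RHS]normr_eq0 normE -(inj_eq (@complexI R)). Qed.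

Lemma nm_sum (I : Type) (r : seq I) (P : pred I) (F : I -> C) :
  nm (\sum_(i <- r | P i) F i) <= \sum_(i <- r | P i) nm (F i).
Proof.
elim/big_rec2: _ => [|i a b _ h]; first by rewrite nm0.
by apply: le_trans (nmD _ _) _; rewrite lerD2l.
Qed.

Lemma nm_prod (I : Type) (r : seq I) (P : pred I) (F : I -> C) :
  nm (\prod_(i <- r | P i) F i) = \prod_(i <- r | P i) nm (F i).
Proof. by apply: big_morph; [exact: nmM|exact: nm1]. Qed.

Lemma nm_dist x y z : nm (x - z) <= nm (x - y) + nm (y - z).
Proof. by apply: le_trans (nmD _ _); rewrite addrA subrK. Qed.

Lemma nm_Re z : `|complex.Re z| <= nm z.
Proof. by have := normc_ge_Re z; rewrite lecR. Qed.

Lemma nm_le_ReIm z : nm z <= `|complex.Re z| + `|complex.Im z|.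
Proof.
have nmC (a : R) : nm a%:C%C = `|a|.
  by rewrite /nm /= expr0n addr0 sqrtr_sqr.
rewrite {1}(complexE z); apply: le_trans (nmD _ _) _; rewrite nmM !nmC.
have -> : nm ('i%C : C) = 1; last by rewrite mul1r.
by rewrite /nm /= expr0n add0r expr1n sqrtr1.
Qed.

Lemma nm_Im z : `|complex.Im z| <= nm z.
Proof.
have := nm_Re (z * 'i%C); rewrite ReiNIm normrN => h; apply: le_trans h _.
rewrite nmM; have -> : nm ('i%C : C) = 1; last by rewrite mulr1.
by rewrite /nm /= expr0n add0r expr1n sqrtr1.
Qed.

Definition tends u (l : C) : Prop :=
  forall e : R, 0 < e -> exists N : nat, forall n, (N <= n)%N -> nm (u n - l) < e.

Lemma tends_cvg u l : tends u l -> u n @[n --> \oo] --> l.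
Proof.
move=> h; apply/cvgrPdist_lt => e e0.
have : 0 < complex.Re e by move: e0; rewrite ltcE => /andP[].
move=> /h[N hN]; exists N => // n /= /hN hn.
rewrite distrC normE ltcE /= hn andbT.
by move: e0; rewrite ltcE /= => /andP[].
Qed.

Lemma tends_lim u l : tends u l -> lim (u n @[n --> \oo]) = l.
Proof. by move=> /tends_cvg h; apply: (cvg_lim (@norm_hausdorff _ _) h). Qed.

Lemma tends_unique u l l' : tends u l -> tends u l' -> l = l'.
Proof. by move=> /tends_lim <- /tends_lim <-. Qed.

Lemma tends_ext u v l : (forall n, u n = v n) -> tends u l -> tends v l.
Proof. by move=> uv h e /h[N hN]; exists N => n /hN; rewrite uv. Qed.

Lemma tends_shift u l : tends (fun n => u n.+1) l -> tends u l.
Proof. by move=> h e /h[N hN]; exists N.+1 => -[|n]// /hN. Qed.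

Lemma tends_const l : tends (fun=> l) l.
Proof. by move=> e e0; exists 0%N => n _; rewrite subrr nm0. Qed.

Lemma tends_bounded u l : tends u l ->
  exists2 B : R, 0 < B & exists N : nat, forall n, (N <= n)%N -> nm (u n) <= B.
Proof.
move=> /(_ 1 ltr01)[N hN]; exists (nm l + 1); first by rewrite ltr_wpDl ?nm_ge0.
exists N => n /hN h; have := nmD (u n - l) l; rewrite subrK => /le_trans; apply.
by rewrite addrC lerD2l ltW.
Qed.

Lemma tendsM u v a b : tends u a -> tends v b -> tends (fun n => u n * v n) (a * b).
Proof.
move=> hu hv e e0; have [B B0 [N1 h1]] := tends_bounded hu.
have b0 : 0 < nm b + 1 by rewrite ltr_wpDl ?nm_ge0.
have e1 : 0 < e / 2 / (nm b + 1) by rewrite !divr_gt0.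
have e2 : 0 < e / 2 / B by rewrite !divr_gt0.
have [N2 h2] := hu _ e1; have [N3 h3] := hv _ e2.
exists (maxn N1 (maxn N2 N3)) => n; rewrite !geq_max => /and3P[/h1{}h1 /h2{}h2 /h3{}h3].
have -> : u n * v n - a * b = u n * (v n - b) + (u n - a) * b by ring.
apply: le_lt_trans (nmD _ _) _; rewrite !nmM [e]splitr.
apply: ltr_leD.
  apply: (@le_lt_trans _ _ (B * nm (v n - b))); first by rewrite ler_wpM2r ?nm_ge0.
  by rewrite mulrC -ltr_pdivlMr.
apply: (@le_trans _ _ (nm (u n - a) * (nm b + 1))).
  by rewrite ler_wpM2l ?nm_ge0// lerDl.
by rewrite -ler_pdivlMr// ltW.
Qed.

Lemma tends_prod (I : Type) (r : seq I) (u_ : I -> nat -> C) (a : I -> C) :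
  (forall i, tends (u_ i) (a i)) ->
  tends (fun n => \prod_(i <- r) u_ i n) (\prod_(i <- r) a i).
Proof.
move=> h; elim: r => [|i r IHr].
  rewrite big_nil; apply: tends_ext (tends_const 1) => n.
  by rewrite big_nil.
rewrite big_cons; apply: tends_ext (tendsM (h i) IHr) => n.
by rewrite big_cons.
Qed.

Lemma geometric_small (r e : R) : 0 <= r < 1 -> 0 < e ->
  exists N : nat, forall n, (N <= n)%N -> r ^+ n < e.
Proof.
move=> /andP[r0 r1] e0.
have /cvgrPdist_lt/(_ e e0)[N _ hN] : (fun n => r ^+ n) @ \oo --> (0 : R).
  by apply: cvg_expr; rewrite ger0_norm.
exists N => n /hN /=; rewrite sub0r normrN => /(le_lt_trans _); apply.
exact: ler_norm.
Qed.

Lemma tends_geometric x : nm x < 1 ->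
  tends (fun m => \sum_(j < m) x ^+ j) (1 - x)^-1.
Proof.
move=> x1 e e0; have x0 : 1 - x != 0.
  by rewrite subr_eq0; apply: contraTneq x1 => <-; rewrite nm1 ltxx.
have n0 : 0 < nm (1 - x) by rewrite lt_def nm_eq0 x0 nm_ge0.
have [|N hN] := @geometric_small (nm x) (e * nm (1 - x)) _ (mulr_gt0 e0 n0).
  by rewrite nm_ge0.
exists N => n /hN h.
have -> : \sum_(j < n) x ^+ j - (1 - x)^-1 = - (x ^+ n / (1 - x)).
  have := subrX1 x n; rewrite -opprB => /eqP; rewrite eqr_oppLR -mulNr opprB => /eqP E.
  have -> : \sum_(j < n) x ^+ j = (1 - x ^+ n) / (1 - x).
    by rewrite E mulrAC divff// mul1r.
  by field.
by rewrite nmN nmM nmV nmX ltr_pdivrMr.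
Qed.

Lemma real_tends_ex (a : nat -> R) (B r : R) : 0 <= r < 1 ->
  (forall n, `|a n.+1 - a n| <= B * r ^+ n) ->
  exists l : R, forall e : R, 0 < e ->
    exists N : nat, forall n, (N <= n)%N -> `|a n - l| < e.
Proof.
move=> /andP[r0 r1] h; pose d n := a n.+1 - a n.
have cd : cvgn (series d).
  apply: normed_cvg; apply: (@series_le_cvg _ _ (geometric B r)).
  - by move=> n /=.
  - by move=> n; rewrite /geometric /=; apply: le_trans (h n).
  - by move=> n; exact: h.
  - by apply: is_cvg_geometric_series; rewrite ger0_norm.
exists (a 0%N + limn (series d)) => e e0.
have /cvgrPdist_lt/(_ e e0)[N _ hN] := cd.
exists N => n /hN; rewrite distrC /series /= telescope_sumr//.
by rewrite opprD addrA.
Qed.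

Lemma tends_ex u (B r : R) : 0 <= r < 1 ->
  (forall n, nm (u n.+1 - u n) <= B * r ^+ n) -> exists l, tends u l.
Proof.
move=> r01 h.
have [a ha] := @real_tends_ex (fun n => complex.Re (u n)) B r r01
  (fun n => le_trans (eq_ind _ (fun t => `|t| <= nm (u n.+1 - u n)) (nm_Re _) _ (raddfB _ _ _)) (h n)).
have [b hb] := @real_tends_ex (fun n => complex.Im (u n)) B r r01
  (fun n => le_trans (eq_ind _ (fun t => `|t| <= nm (u n.+1 - u n)) (nm_Im _) _ (raddfB _ _ _)) (h n)).
exists (a +i* b)%C => e e0; have e2 : 0 < e / 2 by rewrite divr_gt0.
have [N1 h1] := ha _ e2; have [N2 h2] := hb _ e2.
exists (maxn N1 N2) => n; rewrite geq_max => /andP[/h1{}h1 /h2{}h2].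
apply: le_lt_trans (nm_le_ReIm _) _; rewrite [e]splitr.
by move: h1 h2; case: (u n) => x y /= h1 h2; apply: ltrD.
Qed.

Definition qprod (u q : C) (N : nat) : C := \prod_(n < N) (1 - u * q ^+ n).

Lemma prod_bound (b : nat -> R) (B r : R) : 0 <= B -> 0 <= r < 1 ->
  (forall n, 0 <= b n <= B * r ^+ n) ->
  forall N, \prod_(n < N) (1 + b n) <= expR (B / (1 - r)).
Proof.
move=> B0 /andP[r0 r1] hb N.
have r10 : 0 < 1 - r by rewrite subr_gt0.
apply: (@le_trans _ _ (expR (\sum_(n < N) b n))).
  rewrite expR_sum; apply: ler_prod => n _.
  by have /andP[b0 _] := hb n; rewrite addr_ge0// expR_ge1Dx.
rewrite ler_expR.
apply: (@le_trans _ _ (\sum_(n < N) B * r ^+ n)).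
  by apply: ler_sum => n _; have /andP[] := hb n.
rewrite -mulr_sumr ler_wpM2l// -[_^-1]mul1r ler_pdivlMr//.
have -> : (\sum_(i < N) r ^+ i) * (1 - r) = 1 - r ^+ N.
  by rewrite -[LHS]opprK -mulrN opprB mulrC -subrX1 opprB.
by rewrite gerBl exprn_ge0.
Qed.

(** The partial products are uniformly bounded, hence consecutive ones differ by at most a constant
    times the [n]-th power of [nm q]. *)
Lemma qprod_ex (u q : C) : nm q < 1 -> exists l, tends (qprod u q) l.
Proof.
move=> q1; have q01 : 0 <= nm q < 1 by rewrite nm_ge0.
apply: (@tends_ex _ (expR (nm u / (1 - nm q)) * nm u) (nm q)) => // n.
have -> : qprod u q n.+1 - qprod u q n = - (qprod u q n * (u * q ^+ n)).
  by rewrite /qprod big_ord_recr /=; ring.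
rewrite nmN !nmM nmX -mulrA ler_wpM2r ?mulr_ge0 ?exprn_ge0 ?nm_ge0//.
rewrite /qprod nm_prod.
apply: le_trans (@prod_bound (fun n => nm u * nm q ^+ n) _ _ (nm_ge0 u) q01 _ n).
  apply: ler_prod => i _; rewrite nm_ge0 /=.
  by apply: le_trans (nmD _ _) _; rewrite nm1 nmN nmM nmX.
by move=> m; rewrite lexx andbT mulr_ge0 ?exprn_ge0 ?nm_ge0.
Qed.

(** The infinite q-Pochhammer symbol. *)
Definition poch (u q : C) : C := xget 0 [set l | tends (qprod u q) l].

Lemma pochP (u q : C) : nm q < 1 -> tends (qprod u q) (poch u q).
Proof. by move=> /(qprod_ex u) h; exact: (xgetPex 0 h). Qed.

Lemma poch_eq (u q l : C) : nm q < 1 -> tends (qprod u q) l -> poch u q = l.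
Proof. by move=> q1; apply: tends_unique; exact: pochP. Qed.

(** The factors stay away from zero, so the product of their inverses converges as well, and the two
    limits multiply to one. *)
Lemma poch_neq0 (u q : C) : nm q < 1 -> nm u < 1 -> poch u q != 0.
Proof.
move=> q1 u1; have u0 : 0 < 1 - nm u by rewrite subr_gt0.
have q01 : 0 <= nm q < 1 by rewrite nm_ge0.
have small n : nm (u * q ^+ n) <= nm u.
  by rewrite nmM nmX ler_piMr ?nm_ge0// exprn_ile1 ?nm_ge0// ltW.
have low n : 1 - nm u <= nm (1 - u * q ^+ n).
  have := nmD (1 - u * q ^+ n) (u * q ^+ n); rewrite subrK nm1 => h.
  by rewrite lerBlDr; apply: le_trans h _; rewrite lerD2l.
have t0 n : 1 - u * q ^+ n != 0 by rewrite -nm_eq0 gt_eqF// (lt_le_trans u0 (low n)).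
have inv_le n : nm (1 - u * q ^+ n)^-1 <= (1 - nm u)^-1.
  by rewrite nmV lef_pV2// posrE ?(lt_le_trans u0 (low n)).
pose v N := \prod_(n < N) (1 - u * q ^+ n)^-1.
pose B := nm u / (1 - nm u).
have B0 : 0 <= B by rewrite divr_ge0 ?nm_ge0// ltW.
have [l hl] : exists l, tends v l.
  apply: (@tends_ex _ (expR (B / (1 - nm q)) * B) (nm q)) => // n.
  have -> : v n.+1 - v n = v n * (u * q ^+ n * (1 - u * q ^+ n)^-1).
    by rewrite /v big_ord_recr /= -{2}[\prod_(_ < _) _]mulr1 -mulrBr; congr (_ * _); field.
  have hB m : nm (u * q ^+ m * (1 - u * q ^+ m)^-1) <= B * nm q ^+ m.
    by rewrite !nmM nmX /B mulrAC ler_wpM2r ?exprn_ge0 ?nm_ge0// ler_wpM2l ?nm_ge0.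
  rewrite nmM -[X in _ <= X]mulrA; apply: ler_pM; rewrite ?nm_ge0//.
  rewrite /v nm_prod.
  apply: le_trans (@prod_bound (fun n => B * nm q ^+ n) B _ B0 q01 _ n).
    apply: ler_prod => i _; rewrite nm_ge0 /=.
    have -> : (1 - u * q ^+ i)^-1 = 1 + u * q ^+ i * (1 - u * q ^+ i)^-1 by field.
    by apply: le_trans (nmD _ _) _; rewrite nm1 lerD2l.
  by move=> m; rewrite lexx andbT mulr_ge0 ?exprn_ge0 ?nm_ge0.
have := tends_unique (tendsM (pochP u q1) hl) (tends_ext _ (tends_const 1)).
move=> h; apply/eqP => p0; have : poch u q * l = 1.
  apply: h => n; rewrite /qprod /v -big_split big1// => i _ /=.
  by rewrite divff.
by rewrite p0 mul0r => /esym/eqP; rewrite oner_eq0.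
Qed.

End ComplexConvergence.

(** * Unconditional sums over occupation numbers *)

Section UnconditionalSums.
Variable R : realType.
Local Notation C := (cplx R).

Definition abs_bounded (I : choiceType) (f : I -> C) (M : R) : Prop :=
  forall A : {fset I}, \sum_(i <- A) nm (f i) <= M.

Definition sums_to (I : choiceType) (f : I -> C) (l : C) : Prop :=
  forall e : R, 0 < e -> exists A : {fset I}, forall B : {fset I},
    (A `<=` B)%fset -> nm (\sum_(i <- B) f i - l) < e.

Lemma sums_to_has_sum (I : choiceType) (f : I -> C) l :
  sums_to f l -> has_sum f l.
Proof.
move=> h e e0; have : 0 < complex.Re e by move: e0; rewrite ltcE => /andP[].
move=> /h[A hA]; exists A => B /hA hn; rewrite normE ltcE /= hn andbT.
by move: e0; rewrite ltcE /= => /andP[].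
Qed.

Lemma big_fset_split (I : choiceType) (V : nmodType) (A B : {fset I}) (f : I -> V) :
  (A `<=` B)%fset ->
  \sum_(i <- B) f i = \sum_(i <- A) f i + \sum_(i <- (B `\` A)%fset) f i.
Proof.
move=> AB; rewrite (big_fsetID _ (mem A)) /=; congr (_ + _).
  apply: eq_fbigl => i; rewrite !inE /=; apply: andb_idl.
  by move=> iA; apply: (fsubsetP AB).
by apply: eq_fbigl => i; rewrite !inE /= andbC.
Qed.

Lemma abs_bounded_sub (I : choiceType) (f : I -> C) (A B : {fset I}) :
  (A `<=` B)%fset -> \sum_(i <- A) nm (f i) <= \sum_(i <- B) nm (f i).
Proof.
move=> /big_fset_split ->; rewrite lerDl; apply: sumr_ge0 => i _; exact: nm_ge0.
Qed.

(** Absolute boundedness makes the tails small, so it is enough to approach [l] along some cofinal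
    family of finite sets. *)
Lemma sums_to_criterion (I : choiceType) (f : I -> C) (M : R) l :
  abs_bounded f M ->
  (forall (e : R) (A : {fset I}), 0 < e ->
    exists2 B : {fset I}, (A `<=` B)%fset & nm (\sum_(i <- B) f i - l) < e) ->
  sums_to f l.
Proof.
move=> fM cl e e0; pose S := [set x | exists A : {fset I}, x = \sum_(i <- A) nm (f i)].
have supS : has_sup S.
  split; first by exists (\sum_(i <- (fset0 : {fset I})) nm (f i)), fset0.
  by exists M => _ [A ->].
have e3 : 0 < e / 3 by rewrite divr_gt0.
have [_ [A ->] hA] := sup_adherent e3 supS.
have tail (B : {fset I}) : (A `<=` B)%fset ->
    nm (\sum_(i <- (B `\` A)%fset) f i) <= e / 3.
  move=> AB; apply: le_trans (nm_sum _ _ _) _.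
  have : \sum_(i <- B) nm (f i) <= sup S.
    by apply: sup_upper_bound => //; exists B.
  rewrite (big_fset_split _ AB) => h.
  by have := lt_le_trans hA (le_refl _) => {}hA; lra.
have [D AD hD] := cl _ A e3; exists A => B AB.
have -> : \sum_(i <- B) f i - l = \sum_(i <- (B `\` A)%fset) f i
    - \sum_(i <- (D `\` A)%fset) f i + (\sum_(i <- D) f i - l).
  by rewrite (big_fset_split f AB) (big_fset_split f AD); ring.
have h1 := tail B AB; have h2 := tail D AD.
have h3 := nmD (\sum_(i <- (B `\` A)%fset) f i - \sum_(i <- (D `\` A)%fset) f i)
  (\sum_(i <- D) f i - l).
have h4 := nmD (\sum_(i <- (B `\` A)%fset) f i) (- \sum_(i <- (D `\` A)%fset) f i).
rewrite nmN in h4; lra.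
Qed.

Lemma sums_toZ (I : choiceType) (f : I -> C) l c :
  sums_to f l -> sums_to (fun i => c * f i) (c * l).
Proof.
move=> h e e0; have c0 : 0 < nm c + 1 by rewrite ltr_wpDl ?nm_ge0.
have [A hA] := h _ (divr_gt0 e0 c0); exists A => B /hA hB.
rewrite -mulr_sumr -mulrBr nmM.
apply: (@le_lt_trans _ _ ((nm c + 1) * nm (\sum_(i <- B) f i - l))).
  by rewrite ler_wpM2r ?nm_ge0// lerDl.
by rewrite mulrC -ltr_pdivlMr.
Qed.

Lemma sums_toD (I : choiceType) (f g : I -> C) a b :
  sums_to f a -> sums_to g b -> sums_to (fun i => f i + g i) (a + b).
Proof.
move=> hf hg e e0; have e2 : 0 < e / 2 by rewrite divr_gt0.
have [A hA] := hf _ e2; have [B hB] := hg _ e2; exists (A `|` B)%fset => D.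
rewrite fsubUset => /andP[/hA h1 /hB h2]; rewrite big_split /= opprD addrACA.
by apply: le_lt_trans (nmD _ _) _; lra.
Qed.

Lemma sums_to_ext (I : choiceType) (f g : I -> C) l :
  f =1 g -> sums_to f l -> sums_to g l.
Proof.
move=> fg h e /h[A hA]; exists A => B /hA.
by rewrite (eq_bigr g) => // i _.
Qed.

Section Product.
Variables (I J : choiceType) (f : I -> C) (g : J -> C).

Let FP (A : {fset I}) (B : {fset J}) : {fset (I * J)%type} :=
  [fset p | p in allpairs pair A B]%fset.

Let FP_mem A B p : (p \in FP A B) = (p.1 \in A) && (p.2 \in B).
Proof.
rewrite inE; case: p => x y /=; apply/allpairsP/andP => [[[a b] /= [aA bB [-> ->]]]//|].
by case=> xA yB; exists (x, y).
Qed.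

Let FP_sum (V : nmodType) A B (h : I * J -> V) :
  \sum_(p <- FP A B) h p = \sum_(x <- A) \sum_(y <- B) h (x, y).
Proof.
have -> : \sum_(p <- FP A B) h p = \sum_(p <- allpairs pair A B) h p.
  apply: perm_big; apply: uniq_perm; first exact: fset_uniq.
    by apply: allpairs_uniq; [exact: fset_uniq|exact: fset_uniq|move=> [? ?] [? ?]].
  by move=> p; rewrite inE.
by rewrite big_allpairs_dep.
Qed.

Let FP_sub (A : {fset (I * J)%type}) :
  (A `<=` FP [fset p.1 | p in A] [fset p.2 | p in A])%fset.
Proof.
apply/fsubsetP => p pA; rewrite FP_mem; apply/andP; split.
  by apply/imfsetP; exists p.
by apply/imfsetP; exists p.
Qed.

Lemma abs_bounded_prod M N : abs_bounded f M -> abs_bounded g N ->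
  abs_bounded (fun p : I * J => f p.1 * g p.2) (M * N).
Proof.
move=> fM gN A; apply: le_trans (abs_bounded_sub _ (FP_sub A)) _.
rewrite (FP_sum _ _ (fun p => nm (f p.1 * g p.2))) /=.
under eq_bigr => x _ do (under eq_bigr => y _ do rewrite nmM); 
rewrite -?mulr_sumr.
have -> : \sum_(x <- [fset p.1 | p in A]%fset) \sum_(y <- [fset p.2 | p in A]%fset)
    nm (f x) * nm (g y) = (\sum_(x <- [fset p.1 | p in A]%fset) nm (f x)) *
    (\sum_(y <- [fset p.2 | p in A]%fset) nm (g y)).
  by rewrite mulr_suml; apply: eq_bigr => x _; rewrite mulr_sumr.
by apply: ler_pM => //; apply: sumr_ge0 => ? _; exact: nm_ge0.
Qed.

(** Rectangles are cofinal among the finite sets of pairs, and over a rectangle the sum factors. *)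
Lemma sums_to_prod M N a b : abs_bounded f M -> abs_bounded g N ->
  sums_to f a -> sums_to g b ->
  sums_to (fun p : I * J => f p.1 * g p.2) (a * b).
Proof.
move=> fM gN fa gb; apply: sums_to_criterion (abs_bounded_prod fM gN) _ => e A e0.
have M0 : 0 <= M by have := fM fset0; rewrite big_seq_fset0.
have M1 : 0 < M + 1 by rewrite ltr_wpDl.
have b1 : 0 < nm b + 1 by rewrite ltr_wpDl ?nm_ge0.
have e2 : 0 < e / 2 by rewrite divr_gt0.
have [A1 h1] := fa _ (divr_gt0 e2 b1); have [B1 h2] := gb _ (divr_gt0 e2 M1).
pose A2 := (A1 `|` [fset p.1 | p in A])%fset.
pose B2 := (B1 `|` [fset p.2 | p in A])%fset.
exists (FP A2 B2).
  apply: fsubset_trans (FP_sub A) _; apply/fsubsetP => p; rewrite !FP_mem.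
  by move=> /andP[p1 p2]; rewrite !in_fsetU p1 p2 !orbT.
rewrite (FP_sum _ _ (fun p => f p.1 * g p.2)) /=.
have -> : \sum_(x <- A2) \sum_(y <- B2) f x * g y =
    (\sum_(x <- A2) f x) * (\sum_(y <- B2) g y).
  by rewrite mulr_suml; apply: eq_bigr => x _; rewrite mulr_sumr.
have {}h1 := h1 A2 (fsubsetUl _ _); have {}h2 := h2 B2 (fsubsetUl _ _).
have hM : nm (\sum_(x <- A2) f x) <= M by apply: le_trans (nm_sum _ _ _) (fM _).
set F := \sum_(x <- A2) _ in h1 hM *; set G := \sum_(y <- B2) _ in h2 *.
have -> : F * G - a * b = F * (G - b) + (F - a) * b by ring.
apply: le_lt_trans (nmD _ _) _; rewrite !nmM [e]splitr; apply: ltr_leD.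
  apply: (@le_lt_trans _ _ ((M + 1) * nm (G - b))).
    by rewrite ler_wpM2r ?nm_ge0// (le_trans hM)// lerDl.
  by rewrite mulrC -ltr_pdivlMr.
apply: (@le_trans _ _ (nm (F - a) * (nm b + 1))).
  by rewrite ler_wpM2l ?nm_ge0// lerDl.
by rewrite -ler_pdivlMr// ltW.
Qed.

End Product.

(** A finite set of indices is covered by the union of its fibers. What remains of [A] outside that
    union consists of invalid elements, on which [f] vanishes. *)
Lemma sums_to_fibers (S I : choiceType) (f : S -> C) l (valid : pred S)
    (pi : S -> I) (fib : I -> {fset S}) :
  (forall i s, (s \in fib i) = valid s && (pi s == i)) ->
  (forall s, ~~ valid s -> f s = 0) ->
  sums_to f l -> sums_to (fun i => \sum_(s <- fib i) f s) l.
Proof.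
move=> fibP f0 h e /h[A hA]; exists [fset pi s | s in A]%fset => B AB.
pose D := [fset s in flatten [seq enum_fset (fib i) | i <- B]]%fset.
have memD s : (s \in D) = valid s && (pi s \in B).
  rewrite inE; apply/flattenP/andP => [[_ /mapP[i iB ->]]|[vs sB]].
    by move=> si; have := fibP i s; rewrite si => /esym/andP[vs /eqP ->].
  exists (enum_fset (fib (pi s))); first by apply/mapP; exists (pi s).
  by have := fibP (pi s) s; rewrite vs eqxx => ->.
have <- : \sum_(s <- (A `|` D)%fset) f s = \sum_(i <- B) \sum_(s <- fib i) f s.
  have -> : \sum_(s <- (A `|` D)%fset) f s = \sum_(s <- D) f s.
    rewrite (big_fset_split f (fsubsetUr A D)) [X in _ + X]big1_seq ?addr0// => s.
    rewrite !inE /= => /andP[sD]; rewrite (negbTE sD) orbF => sA; apply: f0.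
    apply: contra sD; rewrite -/D => vs.
    have := memD s; rewrite inE => ->; rewrite vs /=.
    by apply: (fsubsetP AB); apply/imfsetP; exists s.
  have -> : \sum_(s <- D) f s =
      \sum_(s <- flatten [seq enum_fset (fib i) | i <- B]) f s.
    apply: perm_big; apply: uniq_perm; first exact: fset_uniq.
      have := fset_uniq B; elim: (enum_fset B) => //= i r IHr /andP[ir ur].
      rewrite cat_uniq fset_uniq IHr// andbT; apply/hasPn => s /flattenP[_ /mapP[j jr ->]] sj.
      have := fibP j s; rewrite sj => /esym/andP[_ /eqP js]; apply/negP => si.
      have := fibP i s; rewrite si => /esym/andP[_ /eqP si'].
      by move: ir; rewrite -si' js jr.
    by move=> s; rewrite inE.
  by rewrite big_flatten big_map.
exact: hA (fsubsetUl _ _).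
Qed.

Section StateSums.
Variables (F : finType) (g : F * nat -> nat -> C).
Local Notation mode := (F * nat)%type.
Hypothesis g0 : forall x, g x 0 = 1.

Definition state_weight (s : multiset mode) : C := \prod_(x <- finsupp s) g x (s x).

Let box k : {fset mode} := [fset (y.1, val y.2) | y : F * 'I_k]%fset.

Fact occupation_key : unit. Proof. exact: tt. Qed.

Let occ k m (f : {ffun F * 'I_k -> 'I_m}) : multiset mode :=
  [fsfun[occupation_key] x in box k =>
    if insub x.2 is Some i then nat_of_ord (f (x.1, i)) else 0%N].

Let boxP k x : (x \in box k) = (x.2 < k)%N.
Proof.
apply/imfsetP/idP => [[y _ ->] /=|xk]; first exact: ltn_ord.
by exists (x.1, Ordinal xk) => //; case: x xk.
Qed.

Let occE k m f (y : F * 'I_k) : @occ k m f (y.1, val y.2) = f y.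
Proof. by rewrite fsfunE boxP ltn_ord /= valK; case: y. Qed.

Let occ_out k m f x : ~~ (x.2 < k)%N -> @occ k m f x = 0%N.
Proof. by move=> h; rewrite fsfunE boxP (negbTE h). Qed.

Let occ_inj k m : injective (@occ k m).
Proof.
move=> f f' ff'; apply/ffunP => y; apply: val_inj => /=.
by rewrite -!occE ff'.
Qed.

Let occ_weight (D : comNzSemiRingType) k m (h : mode -> nat -> D) f : (forall x, h x 0 = 1) ->
  \prod_(x <- finsupp (@occ k m f)) h x (occ f x) = \prod_y h (y.1, val y.2) (f y).
Proof.
move=> h0; transitivity (\prod_(x <- box k) h x (occ f x)).
  apply: big_fset_incl.
    apply/fsubsetP => x; rewrite mem_finsupp boxP; apply: contraNT.
    by move=> /occ_out ->.
  by move=> x _; rewrite memNfinsupp => /eqP ->.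
rewrite big_imfset /=; last first.
  by move=> [a i] [b j] _ _ /= [-> /val_inj ->].
rewrite big_enum /=; apply: eq_bigr => y _; rewrite occE.
by [].
Qed.

Let states k m : {fset multiset mode} := [fset occ f | f : {ffun F * 'I_k -> 'I_m}]%fset.

Let states_sum k m (V : nmodType) (h : multiset mode -> V) :
  \sum_(s <- states k m) h s = \sum_(f : {ffun F * 'I_k -> 'I_m}) h (occ f).
Proof.
by rewrite big_imfset /= ?big_enum// => f f' _ _; exact: occ_inj.
Qed.

Lemma states_exhaust (A : {fset multiset mode}) : exists k0 m0 : nat,
  forall k m, (k0 <= k)%N -> (m0 <= m)%N -> (A `<=` states k m)%fset.
Proof.
exists (\max_(s <- A) \max_(x <- finsupp s) x.2.+1)%N.
exists (\max_(s <- A) \max_(x <- finsupp s) (s x).+1).+1%N => k m kk mm.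
apply/fsubsetP => s sA; have m0 : (0 < m)%N by apply: leq_ltn_trans mm.
have sk x : x \in finsupp s -> (x.2 < k)%N.
  move=> xs; apply: leq_trans kk.
  apply: leq_trans (leq_bigmax_seq (F := fun s : multiset mode =>
    \max_(x <- finsupp s) x.2.+1) s sA isT).
  exact: (leq_bigmax_seq (F := fun x => x.2.+1) x xs isT).
have sm x : (s x < m)%N.
  have [xs|] := boolP (x \in finsupp s); last by rewrite memNfinsupp => /eqP ->.
  apply: leq_trans (ltnW mm).
  apply: leq_trans (leq_bigmax_seq (F := fun s : multiset mode =>
    \max_(x <- finsupp s) (s x).+1) s sA isT).
  exact: (leq_bigmax_seq (F := fun x => (s x).+1) x xs isT).
apply/imfsetP; exists [ffun y : F * 'I_k => Ordinal (sm (y.1, val y.2))] => //.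
apply/fsfunP => x; have [xk|xk] := boolP (x.2 < k)%N.
  have -> : x = ((x.1, Ordinal xk).1, val (x.1, Ordinal xk).2) by case: x xk.
  by rewrite occE ffunE.
rewrite occ_out//; apply/eqP; rewrite -memNfinsupp; apply: contra xk.
exact: sk.
Qed.

Variables (B r : R) (G : mode -> C) (L : C).
Hypothesis B0 : 0 <= B.
Hypothesis r01 : 0 <= r < 1.
Hypothesis gB : forall x m, \sum_(j < m) nm (g x j) <= 1 + B * r ^+ x.2.
Hypothesis gG : forall x, tends (fun m => \sum_(j < m) g x j) (G x).
Hypothesis GL : tends (fun k => \prod_(n < k) \prod_(a : F) G (a, n : nat)) L.

(** Distributivity: summing over bounded occupation numbers gives a product over the modes. The
    coefficients are general because both the weights and their moduli are summed this way. *)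
Let prod_weight (D : comNzSemiRingType) k m (h : mode -> nat -> D) :
  (forall x, h x 0 = 1) ->
  \sum_(s <- states k m) \prod_(x <- finsupp s) h x (s x) =
  \prod_(n < k) \prod_(a : F) \sum_(j < m) h (a, n : nat) j.
Proof.
move=> h0; rewrite states_sum.
under eq_bigr => f _ do rewrite (occ_weight f h0).
rewrite -(bigA_distr_bigA (fun y j => h (y.1, val y.2) (j : 'I_m))).
by rewrite exchange_big pair_big /=.
Qed.

Let states_weight k m :
  \sum_(s <- states k m) state_weight s =
  \prod_(n < k) \prod_(a : F) \sum_(j < m) g (a, n : nat) j.
Proof. exact: prod_weight. Qed.

Lemma state_weight_bounded :
  exists M, abs_bounded state_weight M.
Proof.
have [r0 r1] := andP r01.
exists (expR (B / (1 - r)) ^+ #|F|) => A; have [k0 [m0 hk]] := states_exhaust A.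
apply: le_trans (abs_bounded_sub _ (hk k0 m0 (leqnn _) (leqnn _))) _.
under eq_bigr => s _ do rewrite /state_weight nm_prod.
rewrite (@prod_weight R k0 m0 (fun x j => nm (g x j))) => [|x]; last by rewrite g0 nm1.
apply: (@le_trans _ _ (\prod_(n < k0) \prod_(a : F) (1 + B * r ^+ n))).
  apply: ler_prod => n _; apply/andP; split.
    by apply: prodr_ge0 => a _; apply: sumr_ge0 => j _; exact: nm_ge0.
  apply: ler_prod => a _; apply/andP; split; last exact: gB.
  by apply: sumr_ge0 => j _; exact: nm_ge0.
under eq_bigr => n _ do rewrite prodr_const.
rewrite prodrXl; apply: lerXn2r.
- by rewrite nnegrE; apply: prodr_ge0 => n _; rewrite addr_ge0 ?mulr_ge0 ?exprn_ge0.
- by rewrite nnegrE expR_ge0.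
apply: (prod_bound (b := fun n => B * r ^+ n)) => // n.
by rewrite lexx andbT mulr_ge0 ?exprn_ge0.
Qed.

Lemma state_weight_sum : sums_to state_weight L.
Proof.
have [M hM] := state_weight_bounded.
apply: (sums_to_criterion hM) => e A e0; have [k0 [m0 hk]] := states_exhaust A.
have e2 : 0 < e / 2 by rewrite divr_gt0.
(* First the number of levels, so that the product of the full mode sums is near [L]; then, for
   these finitely many modes, the bound on the occupation numbers. *)
have [k1 h1] := GL e2; pose k := maxn k0 k1.
have tk : tends (fun m => \prod_(n < k) \prod_(a : F) \sum_(j < m) g (a, n : nat) j)
    (\prod_(n < k) \prod_(a : F) G (a, n : nat)).
  by apply: tends_prod => n; apply: tends_prod => a; exact: gG.
have [m1 h2] := tk _ e2; pose m := maxn m0 m1.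
exists (states k m); first by apply: hk; rewrite leq_maxl.
rewrite states_weight; apply: le_lt_trans (nm_dist _ (\prod_(n < k) \prod_(a : F) G (a, n : nat)) _) _.
have {}h1 := h1 k (leq_maxr _ _); have {}h2 := h2 m (leq_maxr _ _); lra.
Qed.

End StateSums.

End UnconditionalSums.

Arguments nm : simpl never.

Section FockSums.
Variables (R : realType) (p : bool) (d : nat).
Local Notation C := (cplx R).
Implicit Types (x : fock_mode d -> C) (s : multiset (fock_mode d)).

Definition state_prod x s : C :=
  if state_valid p s then \prod_(a <- enum_mset s) x a else 0.

Let occ x (a : fock_mode d) (j : nat) : C :=
  if p && (1 < j)%N then 0 else x a ^+ j.

Let state_prodE x s : state_prod x s = state_weight (occ x) s.
Proof.
rewrite /state_prod /state_weight.
have cnt a : s a = count_mem a (enum_mset s) by rewrite -mset_seqE seq_mset_id.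
have [vs|vs] := boolP (state_valid p s).
  rewrite big_mset; apply: eq_bigr => a _; rewrite /occ.
  case: ifP => // /andP[pp]; move: vs; rewrite /state_valid pp /= => us.
  by rewrite cnt count_uniq_mem//; case: (_ \in _).
move: vs; rewrite /state_valid negb_imply => /andP[pp us].
have [a aa] : exists a, (1 < s a)%N.
  apply: contrapT => h; move/negP: us; apply; apply: count_mem_uniq => a.
  rewrite -cnt; have := h; rewrite -forallNE => /(_ a) /negP; rewrite -leqNgt.
  by rewrite -msuppE mem_finsupp; case: (s a) => [|[]].
rewrite (bigD1_seq a) /= ?fset_uniq//; last first.
  by rewrite mem_finsupp; case: (s a) aa.
by rewrite /occ pp aa mul0r.
Qed.

Let G x (a : fock_mode d) : C := if p then 1 + x a else (1 - x a)^-1.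

Let occ_tends x a : (p = false -> nm (x a) < 1) ->
  tends (fun m => \sum_(j < m) occ x a j) (G x a).
Proof.
rewrite /occ /G; case: (p) => [_|/(_ erefl) h]; last exact: tends_geometric.
apply: tends_shift; apply: tends_shift; apply: tends_ext (tends_const _) => m.
rewrite !big_ord_recl /= big1 ?addr0 ?expr1 ?expr0//.
Qed.

Lemma state_prod_sum x (B r rho : R) (L : C) :
  0 <= B -> 0 <= r < 1 -> rho < 1 ->
  (forall a, nm (x a) <= B * r ^+ a.2) ->
  (p = false -> forall a, nm (x a) <= rho) ->
  tends (fun k => \prod_(n < k) \prod_(a : bool * 'I_d) G x (a, n : nat)) L ->
  (exists M, abs_bounded (state_prod x) M) /\ sums_to (state_prod x) L.
Proof.
move=> B0 r01 rho1 xB xrho hL; have [r0 r1] := andP r01.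
have occ0 a : occ x a 0 = 1 by rewrite /occ andbF.
have rho0 : 0 < 1 - rho by rewrite subr_gt0.
(* A fermionic mode adds at most [nm (x a)] to one, and a bosonic mode at most
   [nm (x a) / (1 - rho)] by the geometric series. *)
pose B' := Num.max B (B / (1 - rho)).
have B'0 : 0 <= B' by rewrite le_max B0.
have occB a m : \sum_(j < m) nm (occ x a j) <= 1 + B' * r ^+ a.2.
  have rn : 0 <= r ^+ a.2 by rewrite exprn_ge0.
  move: (xrho) (xB a); rewrite /occ; case: (p) => [_ xa|/(_ erefl a) h xa] /=.
    case: m => [|[|m]].
    - by rewrite big_ord0 addr_ge0// mulr_ge0.
    - by rewrite big_ord1 nm1 lerDl mulr_ge0.
    rewrite !big_ord_recl /= big1 => [|i _]; last exact: nm0.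
    rewrite nm1 addr0 expr1 lerD2l; apply: le_trans xa _.
    by rewrite ler_wpM2r// le_max lexx.
  case: m => [|m]; first by rewrite big_ord0 addr_ge0// mulr_ge0.
  rewrite big_ord_recl expr0 nm1 lerD2l.
  have x1 : nm (x a) < 1 by apply: le_lt_trans h _.
  apply: (@le_trans _ _ (nm (x a) * (1 - rho)^-1)).
    have -> : \sum_(i < m) nm (x a ^+ lift ord0 i) = nm (x a) * \sum_(i < m) nm (x a) ^+ i.
      by rewrite mulr_sumr; apply: eq_bigr => i _; rewrite nmX exprS.
    rewrite ler_wpM2l ?nm_ge0// -[leRHS]mul1r ler_pdivlMr// mulrC.
    apply: (@le_trans _ _ ((1 - nm (x a)) * \sum_(i < m) nm (x a) ^+ i)).
      rewrite ler_wpM2r ?lerD2l ?lerN2//.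
      by apply: sumr_ge0 => i _; rewrite exprn_ge0 ?nm_ge0.
    rewrite -opprB mulNr -subrX1 opprB lerBlDr lerDl.
    by rewrite exprn_ge0 ?nm_ge0.
  apply: (@le_trans _ _ (B / (1 - rho) * r ^+ a.2)).
    by rewrite mulrAC ler_wpM2r// invr_ge0 ltW.
  by rewrite ler_wpM2r// le_max lexx orbT.
have occG a : tends (fun m => \sum_(j < m) occ x a j) (G x a).
  by apply: occ_tends => /xrho h; apply: le_lt_trans (h a) rho1.
split.
  have [M hM] := state_weight_bounded occ0 B'0 r01 occB; exists M => A.
  by under eq_bigr => s _ do rewrite state_prodE; exact: hM.
apply: sums_to_ext (state_weight_sum occ0 B'0 r01 occB occG hL) => s.
by rewrite state_prodE.
Qed.

End FockSums.

Section ThetaSums.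
Variable R : realType.
Local Notation C := (cplx R).

Lemma tendsV (u : nat -> C) (a : C) : a != 0 -> tends u a -> tends (fun n => (u n)^-1) a^-1.
Proof.
move=> a0 hu e e0; have na : 0 < nm a by rewrite lt_def nm_eq0 a0 nm_ge0.
have a2 : 0 < nm a / 2 by rewrite divr_gt0.
have e1 : 0 < e * (nm a / 2) * nm a by rewrite !mulr_gt0.
have [N1 h1] := hu _ a2; have [N2 h2] := hu _ e1.
exists (maxn N1 N2) => n; rewrite geq_max => /andP[/h1{}h1 /h2{}h2].
have low : nm a / 2 < nm (u n).
  by have := nmD (u n) (a - u n); rewrite addrC subrK (nmB a) => h; lra.
have un0 : u n != 0 by rewrite -nm_eq0 gt_eqF// (lt_trans a2).
have -> : (u n)^-1 - a^-1 = (a - u n) / (u n * a) by field; rewrite ?a0 ?un0.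
have un : 0 < nm (u n) by apply: lt_trans low.
rewrite nmM nmV nmM nmB ltr_pdivrMr ?mulr_gt0//.
by apply: lt_trans h2 _; rewrite -mulrA ltr_pM2l// ltr_pM2r.
Qed.

Definition theta_prod (q u : C) : C := poch (u * q) q * poch u^-1 q.

Lemma theta_prod_tends q u : nm q < 1 ->
  tends (fun k => \prod_(n < k) ((1 - u * q ^+ n.+1) * (1 - u^-1 * q ^+ n)))
    (theta_prod q u).
Proof.
move=> q1; apply: tends_ext (tendsM (pochP (u * q) q1) (pochP u^-1 q1)) => k.
rewrite /qprod -big_split; apply: eq_bigr => n _ /=.
by rewrite exprS mulrA.
Qed.

Lemma theta_prods_tends d q (u : 'I_d -> C) : nm q < 1 ->
  tends (fun k => \prod_(n < k) \prod_j
      ((1 - u j * q ^+ n.+1) * (1 - (u j)^-1 * q ^+ n)))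
    (\prod_j theta_prod q (u j)).
Proof.
move=> q1.
have h : tends (fun k => \prod_(j < d) \prod_(n < k)
    ((1 - u j * q ^+ n.+1) * (1 - (u j)^-1 * q ^+ n))) (\prod_j theta_prod q (u j)).
  by apply: tends_prod => j; exact: theta_prod_tends.
by apply: tends_ext h => k; rewrite exchange_big.
Qed.

Lemma theta_prod_neq0 q u : nm q < 1 -> nm u^-1 < 1 -> nm (u * q) < 1 ->
  theta_prod q u != 0.
Proof. by move=> q1 u1 uq1; rewrite mulf_neq0// poch_neq0. Qed.

Definition mode_weight d (q : C) (u : 'I_d -> C) (a : fock_mode d) : C :=
  if a.1.1 then u a.1.2 * q ^+ a.2.+1 else (u a.1.2)^-1 * q ^+ a.2.

Lemma mode_weight_bound d q (u : 'I_d -> C) a : nm q < 1 ->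
  nm (mode_weight q u a) <= (\sum_j (nm (u j) + nm (u j)^-1)) * nm q ^+ a.2.
Proof.
move=> q1; have qn : 0 <= nm q ^+ a.2 by rewrite exprn_ge0 ?nm_ge0.
have h : nm (u a.1.2) + nm (u a.1.2)^-1 <= \sum_j (nm (u j) + nm (u j)^-1).
  rewrite (bigD1 a.1.2)//= lerDl; apply: sumr_ge0 => j _.
  by rewrite addr_ge0 ?nm_ge0.
apply: le_trans (ler_wpM2r qn h); rewrite /mode_weight.
case: ifP => _; rewrite nmM nmX mulrDl.
  rewrite exprS mulrA; apply: ler_wpDr; first by rewrite mulr_ge0 ?nm_ge0.
  by rewrite ler_wpM2r// ler_piMr ?nm_ge0// ltW.
by rewrite lerDr mulr_ge0 ?nm_ge0.
Qed.

Lemma prod_bool_ord d (f : bool * 'I_d -> C) :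
  \prod_a f a = \prod_j (f (true, j) * f (false, j)).
Proof.
transitivity (\prod_b \prod_j f (b, j)).
  by rewrite pair_big; apply: eq_bigr => -[b j].
by rewrite big_bool -big_split.
Qed.

(** The sign in the weights turns the factors [1 + x] of modes occupied at most once into the
    factors of [theta_prod]. *)
Lemma clifford_sum d q (u : 'I_d -> C) : nm q < 1 ->
  let w := state_prod true (mode_weight q (fun j => - u j)) in
  (exists M, abs_bounded w M) /\ sums_to w (\prod_j theta_prod q (u j)).
Proof.
move=> q1; apply: (@state_prod_sum R true d _
  (\sum_j (nm (- u j) + nm (- u j)^-1)) (nm q) 0) => //.
- by apply: sumr_ge0 => j _; apply: addr_ge0; apply: nm_ge0.
- by rewrite nm_ge0.
- by move=> a; apply: mode_weight_bound.
apply: tends_ext (theta_prods_tends u q1) => k.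
apply: eq_bigr => n _; rewrite prod_bool_ord.
by apply: eq_bigr => j _; rewrite /mode_weight /= invrN !mulNr.
Qed.

Lemma weyl_sum d q (u : 'I_d -> C) (rho : R) : nm q < 1 -> rho < 1 ->
  (forall j, nm (u j)^-1 <= rho) -> (forall j, nm (u j * q) <= rho) ->
  let w := state_prod false (mode_weight q u) in
  (exists M, abs_bounded w M) /\ sums_to w (\prod_j theta_prod q (u j))^-1.
Proof.
move=> q1 rho1 h1 h2; apply: (@state_prod_sum R false d _
  (\sum_j (nm (u j) + nm (u j)^-1)) (nm q) rho) => //.
- by apply: sumr_ge0 => j _; apply: addr_ge0; apply: nm_ge0.
- by rewrite nm_ge0.
- by move=> a; apply: mode_weight_bound.
- move=> _ a; have qn : nm q ^+ a.2 <= 1 by rewrite exprn_ile1 ?nm_ge0// ltW.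
  rewrite /mode_weight; case: ifP => _; rewrite ?exprS ?mulrA nmM nmX.
    by apply: le_trans (h2 a.1.2); rewrite ler_piMr ?nm_ge0.
  by apply: le_trans (h1 a.1.2); rewrite ler_piMr ?nm_ge0.
apply: tends_ext (tendsV _ (theta_prods_tends u q1)) => [k|].
  rewrite -prodfV; apply: eq_bigr => n _; rewrite prod_bool_ord -prodfV.
  by apply: eq_bigr => j _; rewrite /mode_weight /= invfM.
apply/prodf_neq0 => j _; apply: theta_prod_neq0 => //.
  exact: le_lt_trans (h1 j) rho1.
exact: le_lt_trans (h2 j) rho1.
Qed.

(** The creation operator from [ps_minus] in degree zero. *)
Definition zero_mode : fock_mode 1 := (false, ord0, 0%N).

(** At [u = 1] the zero mode would contribute the factor [1 - 1]. Omitting it leaves each [1 - q^n]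
    with positive [n] twice, from the plus and from the minus modes. *)
Lemma zero_mode_removed_sum (q : C) : nm q < 1 ->
  let w := state_prod true (fun a => if a == zero_mode then 0
    else mode_weight q (fun=> -1) a) in
  (exists M, abs_bounded w M) /\ sums_to w (poch q q ^+ 2).
Proof.
move=> q1; apply: (@state_prod_sum R true 1 _ 2 (nm q) 0) => //.
- by rewrite nm_ge0.
- move=> a; have qn : 0 <= nm q ^+ a.2 by rewrite exprn_ge0 ?nm_ge0.
  case: ifP => _; first by rewrite nm0 mulr_ge0.
  apply: le_trans (mode_weight_bound _ _ q1) _.
  by rewrite big_ord1 invrN1 nmN nm1.
apply: tends_shift.
have t1 : tends (fun k => qprod q q k.+1) (poch q q).
  by move=> e /(pochP q q1)[N hN]; exists N => n h; apply: hN; apply: leqW.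
apply: tends_ext (tendsM t1 (pochP q q1)) => k.
transitivity (\prod_(n < k.+1) ((1 - q * q ^+ n) * (if n == 0 :> nat then 1 else 1 - q ^+ n))).
  rewrite big_split /=; congr (_ * _); rewrite big_ord_recl mul1r.
  by apply: eq_bigr => n _; rewrite exprS.
apply: eq_bigr => n _; rewrite prod_bool_ord big_ord1 /mode_weight /=.
rewrite invrN1 !mulN1r -exprS; congr (_ * _); rewrite /zero_mode !xpair_eqE /=.
by case: (val n == 0)%N; rewrite ?addr0.
Qed.

End ThetaSums.

(** * Traces of diagonal operators *)

Section DiagonalTrace.
Variables (K : numFieldType) (W : lmodType K) (S : choiceType) (valid : pred S).
Variables (w : S -> W) (J L X : W -> W) (mJ mL : S -> int) (x : S -> K).
Hypothesis w_basis : is_basis valid w.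
Hypothesis JL : linear J.
Hypothesis LL : linear L.
Hypothesis Jw : forall s, valid s -> J (w s) = (mJ s)%:~R *: w s.
Hypothesis Lw : forall s, valid s -> L (w s) = (mL s)%:~R *: w s.
Hypothesis Xw : forall s, valid s -> X (w s) = x s *: w s.
Variable fib : int -> int -> {fset S}.
Hypothesis fibP : forall m n s,
  (s \in fib m n) = valid s && ((mJ s == m) && (mL s == n)).

(** The expansion holds over every finite set of valid indices beyond a given one, so it can be
    taken over a set that also contains a prescribed fiber. *)
Lemma basis_expand : exists co : S -> W -> K,
  (forall s k u v, co s (k *: u + v) = k * co s u + co s v) /\
  (forall s t, valid s -> valid t -> co s (w t) = (s == t)%:R) /\
  (forall u, exists A : {fset S}, (forall s, s \in A -> valid s) /\
    forall D : {fset S}, (A `<=` D)%fset -> (forall s, s \in D -> valid s) ->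
    u = \sum_(s <- D) co s u *: w s).
Proof.
have [span [co [coL coP]]] := w_basis; exists co; split=> //; split=> // u.
have co0 s : co s 0 = 0.
  have cL : linear (co s : W -> K^o) by move=> k y z; exact: coL.
  exact: plin0 cL.
apply: (lspanP _ _ (span u) [set u | exists A : {fset S}, (forall s, s \in A -> valid s) /\
    forall D : {fset S}, (A `<=` D)%fset -> (forall s, s \in D -> valid s) ->
    u = \sum_(s <- D) co s u *: w s]).
- exists fset0; split=> // D _ _; rewrite big1// => s _.
  by rewrite co0 scale0r.
- move=> k y z [A [Av hA]] [B [Bv hB]]; exists (A `|` B)%fset; split.
    by move=> s; rewrite in_fsetU => /orP[/Av|/Bv].
  move=> D; rewrite fsubUset => /andP[AD BD] Dv.
  rewrite {1}(hA D AD Dv) {1}(hB D BD Dv) scaler_sumr -big_split.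
  by apply: eq_bigr => s _; rewrite coL scalerDl scalerA.
move=> _ [s vs <-]; exists [fset s]%fset; split=> [t|D].
  by rewrite inE => /eqP ->.
rewrite fsub1set => sD Dv; rewrite (big_fsetD1 s) //= coP// eqxx scale1r big1_seq ?addr0//.
move=> t /=; rewrite !inE => /andP[ts /Dv vt].
by rewrite coP// (negbTE ts) scale0r.
Qed.

Lemma diagonal_trace_series :
  trace_series X J L (fun m n => \sum_(s <- fib m n) x s).
Proof.
have [co [coL [coP coE]]] := basis_expand.
split=> [u|m n].
  have [A [Av /(_ A (fsubset_refl _) Av) uA]] := coE u.
  pose e (i : 'I_(size (enum_fset A))) : S := tnth (in_tuple (enum_fset A)) i.
  have ve i : valid (e i) by apply: Av; exact: mem_tnth.
  exists (size (enum_fset A)), (fun i => mJ (e i)), (fun i => mL (e i)).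
  exists (fun i => co (e i) u *: w (e i)); split.
    move=> i; split; rewrite ?(plinZ JL) ?(plinZ LL) ?Jw ?Lw//.
      by rewrite !scalerA mulrC.
    by rewrite !scalerA mulrC.
  by rewrite [LHS]uA [LHS]big_tnth.
have coZ s k u : co s (k *: u) = k * co s u.
  have cL : linear (co s : W -> K^o) by move=> k' y z; exact: coL.
  exact: plinZ cL k u.
have co_sum s (D : {fset S}) (f : S -> K) : valid s -> (forall t, t \in D -> valid t) ->
    co s (\sum_(t <- D) f t *: w t) = if s \in D then f s else 0.
  move=> vs Dv; have cL : linear (co s : W -> K^o) by move=> k u v; exact: coL.
  rewrite (plin_sum cL) /=; case: ifP => sD.
    rewrite (big_fsetD1 s)//= coZ coP// eqxx mulr1 big1_seq ?addr0// => t /=.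
    rewrite !inE => /andP[ts /Dv vt].
    by rewrite coZ coP// eq_sym (negbTE ts) mulr0.
  rewrite big1_seq// => t /= tD; rewrite coZ coP ?(Dv t)//.
  by case: eqP tD => [<-|_ _]; rewrite ?sD// mulr0.
pose r := enum_fset (fib m n).
pose e (i : 'I_(size r)) : S := tnth (in_tuple r) i.
have er i : e i \in fib m n by exact: mem_tnth.
have ve i : valid (e i) by have := er i; rewrite fibP => /andP[].
have fv s : s \in fib m n -> valid s by rewrite fibP => /andP[].
exists (size r), (fun i => w (e i)), (\matrix_(i, j) (if i == j then x (e j) else 0)).
have rE (f : S -> W) : \sum_(s <- fib m n) f s = \sum_i f (e i) by rewrite big_tnth.
split.
- apply/seteqP; split => [u [Ju Lu]|u [c ->]] /=.
    exists (fun i => co (e i) u).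
    rewrite -(rE (fun s => co s u *: w s)).
    have [A [Av hA]] := coE u; pose D := (A `|` fib m n)%fset.
    have Dv s : s \in D -> valid s by rewrite in_fsetU => /orP[/Av|/fv].
    have uD := hA D (fsubsetUl _ _) Dv.
    rewrite [LHS]uD (big_fset_incl _ (fsubsetUr A (fib m n)))//= => s sD sf.
    have vs := Dv s sD.
    (* If the coordinate of [u] on [w s] is nonzero, comparing the coordinates of [T u] on [w s]
       identifies the two eigenvalues. *)
    have eig (T : W -> W) (mT : S -> int) k : linear T -> T u = k%:~R *: u ->
        (forall s, valid s -> T (w s) = (mT s)%:~R *: w s) -> co s u != 0 -> mT s = k.
      move=> TL Tu Tw cs0; have : co s (T u) = co s u * (mT s)%:~R.
        rewrite [in LHS]uD (plin_sum TL).
        transitivity (co s (\sum_(t <- D) (co t u * (mT t)%:~R) *: w t)).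
          congr (co s _); apply: eq_big_seq => t tD.
          by rewrite (plinZ TL) Tw ?Dv// scalerA.
        by rewrite co_sum// sD.
      rewrite Tu coZ mulrC => /(mulfI cs0) /eqP; rewrite eqr_int => /eqP.
      by [].
    have [->|cs0] := eqVneq (co s u) 0; first by rewrite scale0r.
    move/negP: sf; case; rewrite fibP vs.
    by rewrite (eig J mJ m JL Ju Jw cs0) (eig L mL n LL Lu Lw cs0) !eqxx.
  split.
    rewrite (plin_sum JL) scaler_sumr; apply: eq_bigr => i _.
    rewrite (plinZ JL) Jw// !scalerA mulrC.
    by have := er i; rewrite fibP => /andP[_ /andP[/eqP -> _]].
  rewrite (plin_sum LL) scaler_sumr; apply: eq_bigr => i _.
  rewrite (plinZ LL) Lw// !scalerA mulrC.
  by have := er i; rewrite fibP => /andP[_ /andP[_ /eqP ->]].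
- move=> c hc i.
  have e_inj : injective e.
    move=> a b; rewrite /e !(tnth_nth (e a)) /= => /eqP.
    by rewrite nth_uniq ?fset_uniq//; move/eqP/val_inj.
  have cL : linear (co (e i) : W -> K^o) by move=> k u v; exact: coL.
  have : co (e i) (\sum_j c j *: w (e j)) = c i.
    rewrite (plin_sum cL) /= (bigD1 i)//= coZ coP// eqxx mulr1 big1 ?addr0// => j ji.
    by rewrite coZ coP// (inj_eq e_inj) eq_sym (negbTE ji) mulr0.
  by rewrite hc => <-; rewrite (plin0 cL).
- move=> j; rewrite Xw// (bigD1 j)//= mxE eqxx big1 ?addr0// => i ij.
  by rewrite mxE (negbTE ij) scale0r.
rewrite /mxtrace big_tnth; apply: eq_bigr => i _; rewrite mxE eqxx.
by [].
Qed.

End DiagonalTrace.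

(** An infinite fiber would contain more states of weight at least [c i] than the bound [M] on the
    total weight permits. *)
Lemma finite_fibers (R : realType) (S I : choiceType) (valid : pred S) (pi : S -> I)
    (f : S -> cplx R) (M : R) (c : I -> R) :
  abs_bounded f M -> (forall i, 0 < c i) ->
  (forall s, valid s -> c (pi s) <= nm (f s)) ->
  exists fib : I -> {fset S}, forall i s, (s \in fib i) = valid s && (pi s == i).
Proof.
move=> fM c0 hc.
have fin i : finite_set [set s | valid s && (pi s == i)].
  apply: contrapT => /infinite_set_fset h.
  have [k hk] : exists k : nat, M < k%:R * c i.
    exists (Num.bound `|M / c i|); rewrite -ltr_pdivrMr//.
    by apply: le_lt_trans (ler_norm _) (archi_boundP _); rewrite normr_ge0.
  have [A Asub cA] := h k.
  have : k%:R * c i <= M.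
    apply: le_trans (fM A); apply: (@le_trans _ _ (\sum_(s <- A) c i)).
      rewrite big_const_seq count_predT iter_addr addr0 mulr_natl.
      by rewrite ler_pMn2l.
    rewrite big_seq [leRHS]big_seq; apply: ler_sum => s /Asub /= /andP[vs /eqP <-].
    exact: hc.
  by rewrite leNgt hk.
exists (fun i => fset_set [set s | valid s && (pi s == i)]) => i s.
by rewrite in_fset_set//; apply/asboolP/idP.
Qed.

(** The sum is regrouped by the two-element orbits of the involution, each represented by its member
    outside [has0]. *)
Lemma toggle_sum (K : nmodType) (S : choiceType) (fib : {fset S}) (has0 : pred S)
    (tau : S -> S) (f : S -> K) :
  (forall s, s \in fib -> tau s \in fib /\ tau (tau s) = s) ->
  (forall s, s \in fib -> has0 (tau s) = ~~ has0 s) ->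
  \sum_(s <- fib) f s = \sum_(s <- fib) if has0 s then 0 else f s + f (tau s).
Proof.
move=> tauP tau0; rewrite (bigID (fun s => has0 s)) /= addrC.
rewrite [RHS](bigID (fun s => has0 s)) /= [X in _ = X + _]big1 ?add0r => [|s ->//].
rewrite [RHS](eq_bigr (fun s => f s + f (tau s))) => [|s /negbTE ->//].
rewrite big_split /=; congr (_ + _).
have /(perm_big _) -> : perm_eq (enum_fset fib) [seq tau s | s <- enum_fset fib].
  apply: uniq_perm; first exact: fset_uniq.
    rewrite map_inj_in_uniq ?fset_uniq// => s t /tauP[_ hs] /tauP[_ ht] st.
    by rewrite -hs st ht.
  move=> s; apply/idP/mapP => [sf|[t /tauP[tf _] ->//]].
  by have [tf ts] := tauP s sf; exists (tau s).
rewrite big_map big_seq_cond [RHS]big_seq_cond; apply: eq_bigl => s.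
by have [sf|//] := boolP (s \in enum_fset fib); rewrite tau0.
Qed.

(** * The module W_tw *)

Section EigenvectorSums.
Variables (K : fieldType) (V M : lmodType K) (f : V -> M) (x : M).
Hypothesis fL : linear f.

Lemma eigen_combination a b c l m ka kb kc k :
  f a = ka *: x -> f b = kb *: x -> f c = kc *: x -> k = l * ka + m * kb + kc ->
  f (l *: a + m *: b + c) = k *: x.
Proof.
move=> ha hb hc ->.
by rewrite !(plinD fL) !(plinZ fL) ha hb hc !scalerA -!scalerDl.
Qed.

Lemma eigen_sum4 a b c d ka kb kc kd k :
  f a = ka *: x -> f b = kb *: x -> f c = kc *: x -> f d = kd *: x ->
  k = ka + kb + kc + kd -> f (a + b + c + d) = k *: x.
Proof. by move=> ha hb hc hd ->; rewrite !(plinD fL) ha hb hc hd -!scalerDl. Qed.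

End EigenvectorSums.

Lemma tmulZZ (K : fieldType) (V W : lmodType K) (k k' : K) (v : V) (w : W) :
  tmul (k *: v) (k' *: w) = (k * k') *: tmul v w.
Proof.
rewrite (plinZ (tmul_linearl (k' *: w)) k v) (plinZ (tmul_linearr v) k' w).
exact: scalerA.
Qed.

(** * Fields of vectors from a single tensor factor *)

Section FourfoldTensor.
Variables (K : numFieldType) (V1 V2 V3 V4 M1 M2 M3 M4 : lmodType K).
Variables (vac1 : V1) (vac2 : V2) (vac3 : V3) (vac4 : V4).
Variables (pV2 : V2 -> V2) (pV3 : V3 -> V3) (pV4 : V4 -> V4).
Variables (pM1 : M1 -> M1) (pM2 : M2 -> M2) (pM3 : M3 -> M3).
Variables (Y1 : fields V1 M1) (Y2 : fields V2 M2).
Variables (Y3 : fields V3 M3) (Y4 : fields V4 M4).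
Hypotheses (pV2L : linear pV2) (pV3L : linear pV3) (pV4L : linear pV4).
Hypotheses (pM1L : linear pM1) (pM2L : linear pM2) (pM3L : linear pM3).
Hypotheses (r1 : regular_fields Y1) (r2 : regular_fields Y2).
Hypotheses (r3 : regular_fields Y3) (r4 : regular_fields Y4).
Hypothesis v1 : forall n w, Y1 vac1 n w = if n == -1 then w else 0.
Hypothesis v2 : forall n w, Y2 vac2 n w = if n == -1 then w else 0.
Hypothesis v3 : forall n w, Y3 vac3 n w = if n == -1 then w else 0.
Hypothesis v4 : forall n w, Y4 vac4 n w = if n == -1 then w else 0.
Hypotheses (e2 : pV2 vac2 = vac2) (e3 : pV3 vac3 = vac3) (e4 : pV4 vac4 = vac4).

Let Y12 := tensor_fields pV2 pM1 Y1 Y2.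
Let pM12 := tmap pM1 pM2.
Let Y123 := tensor_fields pV3 pM12 Y12 Y3.
Let pM123 := tmap pM12 pM3.
Definition fourfold_fields := tensor_fields pV4 pM123 Y123 Y4.
Local Notation Y := fourfold_fields.

Let pM12L : linear pM12. Proof. exact: tmap_linear. Qed.
Let pM123L : linear pM123. Proof. exact: tmap_linear. Qed.
Let r12 : regular_fields Y12. Proof. exact: tensor_fields_regular. Qed.
Let r123 : regular_fields Y123. Proof. exact: tensor_fields_regular. Qed.

Lemma fourfold_regular : regular_fields Y.
Proof. exact: tensor_fields_regular. Qed.

Let v12 n w : Y12 (tmul vac1 vac2) n w = if n == -1 then w else 0.
Proof. exact: tensor_fields_vacuum. Qed.
Let v123 n w : Y123 (tmul (tmul vac1 vac2) vac3) n w = if n == -1 then w else 0.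
Proof. exact: tensor_fields_vacuum. Qed.

Variables (x1 : M1) (x2 : M2) (x3 : M3) (x4 : M4).
Local Notation x := (tmul (tmul (tmul x1 x2) x3) x4).

Let tZl (U U' : lmodType K) k (u : U) (u' : U') : tmul (k *: u) u' = k *: tmul u u'.
Proof. exact: plinZ (tmul_linearl u') _ _. Qed.
Let tZr (U U' : lmodType K) k (u : U) (u' : U') : tmul u (k *: u') = k *: tmul u u'.
Proof. exact: plinZ (tmul_linearr u) _ _. Qed.

Lemma fourfold1 a n k : Y1 a n x1 = k *: x1 ->
  Y (tmul (tmul (tmul a vac2) vac3) vac4) n x = k *: x.
Proof.
move=> h.
have h1 : Y12 (tmul a vac2) n (tmul x1 x2) = tmul (Y1 a n x1) x2.
  exact: tensor_fields_vacuumr.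
have h2 : Y123 (tmul (tmul a vac2) vac3) n (tmul (tmul x1 x2) x3) =
    tmul (Y12 (tmul a vac2) n (tmul x1 x2)) x3.
  exact: tensor_fields_vacuumr.
transitivity (tmul (Y123 (tmul (tmul a vac2) vac3) n (tmul (tmul x1 x2) x3)) x4).
  exact: tensor_fields_vacuumr.
by rewrite h2 h1 h !tZl.
Qed.

(** Evenness of the inserted vector removes the sign with which its odd part would pass the factors
    on its left. *)
Lemma fourfold2 a n k : pV2 a = a -> Y2 a n x2 = k *: x2 ->
  Y (tmul (tmul (tmul vac1 a) vac3) vac4) n x = k *: x.
Proof.
move=> pa h.
have h1 : Y12 (tmul vac1 a) n (tmul x1 x2) = tmul x1 (Y2 a n x2).
  exact: tensor_fields_vacuuml.
have h2 : Y123 (tmul (tmul vac1 a) vac3) n (tmul (tmul x1 x2) x3) =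
    tmul (Y12 (tmul vac1 a) n (tmul x1 x2)) x3.
  exact: tensor_fields_vacuumr.
transitivity (tmul (Y123 (tmul (tmul vac1 a) vac3) n (tmul (tmul x1 x2) x3)) x4).
  exact: tensor_fields_vacuumr.
by rewrite h2 h1 h tZr !tZl.
Qed.

Lemma fourfold3 a n k : pV3 a = a -> Y3 a n x3 = k *: x3 ->
  Y (tmul (tmul (tmul vac1 vac2) a) vac4) n x = k *: x.
Proof.
move=> pa h.
have h2 : Y123 (tmul (tmul vac1 vac2) a) n (tmul (tmul x1 x2) x3) =
    tmul (tmul x1 x2) (Y3 a n x3).
  exact: tensor_fields_vacuuml.
transitivity (tmul (Y123 (tmul (tmul vac1 vac2) a) n (tmul (tmul x1 x2) x3)) x4).
  exact: tensor_fields_vacuumr.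
by rewrite h2 h tZr !tZl.
Qed.

Lemma fourfold4 a n k : pV4 a = a -> Y4 a n x4 = k *: x4 ->
  Y (tmul (tmul (tmul vac1 vac2) vac3) a) n x = k *: x.
Proof.
move=> pa h; transitivity (tmul (tmul (tmul x1 x2) x3) (Y4 a n x4)).
  exact: tensor_fields_vacuuml.
by rewrite h tZr.
Qed.

Lemma fourfold_map (f1 : M1 -> M1) (f2 : M2 -> M2) (f3 : M3 -> M3) (f4 : M4 -> M4)
    k1 k2 k3 k4 : linear f1 -> linear f2 -> linear f3 -> linear f4 ->
  f1 x1 = k1 *: x1 -> f2 x2 = k2 *: x2 -> f3 x3 = k3 *: x3 -> f4 x4 = k4 *: x4 ->
  tmap (tmap (tmap f1 f2) f3) f4 x = (k1 * k2 * k3 * k4) *: x.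
Proof.
move=> L1 L2 L3 L4 h1 h2 h3 h4.
have L12 : linear (tmap f1 f2) by exact: tmap_linear.
have L123 : linear (tmap (tmap f1 f2) f3) by exact: tmap_linear.
rewrite (tmapE L123 L4) (tmapE L12 L3) (tmapE L1 L2) h1 h2 h3 h4.
by rewrite (tmulZZ k1 k2 x1 x2) (tmulZZ (k1 * k2) k3) (tmulZZ (k1 * k2 * k3) k4).
Qed.

End FourfoldTensor.

Section EvenVectors.
Variables (K : numFieldType) (p : bool) (P : polarized_space K p) (b : dual_bases P).

Let par2 a a' m n : @parity K p P false (mode false a m (mode false a' n vacuum)) =
  mode false a m (mode false a' n vacuum).
Proof.
rewrite parity_mode parity_mode parity_vacuum.
rewrite (plinZ (mode_is_linear (tw := false) a m)) scalerA.
by rewrite -expr2 sqrr_sign scale1r.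
Qed.

Lemma parity_current : @parity K p P false (current b) = current b.
Proof.
rewrite /current (plin_sum (@parity_linear _ _ _ false)).
by apply: eq_bigr => i _; exact: par2.
Qed.

Lemma parity_conformal : @parity K p P false (conformal b) = conformal b.
Proof.
have pL := @parity_linear K p P false.
rewrite /conformal (plinZ pL) (plin_sum pL); congr (_ *: _).
apply: eq_bigr => i _; rewrite (plinB pL); congr (_ - _); exact: par2.
Qed.

End EvenVectors.

Section TwistedModule5.
Variable K : numFieldType.
Variables (E A A' : polarized_space K true) (B : polarized_space K false).
Variables (vE : vertex_structure E) (vA : vertex_structure A).
Variables (vA' : vertex_structure A') (vB : vertex_structure B).
Variables (bE : dual_bases E) (bA : dual_bases A) (bA' : dual_bases A').
Variable bB : dual_bases B.
Hypotheses (sE : db_size bE = 1%N) (sA : db_size bA = 1%N).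
Hypotheses (sA' : db_size bA' = 1%N) (sB : db_size bB = 3%N).
Variables (FE : polar_frame E 1) (FA : polar_frame A 1) (FA' : polar_frame A' 1).
Variable FB : polar_frame B 3.
Local Notation Ytw := (W5tw_fields vE vA vA' vB).

Definition state5 : choiceType :=
  (multiset (fock_mode 1) * multiset (fock_mode 1) * multiset (fock_mode 1)
   * multiset (fock_mode 3))%type.

Definition valid5 (s : state5) : bool :=
  state_valid true s.1.1.1 && state_valid true s.1.1.2 && state_valid true s.1.2
  && state_valid false s.2.

Definition vector5 (s : state5) : W5tw E A A' B :=
  tmul (tmul (tmul (fock_state FE s.1.1.1) (fock_state FA s.1.1.2))
    (fock_state FA' s.1.2)) (fock_state FB s.2).

Lemma vector5_basis : is_basis valid5 vector5.
Proof.
exact: tensor_basis (tensor_basis (tensor_basis (fock_state_basis FE)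
  (fock_state_basis FA)) (fock_state_basis FA')) (fock_state_basis FB).
Qed.

Let reg (p : bool) (P : polarized_space K p) (v : vertex_structure P) :
  regular_fields (vs_twisted v).
Proof.
apply: (twisted_regular _ _ (vs_module v)).
  exact: canonical_involution_linear.
exact: canonical_involutionK.
Qed.

Let vac (p : bool) (P : polarized_space K p) (v : vertex_structure P) n w :
  vs_twisted v vacuum n w = if n == -1 then w else 0.
Proof. exact: tm_vacuum (vs_module v) n w. Qed.

Let pL (p : bool) (P : polarized_space K p) tw : linear (@parity K p P tw).
Proof. exact: parity_linear. Qed.
Let pv (p : bool) (P : polarized_space K p) tw : @parity K p P tw vacuum = vacuum.
Proof. exact: parity_vacuum. Qed.

Let Ytw_regular : regular_fields Ytw.
Proof. by apply: fourfold_regular; try exact: pL; try exact: reg. Qed.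

Lemma Ytw_vector_linear a n : linear (Ytw a n).
Proof. by case: Ytw_regular. Qed.

Let Ytw_state n w : linear (fun a => Ytw a n w).
Proof. by case: Ytw_regular. Qed.

Definition charge d (s : seq (fock_mode d)) : int := \sum_(x <- s) (-1) ^+ (~~ x.1.1).
Definition degree d (s : seq (fock_mode d)) : nat := (\sum_(x <- s) mode_degree x)%N.

Let y1 a n k (s : state5) : vs_twisted vE a n (fock_state FE s.1.1.1) = k *: fock_state FE s.1.1.1 ->
  Ytw (tmul4 a vacuum vacuum vacuum) n (vector5 s) = k *: vector5 s.
Proof. by apply: fourfold1; try exact: pL; try exact: reg; try exact: vac; exact: pv. Qed.
Let y2 a n k (s : state5) : @parity K true A false a = a ->
  vs_twisted vA a n (fock_state FA s.1.1.2) = k *: fock_state FA s.1.1.2 ->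
  Ytw (tmul4 vacuum a vacuum vacuum) n (vector5 s) = k *: vector5 s.
Proof. by apply: fourfold2; try exact: pL; try exact: reg; try exact: vac; exact: pv. Qed.
Let y3 a n k (s : state5) : @parity K true A' false a = a ->
  vs_twisted vA' a n (fock_state FA' s.1.2) = k *: fock_state FA' s.1.2 ->
  Ytw (tmul4 vacuum vacuum a vacuum) n (vector5 s) = k *: vector5 s.
Proof. by apply: fourfold3; try exact: pL; try exact: reg; try exact: vac; exact: pv. Qed.
Let y4 a n k (s : state5) : @parity K false B false a = a ->
  vs_twisted vB a n (fock_state FB s.2) = k *: fock_state FB s.2 ->
  Ytw (tmul4 vacuum vacuum vacuum a) n (vector5 s) = k *: vector5 s.
Proof. by apply: fourfold4; try exact: pL; try exact: reg; try exact: vac; exact: pv. Qed.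

Lemma currentE_vector s : Ytw (currentE A A' B bE) 0 (vector5 s) =
  (2^-1 + (charge (enum_mset s.1.1.1))%:~R) *: vector5 s.
Proof.
apply: y1; have := current_state_word vE bE FE (enum_mset s.1.1.1).
rewrite sE expr1 opprK mulr1 mul1r; apply.
Qed.

(** The constant is the vacuum eigenvalue [2 * 1/2 + 3 * 1/2 - 3/2]. *)
Definition charge5 (s : state5) : int := 1 + 2 * charge (enum_mset s.1.1.2)
  + 3 * charge (enum_mset s.1.2) + charge (enum_mset s.2).
(** The vacuum energies, [1/8] for each Clifford factor and [- 3/8] for the Weyl factor, add up to
    zero. *)
Definition degree5 (s : state5) : int :=
  (degree (enum_mset s.1.1.1) + degree (enum_mset s.1.1.2)
   + degree (enum_mset s.1.2) + degree (enum_mset s.2))%:Z.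

Lemma current5_vector s : Ytw (current5 E bA bA' bB) 0 (vector5 s) =
  (charge5 s)%:~R *: vector5 s.
Proof.
apply: (eigen_combination (Ytw_state 0 (vector5 s))
  (y2 (parity_current bA) (current_state_word vA bA FA _))
  (y3 (parity_current bA') (current_state_word vA' bA' FA' _))
  (y4 (parity_current bB) (current_state_word vB bB FB _))).
by rewrite sA sA' sB /charge5 !intrD !intrM /=; field.
Qed.

Lemma conformal5_vector s : Ytw (omega5 bE bA bA' bB) 1 (vector5 s) =
  (degree5 s)%:~R *: vector5 s.
Proof.
apply: (eigen_sum4 (Ytw_state 1 (vector5 s))
  (y1 (conformal_state_word vE bE FE _))
  (y2 (parity_conformal bA) (conformal_state_word vA bA FA _))
  (y3 (parity_conformal bA') (conformal_state_word vA' bA' FA' _))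
  (y4 (parity_conformal bB) (conformal_state_word vB bB FB _))).
by rewrite sE sA sA' sB /degree5 -pmulrn !natrD; field.
Qed.

End TwistedModule5.

Section Actions5.
Variable K : numFieldType.
Variables (E A A' : polarized_space K true) (B : polarized_space K false).
Variables (FE : polar_frame E 1) (FA : polar_frame A 1) (FA' : polar_frame A' 1).
Variable FB : polar_frame B 3.
Local Notation vector5 := (vector5 FE FA FA' FB).

Definition eigen_frame (p : bool) (P : polarized_space K p) d (F : polar_frame P d)
    (g : 'End(subvs_of (ps_plus P))) (nu : 'I_d -> K) : Prop :=
  (forall j, nu j != 0) /\ forall j,
    g (vsproj (ps_plus P) (pf_plus F j)) = nu j *: vsproj (ps_plus P) (pf_plus F j).

Definition char_prod d (nu : 'I_d -> K) (s : multiset (fock_mode d)) : K :=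
  \prod_(x <- enum_mset s) mode_char nu x.

Lemma gl_fock_state (p : bool) (P : polarized_space K p) d (F : polar_frame P d) g nu s :
  eigen_frame F g nu ->
  gl_fock g (fock_state F s) = char_prod nu s *: fock_state F s.
Proof. by move=> [nu0 gnu]; exact: gl_fock_word. Qed.

Lemma eigen_frame_linear (p : bool) (P : polarized_space K p) d (F : polar_frame P d) g nu :
  eigen_frame F g nu -> linear (gl_fock g).
Proof. by move=> [nu0 gnu]; exact: (gl_fock_linear nu0 gnu). Qed.

Lemma eigen_frame1 (p : bool) (P : polarized_space K p) d (F : polar_frame P d) :
  eigen_frame F \1%VF (fun=> 1).
Proof. by split=> j; rewrite ?oner_neq0// id_lfunE scale1r. Qed.

Lemma eigen_frameN1 (p : bool) (P : polarized_space K p) d (F : polar_frame P d) :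
  eigen_frame F (- \1%VF) (fun=> -1).
Proof. by split=> j; rewrite ?oppr_eq0 ?oner_neq0// opp_lfunE id_lfunE scaleN1r. Qed.

Lemma char_prod1 d s : char_prod (fun _ : 'I_d => 1) s = 1.
Proof. by rewrite /char_prod big1// => x _; rewrite /mode_char invr1 if_same. Qed.

Lemma char_prodN1 d s : char_prod (fun _ : 'I_d => -1) s = (-1) ^+ size (enum_mset s).
Proof.
rewrite /char_prod; elim: (enum_mset s) => [|x r IHr]; first by rewrite big_nil.
by rewrite big_cons IHr /mode_char invrN1 if_same exprS.
Qed.

Lemma fermion_sign_vector s : fermion_sign (vector5 s) =
  ((-1) ^+ (size (enum_mset s.1.1.1) + size (enum_mset s.1.1.2)
     + size (enum_mset s.1.2))) *: vector5 s.
Proof.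
have h := fourfold_map (eigen_frame_linear (eigen_frameN1 FE))
  (eigen_frame_linear (eigen_frameN1 FA)) (eigen_frame_linear (eigen_frameN1 FA'))
  (eigen_frame_linear (eigen_frame1 FB)) (gl_fock_state s.1.1.1 (eigen_frameN1 FE))
  (gl_fock_state s.1.1.2 (eigen_frameN1 FA)) (gl_fock_state s.1.2 (eigen_frameN1 FA'))
  (gl_fock_state s.2 (eigen_frame1 FB)).
rewrite !char_prodN1 char_prod1 mulr1 -!exprD in h; exact: h.
Qed.

Lemma act5_vector gA gA' gB nuA nuA' nuB s : eigen_frame FA gA nuA ->
  eigen_frame FA' gA' nuA' -> eigen_frame FB gB nuB ->
  act5 (E := E) gA gA' gB (vector5 s) =
  (char_prod nuA s.1.1.2 * char_prod nuA' s.1.2 * char_prod nuB s.2) *: vector5 s.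
Proof.
move=> hA hA' hB; have h := fourfold_map (eigen_frame_linear (eigen_frame1 FE))
  (eigen_frame_linear hA) (eigen_frame_linear hA') (eigen_frame_linear hB)
  (gl_fock_state s.1.1.1 (eigen_frame1 FE)) (gl_fock_state s.1.1.2 hA)
  (gl_fock_state s.1.2 hA') (gl_fock_state s.2 hB).
rewrite char_prod1 mul1r in h; exact: h.
Qed.

Lemma act5_linear gA gA' gB nuA nuA' nuB : eigen_frame FA gA nuA ->
  eigen_frame FA' gA' nuA' -> eigen_frame FB gB nuB ->
  linear (act5 (E := E) gA gA' gB).
Proof.
move=> hA hA' hB; apply: tmap_linear; last exact: eigen_frame_linear hB.
apply: tmap_linear; last exact: eigen_frame_linear hA'.
apply: tmap_linear; last exact: eigen_frame_linear hA.
exact: eigen_frame_linear (eigen_frame1 FE).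
Qed.

End Actions5.

(** * Theta functions *)

Section ThetaFunctions.
Variable R : realType.
Local Notation C := (cplx R).
Implicit Types (tau z w u v q : C).

Let i_def : 'i = 'i%C :> C. Proof. by rewrite complexiE. Qed.

Let cexpD z w : cexp (z + w) = cexp z * cexp w.
Proof.
case: z => a b; case: w => c d /=; rewrite expRD cosD sinD.
by apply/eqP; rewrite eq_complex /=; apply/andP; split; apply/eqP; ring.
Qed.

Lemma ceD z w : ce (z + w) = ce z * ce w.
Proof. by rewrite /ce mulrDr cexpD. Qed.

Lemma ce0 : ce 0 = 1 :> C.
Proof.
by rewrite /ce mulr0; apply/eqP; rewrite eq_complex /= expR0 cos0 sin0 mulr1 mulr0 !eqxx.
Qed.

Lemma ceVN z : ce (- z) = (ce z)^-1.
Proof.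
have h : ce z * ce (- z) = 1 by rewrite -ceD subrr ce0.
have z0 : ce z != 0.
  by apply/eqP => e; move: h; rewrite e mul0r => /esym/eqP; rewrite oner_eq0.
by apply: (mulfI z0); rewrite h divff.
Qed.

Lemma ce_neq0 z : ce z != 0.
Proof.
have h : ce z * ce (- z) = 1 by rewrite -ceD subrr ce0.
by apply/eqP => e; move: h; rewrite e mul0r => /esym/eqP; rewrite oner_eq0.
Qed.

Lemma ceMn n z : ce (n%:R * z) = ce z ^+ n.
Proof.
elim: n => [|n IHn]; first by rewrite mul0r ce0 expr0.
by rewrite -natr1 mulrDl mul1r ceD IHn exprSr.
Qed.

Lemma ce_real (x : R) : ce x%:C%C = (cos (2 * pi * x) +i* sin (2 * pi * x))%C.
Proof.
rewrite /ce i_def; have -> : 2 * pi%:C%C * 'i%C * x%:C%C = (0 +i* (2 * pi * x))%C :> C.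
  apply/eqP; rewrite eq_complex /=; apply/andP; split; apply/eqP; ring.
by rewrite /= expR0 !mul1r.
Qed.

Lemma nm_ce z : nm (ce z) = expR (- (2 * pi * complex.Im z)).
Proof.
case: z => a b.
have -> : ce (a +i* b)%C = cexp ((- (2 * pi * b)) +i* (2 * pi * a))%C.
  rewrite /ce i_def; congr cexp.
  by apply/eqP; rewrite eq_complex /=; apply/andP; split; apply/eqP; ring.
rewrite /nm /= !exprMn -mulrDr cos2Dsin2 mulr1 sqrtr_sqr.
by rewrite ger0_norm ?expR_ge0.
Qed.

Lemma ce_quarter : ce (1 / 4) = 'i :> C.
Proof.
have -> : 1 / 4 = (1 / 4 : R)%:C%C :> C by rewrite rmorphM fmorphV rmorph_nat rmorph1.
rewrite ce_real; have -> : 2 * pi * (1 / 4) = pi / 2 :> R by field.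
by rewrite cos_pihalf sin_pihalf i_def.
Qed.

Lemma ce_third : 1 + ce (1 / 3) + ce (1 / 3) ^+ 2 = 0 :> C.
Proof.
have h3 : ce (1 / 3) ^+ 3 = 1 :> C.
  (* The period of the exponential is taken from the value at one quarter, as the fourth power of
     ['i]. *)
  rewrite -ceMn; have -> : 3%:R * (1 / 3) = 4%:R * (1 / 4) :> C by field.
  by rewrite ceMn ce_quarter -[4%N]/(2 * 2)%N exprM sqrCi sqrrN expr1n.
have n1 : ce (1 / 3) - 1 != 0 :> C.
  have -> : 1 / 3 = (1 / 3 : R)%:C%C :> C by rewrite rmorphM fmorphV rmorph_nat rmorph1.
  rewrite subr_eq0 ce_real eq_complex /= negb_and; apply/orP; right.
  rewrite gt_eqF// sin_gt0_pi//; have := pi_gt0 R => p0.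
  by apply/andP; split; lra.
apply: (mulfI n1); rewrite mulr0; move: (ce _) h3 => om h3.
have -> : (om - 1) * (1 + om + om ^+ 2) = om ^+ 3 - 1 by ring.
by rewrite h3 subrr.
Qed.

Lemma iprod_eq (f : nat -> C) l :
  tends (fun N => \prod_(n < N) f n.+1) l -> iprod f = l.
Proof.
move=> h; apply: tends_lim; apply: tends_shift; apply: tends_ext h => N.
by rewrite big_add1 big_mkord.
Qed.

Section AtPoint.
Variable tau : C.
Hypothesis tau0 : 0 < complex.Im tau.

Lemma nm_ce_lt1 : nm (ce tau) < 1.
Proof.
by rewrite nm_ce -[ltRHS]expR0 ltr_expR oppr_lt0 !mulr_gt0// pi_gt0.
Qed.

Local Notation q := (ce tau).
Local Notation phi := (poch q q).

Lemma phi_neq0 : phi != 0. Proof. by apply: poch_neq0; exact: nm_ce_lt1. Qed.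

Let tphi : tends (fun N => \prod_(n < N) (1 - q ^+ n.+1)) phi.
Proof.
apply: tends_ext (pochP q nm_ce_lt1) => N.
by apply: eq_bigr => n _; rewrite exprS.
Qed.

Lemma etaE : eta tau = ce (tau / 24) * phi.
Proof. by rewrite /eta; congr (_ * _); exact: iprod_eq. Qed.

Lemma theta1E z : theta1 tau z =
  - 'i * ce (tau / 8) * ce (z / 2) * (theta_prod q (ce z) * phi).
Proof.
rewrite /theta1; congr (_ * _); apply: iprod_eq.
apply: tends_ext (tendsM (theta_prod_tends (ce z) nm_ce_lt1) tphi) => N.
by rewrite -big_split; apply: eq_bigr => n _ /=; rewrite [X in X * _]mulrC.
Qed.

Lemma theta2E z : theta2 tau z =
  ce (tau / 8) * ce (z / 2) * (theta_prod q (- ce z) * phi).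
Proof.
rewrite /theta2; congr (_ * _); apply: iprod_eq.
apply: tends_ext (tendsM (theta_prod_tends (- ce z) nm_ce_lt1) tphi) => N.
rewrite -big_split; apply: eq_bigr => n _ /=; rewrite [X in X * _]mulrC.
by rewrite invrN !mulNr !opprK.
Qed.

End AtPoint.

Lemma poch2 q u : nm q < 1 -> poch u q * poch (- u) q = poch (u ^+ 2) (q ^+ 2).
Proof.
move=> q1; have q2 : nm (q ^+ 2) < 1 by rewrite nmX exprn_ilt1 ?nm_ge0.
apply/esym/poch_eq => //; apply: tends_ext (tendsM (pochP u q1) (pochP (- u) q1)) => N.
rewrite /qprod -big_split; apply: eq_bigr => n _ /=.
by rewrite -exprM mulnC exprM; ring.
Qed.

(** Factor by factor this is the factorization of [1 - x^3] over the cube roots of unity. *)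
Lemma poch3 q u (om : C) : nm q < 1 -> 1 + om + om ^+ 2 = 0 ->
  poch u q * poch (om * u) q * poch (om ^+ 2 * u) q = poch (u ^+ 3) (q ^+ 3).
Proof.
move=> q1 hom; have q3 : nm (q ^+ 3) < 1 by rewrite nmX exprn_ilt1 ?nm_ge0.
have om3 : om ^+ 3 = 1.
  by apply/subr0_eq; rewrite -(mulr0 (om - 1)) -hom; ring.
apply/esym/poch_eq => //; apply: tends_ext
  (tendsM (tendsM (pochP u q1) (pochP (om * u) q1)) (pochP (om ^+ 2 * u) q1)) => N.
rewrite /qprod -!big_split; apply: eq_bigr => n _ /=.
rewrite -exprM mulnC exprM; move: (q ^+ n) => x.
have -> : (1 - u * x) * (1 - om * u * x) * (1 - om ^+ 2 * u * x) =
  1 - (1 + om + om ^+ 2) * (u * x) + om * (1 + om + om ^+ 2) * (u * x) ^+ 2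
  - om ^+ 3 * (u * x) ^+ 3 by ring.
by rewrite hom om3; ring.
Qed.

Lemma theta_prod2 q u : nm q < 1 ->
  theta_prod q u * theta_prod q (- u) = theta_prod (q ^+ 2) (u ^+ 2).
Proof.
move=> q1; have h1 := poch2 (u * q) q1; have h2 := poch2 u^-1 q1.
rewrite /theta_prod (invrN u) (mulNr u q) -(exprVn u 2) -(exprMn 2 u q) -h1 -h2.
exact: mulrACA.
Qed.

Lemma theta_prod3 q u (om : C) : nm q < 1 -> 1 + om + om ^+ 2 = 0 ->
  theta_prod q u * theta_prod q (om * u) * theta_prod q (om ^+ 2 * u) =
  theta_prod (q ^+ 3) (u ^+ 3).
Proof.
move=> q1 hom; have om3 : om ^+ 3 = 1.
  by apply/subr0_eq; rewrite -(mulr0 (om - 1)) -hom; ring.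
have omV : om^-1 = om ^+ 2.
  have om0 : om != 0 by apply: contra_eq_neq om3 => ->; rewrite expr0n eq_sym oner_eq0.
  by apply: (mulfI om0); rewrite divff// -exprS.
have om2V : (om ^+ 2)^-1 = om by rewrite -omV invrK.
have h1 := poch3 (u * q) q1 hom; have h2 := poch3 u^-1 q1 hom.
have e1 : (om * u)^-1 = om ^+ 2 * u^-1 by rewrite (invfM om u) omV.
have e2 : (om ^+ 2 * u)^-1 = om * u^-1 by rewrite (invfM (om ^+ 2) u) om2V.
rewrite /theta_prod e1 e2 -(exprVn u 3) -(exprMn 3 u q) -h1 -h2.
rewrite -(mulrA om u q) -(mulrA (om ^+ 2) u q).
move: (poch (u * q) q) (poch (om * (u * q)) q) (poch (om ^+ 2 * (u * q)) q).
move: (poch u^-1 q) (poch (om * u^-1) q) (poch (om ^+ 2 * u^-1) q).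
by move=> a b c a' b' c'; ring.
Qed.

(** * The functions [psi5] in terms of eigenvalues *)

Section Psi5.
Variables tau z : C.
Hypotheses (t0 : 0 < complex.Im tau) (z0 : 0 < - complex.Im z).
Hypothesis zt : - complex.Im z < complex.Im tau.
Local Notation q := (ce tau).
Local Notation y := (ce z).
Local Notation phi := (poch q q).
Local Notation Th := (theta_prod q).

Lemma nm_yV : nm y^-1 < 1.
Proof.
rewrite nmV nm_ce invf_lt1 ?expR_gt0// -[ltLHS]expR0 ltr_expR -mulrN.
by rewrite !mulr_gt0// pi_gt0.
Qed.

Lemma nm_yq : nm (y * q) < 1.
Proof.
rewrite nmM !nm_ce -expRD -[ltRHS]expR0 ltr_expR -opprD -mulrDr oppr_lt0.
by rewrite !mulr_gt0 ?pi_gt0// -ltrBlDl sub0r.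
Qed.

(** Inside the domain both [(k * y)^-1] and [k * y * q] have modulus less than one, so no factor of
    the product vanishes. *)
Lemma theta_y_neq0 (k : C) : nm k = 1 -> Th (k * y) != 0.
Proof.
move=> k1; apply: theta_prod_neq0; first exact: nm_ce_lt1.
  by rewrite invfM nmM nmV k1 invr1 mul1r nm_yV.
by rewrite -mulrA nmM k1 mul1r nm_yq.
Qed.

(** The contribution of an element [g] to the trace, with the eigenvalues [la]
    of [g] on [a^+], [mu] on [a'^+] and [nu] on [b^+]. *)
Definition twisted_term (la mu : C) (nu : 'I_3 -> C) : C :=
  Th (la * y ^+ 2) * Th (mu * y ^+ 3) * (\prod_j Th (nu j * y))^-1.

(** The sign is the one in the definition of the series, [y] is the charge of the vacuum, [phi ^+ 2]
    is what the first factor leaves, and the two terms belong to [g] and its inverse. *)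
Definition twisted_value (la mu : C) (nu : 'I_3 -> C) : C :=
  - (y * phi ^+ 2 * (twisted_term la mu nu
     + twisted_term la^-1 mu^-1 (fun j => (nu j)^-1))).

Definition triple (a b c : C) (j : 'I_3) : C := nth 0 [:: a; b; c] j.

Let tripleE a b c (f : C -> C) : \prod_j f (triple a b c j) = f a * f b * f c.
Proof. by rewrite !big_ord_recl big_ord0 mulr1 mulrA. Qed.

Lemma twisted_termE la mu a b c : twisted_term la mu (triple a b c) =
  Th (la * y ^+ 2) * Th (mu * y ^+ 3) / (Th (a * y) * Th (b * y) * Th (c * y)).
Proof. by rewrite /twisted_term (tripleE a b c (fun x => Th (x * y))). Qed.

Lemma twisted_valueE la mu a b c : twisted_value la mu (triple a b c) =
  - (y * phi ^+ 2 * (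
  Th (la * y ^+ 2) * Th (mu * y ^+ 3) / (Th (a * y) * Th (b * y) * Th (c * y)) +
  Th (la^-1 * y ^+ 2) * Th (mu^-1 * y ^+ 3) /
    (Th (a^-1 * y) * Th (b^-1 * y) * Th (c^-1 * y)))).
Proof.
rewrite /twisted_value twisted_termE; congr (- (_ * (_ + _))).
by rewrite /twisted_term (tripleE a b c (fun x => Th (x^-1 * y))).
Qed.

Local Notation t := (ce (tau / 24)).
Local Notation u := (ce (z / 2)).

Let t3 : ce (tau / 8) = t ^+ 3.
Proof. by rewrite -ceMn; congr ce; field. Qed.
Let yE : y = u ^+ 2.
Proof. by rewrite -ceMn; congr ce; field. Qed.
Let y2 : ce (2 * z) = y ^+ 2. Proof. by rewrite -ceMn. Qed.
Let y3 : ce (3 * z) = y ^+ 3. Proof. by rewrite -ceMn. Qed.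
Let u2 : ce (2 * z / 2) = u ^+ 2.
Proof. by rewrite -ceMn; congr ce; field. Qed.
Let u3 : ce (3 * z / 2) = u ^+ 3.
Proof. by rewrite -ceMn; congr ce; field. Qed.
Let tt0 : t != 0. Proof. exact: ce_neq0. Qed.
Let uu0 : u != 0. Proof. exact: ce_neq0. Qed.
Let i0 : 'i != 0 :> C. Proof. exact: neq0Ci. Qed.
Let ph0 : phi != 0. Proof. exact: phi_neq0. Qed.
Let Tp : Th y != 0.
Proof. by have := theta_y_neq0 (nm1 R); rewrite mul1r. Qed.
Let Tm : Th (- y) != 0.
Proof. by have := @theta_y_neq0 (-1); rewrite nmN nm1 mulN1r; apply. Qed.

Let ii : 'i * 'i = -1 :> C. Proof. by rewrite -expr2 sqrCi. Qed.

(** All prefactors are powers of [q^(1/24)] and [y^(1/2)], written [t] and [u]. With the theta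
    products replaced by variables, an identity of rational functions remains. *)
Lemma psi5_1A : psi5 C1A tau z = twisted_value 1 1 (triple 1 1 1).
Proof.
rewrite twisted_valueE !invr1 !mul1r /psi5 etaE// !theta1E// t3 u2 u3 y2 y3.
move: Tp; move: (Th y) (Th (y ^+ 2)) (Th (y ^+ 3)) => T1 T2 T3 T10; rewrite yE.
by field; rewrite ?T10 ?tt0 ?uu0 ?i0 ?ph0.
Qed.

Lemma psi5_2A : psi5 C2A tau z = twisted_value 1 (-1) (triple (-1) (-1) (-1)).
Proof.
rewrite twisted_valueE invr1 invrN1 !mul1r !mulN1r /psi5 etaE// theta1E// !theta2E//.
rewrite t3 u2 u3 y2 y3.
move: Tm; move: (Th (- y)) (Th (y ^+ 2)) (Th (- y ^+ 3)) => T1 T2 T3 T10; rewrite yE.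
(* The factor ['i * 'i] is kept apart here, because [field] treats ['i] as an indeterminate. *)
transitivity ('i * 'i * (u ^+ 2 * phi ^+ 2 * (T2 * T3 / (T1 * T1 * T1) + T2 * T3 / (T1 * T1 * T1)))).
  by field; rewrite ?T10 ?tt0 ?uu0 ?i0 ?ph0.
by rewrite ii mulN1r.
Qed.

Lemma psi5_2B : psi5 C2B tau z = twisted_value 1 1 (triple (-1) 1 (-1)).
Proof.
rewrite twisted_valueE invr1 invrN1 !mul1r !mulN1r /psi5 etaE// !theta1E// theta2E//.
rewrite t3 u2 u3 y2 y3; move: Tm Tp.
move: (Th y) (Th (- y)) (Th (y ^+ 2)) (Th (y ^+ 3)) => T0 T1 T2 T3 T10 T00; rewrite yE.
transitivity ('i * 'i * (u ^+ 2 * phi ^+ 2 * (T2 * T3 / (T1 * T0 * T1) + T2 * T3 / (T1 * T0 * T1)))).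
  by field; rewrite ?T00 ?T10 ?tt0 ?uu0 ?i0 ?ph0.
by rewrite ii mulN1r.
Qed.

Lemma psi5_2C : psi5 C2C tau z = twisted_value 1 (-1) (triple 1 (-1) 1).
Proof.
rewrite twisted_valueE invr1 invrN1 !mul1r !mulN1r /psi5 etaE// !theta1E// !theta2E//.
rewrite t3 u2 u3 y2 y3; move: Tm Tp.
move: (Th y) (Th (- y)) (Th (y ^+ 2)) (Th (- y ^+ 3)) => T0 T1 T2 T3 T10 T00; rewrite yE.
by field; rewrite ?T00 ?T10 ?tt0 ?uu0 ?i0 ?ph0.
Qed.

Let q1 : nm q < 1. Proof. exact: nm_ce_lt1. Qed.
Let tau_pos (n : nat) : (0 < n)%N -> 0 < complex.Im (n%:R * tau).
Proof.
move=> n0; have -> : complex.Im (n%:R * tau) = n%:R * complex.Im tau.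
  by rewrite mulr_natl raddfMn mulr_natl.
by rewrite mulr_gt0// ltr0n.
Qed.

Local Notation om := (ce (1 / 3) : C).

Let omV : om^-1 = om ^+ 2.
Proof.
have h : om ^+ 3 = 1 by apply/subr0_eq; rewrite -(mulr0 (om - 1)) -ce_third; move: om => o; ring.
by apply: (mulfI (ce_neq0 (1 / 3))); rewrite divff ?ce_neq0// -exprS.
Qed.
Let om2V : (om ^+ 2)^-1 = om. Proof. by rewrite -omV invrK. Qed.

Let nm_om : nm om = 1.
Proof.
have -> : 1 / 3 = (1 / 3 : R)%:C%C :> C by rewrite rmorphM fmorphV rmorph_nat rmorph1.
by rewrite nm_ce /= mulr0 oppr0 expR0.
Qed.

Let nm_om2 : nm (om ^+ 2) = 1. Proof. by rewrite nmX nm_om expr1n. Qed.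

(** The denominators multiply to [Theta_(q^3)(y^3)]. Inversion merely permutes the cube roots of
    unity, so the terms of [g] and its inverse agree. *)
Lemma psi5_3A : psi5 C3A tau z = twisted_value 1 1 (triple 1 om (om ^+ 2)).
Proof.
have T3p := theta_prod3 y q1 ce_third.
have T30 : theta_prod (q ^+ 3) (y ^+ 3) != 0.
  by rewrite -T3p; apply: mulf_neq0 (mulf_neq0 Tp (theta_y_neq0 nm_om)) (theta_y_neq0 nm_om2).
have -> : twisted_value 1 1 (triple 1 om (om ^+ 2)) = - (y * phi ^+ 2 *
    (Th (y ^+ 2) * Th (y ^+ 3) / theta_prod (q ^+ 3) (y ^+ 3)
     + Th (y ^+ 2) * Th (y ^+ 3) / theta_prod (q ^+ 3) (y ^+ 3))).
  rewrite twisted_valueE invr1 (mul1r y) (mul1r (y ^+ 2)) (mul1r (y ^+ 3)) om2V omV -T3p.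
  by rewrite [Th y * Th (om ^+ 2 * y) * _]mulrAC.
have ph3 := @phi_neq0 (3%:R * tau) (tau_pos (isT : (0 < 3)%N)).
rewrite /psi5 (etaE (tau_pos (isT : (0 < 3)%N))) (theta1E (tau_pos (isT : (0 < 3)%N))).
rewrite !theta1E// t3 u2 u3 y2 y3.
have -> : ce (3 * tau / 24) = t ^+ 3 by rewrite -ceMn; congr ce; field.
have -> : ce (3 * tau / 8) = t ^+ 9 by rewrite -ceMn; congr ce; field.
move: ph3 T30; rewrite ceMn; move: (poch (q ^+ 3) (q ^+ 3)) => p3.
move: (theta_prod _ (y ^+ 3)) (Th (y ^+ 2)) (Th (y ^+ 3)) => T1 T2 T3 p30 T10; rewrite yE.
transitivity ('i * 'i * (u ^+ 2 * phi ^+ 2 * (T2 * T3 / T1 + T2 * T3 / T1))).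
  by field; rewrite ?T10 ?tt0 ?uu0 ?i0 ?ph0 ?p30.
by rewrite ii mulN1r.
Qed.

Lemma psi5_6A : psi5 C6A tau z = twisted_value 1 (-1) (triple (-1) (- om) (- om ^+ 2)).
Proof.
have T3p := theta_prod3 (- y) q1 ce_third.
have yN : (- y) ^+ 3 = - y ^+ 3 by rewrite exprNn -signr_odd mulN1r.
rewrite yN in T3p.
have T30 : theta_prod (q ^+ 3) (- y ^+ 3) != 0.
  rewrite -T3p (mulrN om) (mulrN (om ^+ 2)) -(mulNr om) -(mulNr (om ^+ 2)).
  by apply: mulf_neq0 (mulf_neq0 Tm (theta_y_neq0 _)) (theta_y_neq0 _); rewrite nmN.
have -> : twisted_value 1 (-1) (triple (-1) (- om) (- om ^+ 2)) = - (y * phi ^+ 2 *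
    (Th (y ^+ 2) * Th (- y ^+ 3) / theta_prod (q ^+ 3) (- y ^+ 3)
     + Th (y ^+ 2) * Th (- y ^+ 3) / theta_prod (q ^+ 3) (- y ^+ 3))).
  rewrite twisted_valueE invr1 invrN1 (invrN om) (invrN (om ^+ 2)) om2V omV -T3p.
  rewrite (mul1r (y ^+ 2)) (mulN1r y) (mulN1r (y ^+ 3)) (mulNr om) (mulNr (om ^+ 2)).
  rewrite -(mulrN om) -(mulrN (om ^+ 2)).
  by rewrite [Th (- y) * Th (om ^+ 2 * - y) * _]mulrAC.
have ph3 := @phi_neq0 (3%:R * tau) (tau_pos (isT : (0 < 3)%N)).
rewrite /psi5 (etaE (tau_pos (isT : (0 < 3)%N))) (theta2E (tau_pos (isT : (0 < 3)%N))).
rewrite !theta1E// !theta2E// t3 u2 u3 y2 y3.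
have -> : ce (3 * tau / 24) = t ^+ 3 by rewrite -ceMn; congr ce; field.
have -> : ce (3 * tau / 8) = t ^+ 9 by rewrite -ceMn; congr ce; field.
move: ph3 T30; rewrite ceMn; move: (poch (q ^+ 3) (q ^+ 3)) => p3.
move: (theta_prod _ (- y ^+ 3)) (Th (y ^+ 2)) (Th (- y ^+ 3)) => T1 T2 T3 p30 T10; rewrite yE.
transitivity ('i * 'i * (u ^+ 2 * phi ^+ 2 * (T2 * T3 / T1 + T2 * T3 / T1))).
  by field; rewrite ?T10 ?tt0 ?uu0 ?i0 ?ph0 ?p30.
by rewrite ii mulN1r.
Qed.

Lemma nm_i : nm ('i : C) = 1.
Proof. by apply: complexI; rewrite -normE normCi rmorph1. Qed.

Let ceDV (w1 w2 : C) : ce (w1 - w2) = ce w1 / ce w2.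
Proof. by rewrite ceD ceVN. Qed.
Let half_shift (n : nat) (v : C) : ce ((n%:R * z + v) / 2) = u ^+ n * ce (v / 2).
Proof. by rewrite mulrDl ceD -mulrA ceMn. Qed.
Let half_shift1 (v : C) : ce ((z + v) / 2) = u * ce (v / 2).
Proof. by rewrite mulrDl ceD. Qed.

(** The squared theta function in the denominator contributes both [Th ('i * y)] and
    [Th ('i^-1 * y)] twice. The numerator of either summand cancels one of them, which leaves the
    contribution of [g] or of its inverse. *)
Lemma psi5_4A : psi5 C4A tau z = twisted_value (-1) 'i (triple 'i 'i^-1 'i^-1).
Proof.
have iV : 'i^-1 = - 'i :> C by apply: (mulfI i0); rewrite divff// mulrN ii opprK.
have T20 : theta_prod (q ^+ 2) (- y ^+ 2) = Th ('i * y) * Th ('i^-1 * y).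
  rewrite iV (mulNr 'i y) (theta_prod2 ('i * y) q1); congr theta_prod.
  by rewrite exprMn sqrCi mulN1r.
have Tp0 : Th ('i * y) != 0 by apply: theta_y_neq0; exact: nm_i.
have Tm0 : Th ('i^-1 * y) != 0 by apply: theta_y_neq0; rewrite iV nmN nm_i.
have tau2 := tau_pos (isT : (0 < 2)%N).
have ph2 := phi_neq0 tau2.
rewrite twisted_valueE invrK invrN1 !mulN1r /psi5 (etaE tau2) (theta2E tau2) etaE//.
rewrite !theta1E// theta2E// t3.
have -> : ce (2 * tau / 24) = t ^+ 2 by rewrite -ceMn; congr ce; field.
have -> : ce (2 * tau / 8) = t ^+ 6 by rewrite -ceMn; congr ce; field.
(* The square of this eighth root of unity is the constant that the shifts by one quarter produce in
   the factors [y^(1/2)] and [y^(3/2)]. *)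
have f2 : ce (1 / 4 / 2) ^+ 2 = 'i :> C.
  by rewrite -ceMn -ce_quarter; congr ce; field.
rewrite u2 y2 !ceDV !ceD ce_quarter y3 !half_shift1 !half_shift !mulNr !ceVN.
rewrite (ceMn 2 tau) [y * 'i]mulrC [y / 'i]mulrC [y ^+ 3 * 'i]mulrC [y ^+ 3 / 'i]mulrC.
rewrite T20; move: ph2 (ce_neq0 (1 / 4 / 2)) f2 Tp0 Tm0; rewrite (ceMn 2 tau).
move: (poch (q ^+ 2) (q ^+ 2)) => p2; move: (ce (1 / 4 / 2)) => f.
move: (Th ('i * y)) (Th ('i^-1 * y)) (Th ('i * y ^+ 3)) (Th ('i^-1 * y ^+ 3)).
move: (Th (- y ^+ 2)) => T2 P M P3 M3 p20 f0 f2 P0 M0; rewrite yE.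
have fV : f^-1 * f^-1 = 'i^-1 by rewrite -f2 expr2 invfM.
transitivity (- (u ^+ 2 * phi ^+ 2 * T2 * ('i * 'i * ('i * (f * f)) * (P3 * P / (P * M) ^+ 2)
   - 'i * 'i * ('i * (f^-1 * f^-1)) * (M3 * M / (P * M) ^+ 2)))).
  by field; rewrite ?tt0 ?uu0 ?i0 ?ph0 ?p20 ?f0 ?P0 ?M0.
rewrite fV -(expr2 f) f2 !ii divff//.
by field; rewrite ?P0 ?M0.
Qed.

(** The powers of [e] with exponents [1, 3, 5, -1, -3, -5] are the sixth roots of [-1]. Pairing
    opposite roots passes from [q] to [q^2], and the cube roots of unity then lead to [q^6], so the
    theta function in the denominator contains all six factors. The first summand gives the term of
    the inverse. *)
Lemma psi5_12A : psi5 C12A tau z = twisted_value (-1) 'i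
  (triple (ce (1 / 12)) (ce (1 / 12) ^+ 3) (ce (1 / 12) ^+ 5)).
Proof.
set e : C := ce (1 / 12); have e0 : e != 0 by exact: ce_neq0.
have iV : 'i^-1 = - 'i :> C by apply: (mulfI i0); rewrite divff// mulrN ii opprK.
have e3 : e ^+ 3 = 'i by rewrite -ceMn -ce_quarter; congr ce; field.
have e4 : e ^+ 4 = om by rewrite -ceMn; congr ce; field.
have e5 : e ^+ 5 = ce (5 / 12) by rewrite -ceMn; congr ce; field.
have nme : nm e = 1.
  have -> : e = ce (1 / 12 : R)%:C%C.
    by rewrite /e; congr ce; rewrite rmorphM fmorphV rmorph_nat rmorph1.
  by rewrite nm_ce /= mulr0 oppr0 expR0.
pose P1 := Th (e * y); pose P2 := Th (e ^+ 3 * y); pose P3 := Th (e ^+ 5 * y).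
pose M1 := Th (e^-1 * y); pose M2 := Th (e ^- 3 * y); pose M3 := Th (e ^- 5 * y).
have P10 : P1 != 0 by apply: theta_y_neq0.
have P20 : P2 != 0 by apply: theta_y_neq0; rewrite nmX nme expr1n.
have P30 : P3 != 0 by apply: theta_y_neq0; rewrite nmX nme expr1n.
have M10 : M1 != 0 by apply: theta_y_neq0; rewrite nmV nme invr1.
have M20 : M2 != 0 by apply: theta_y_neq0; rewrite nmV nmX nme expr1n invr1.
have M30 : M3 != 0 by apply: theta_y_neq0; rewrite nmV nmX nme expr1n invr1.
have e6 : e ^+ 6 = -1 by rewrite -[6%N]/(3 * 2)%N exprM e3 sqrCi.
have pair k l : (k + l = 6)%N -> Th (e ^+ k * y) * Th (e ^- l * y) =
    theta_prod (q ^+ 2) (e ^+ k.*2 * y ^+ 2).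
  move=> kl; have -> : e ^- l = - e ^+ k.
    by apply: (mulfI (expf_neq0 l e0)); rewrite divff ?expf_neq0// mulrN -exprD addnC kl e6 opprK.
  rewrite (mulNr (e ^+ k) y) (theta_prod2 (e ^+ k * y) q1); congr theta_prod.
  by rewrite exprMn -exprM muln2.
have q2 : nm (q ^+ 2) < 1 by rewrite nmX exprn_ilt1 ?nm_ge0.
have T60 : theta_prod (q ^+ 6) (- y ^+ 6) = (P1 * P2 * P3) * (M1 * M2 * M3).
  transitivity ((P1 * M3) * (P3 * M1) * (P2 * M2)); last first.
    by move: (P1) (P2) (P3) (M1) (M2) (M3) => x1 x2 x3 x4 x5 x6; ring.
  have h1 : P1 * M3 = theta_prod (q ^+ 2) (e ^+ 2 * y ^+ 2) by exact: (pair 1 5).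
  have h2 : P3 * M1 = theta_prod (q ^+ 2) (e ^+ 10 * y ^+ 2) by exact: (pair 5 1).
  have h3 : P2 * M2 = theta_prod (q ^+ 2) (e ^+ 6 * y ^+ 2) by exact: (pair 3 3).
  have a1 : om * (e ^+ 2 * y ^+ 2) = e ^+ 6 * y ^+ 2 by rewrite -e4 mulrA -exprD.
  have a2 : om ^+ 2 * (e ^+ 2 * y ^+ 2) = e ^+ 10 * y ^+ 2.
    by rewrite -e4 -exprM mulrA -exprD.
  have a3 : (e ^+ 2 * y ^+ 2) ^+ 3 = - y ^+ 6 by rewrite exprMn -!exprM e6 mulN1r.
  have a4 : (q ^+ 2) ^+ 3 = q ^+ 6 by rewrite -exprM.
  have h := theta_prod3 (e ^+ 2 * y ^+ 2) q2 ce_third.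
  rewrite a1 a2 a3 a4 -h1 -h2 -h3 in h; rewrite -h; exact: mulrAC.
have tau6 := tau_pos (isT : (0 < 6)%N).
have ph6 := phi_neq0 tau6.
rewrite twisted_valueE invrN1 !mulN1r /psi5 (etaE tau6) (theta2E tau6) etaE//.
rewrite !theta1E// theta2E// t3.
have -> : ce (6 * tau / 24) = t ^+ 6 by rewrite -ceMn; congr ce; field.
have -> : ce (6 * tau / 8) = t ^+ 18 by rewrite -ceMn; congr ce; field.
have -> : ce (6 * z / 2) = u ^+ 6 by rewrite -ceMn; congr ce; field.
have -> : ce (6 * z) = y ^+ 6 by rewrite -ceMn.
rewrite u2 y2 !ceDV !ceD ce_quarter y3 !half_shift1 !half_shift !mulNr !ceVN -/e -e5.
have f1 : ce (1 / 12 / 2) ^+ 3 = ce (1 / 4 / 2) :> C by rewrite -ceMn; congr ce; field.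
have f5 : ce (1 / 12 / 2) ^+ 5 = ce (5 / 12 / 2) :> C by rewrite -ceMn; congr ce; field.
(* In units of one twelfth the shifts of the four theta functions add up to [1 + 3 + 5 - 3 = 6],
   whence the sixth power. *)
have f6 : ce (1 / 12 / 2) ^+ 6 = 'i :> C by rewrite -ceMn -ce_quarter; congr ce; field.
rewrite -f1 -f5 (mulrC y e) (mulrC y (e ^+ 5)) (mulrC y e^-1) (mulrC y (e ^- 5)).
rewrite (mulrC y 'i) (mulrC y 'i^-1) (mulrC (y ^+ 3) 'i) (mulrC (y ^+ 3) 'i^-1) -[in 'i * y]e3
  -[in 'i^-1 * y]e3.
rewrite -(ceMn 6 tau) in T60.
rewrite -!/P1 -!/P2 -!/P3 -!/M1 -!/M2 -!/M3 T60.
have g6 : 'i * ce (1 / 12 / 2) ^+ 6 = -1 :> C by rewrite f6 ii.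
have g6V : 'i * ce (1 / 12 / 2) ^- 6 = 1 :> C by rewrite f6 divff.
move: ph6 (ce_neq0 (1 / 12 / 2)) g6 g6V P10 P20 P30 M10 M20 M30.
move: (ce (1 / 12 / 2)) (poch _ (ce (6%:R * tau))) => f p6.
move: (P1) (P2) (P3) (M1) (M2) (M3) => x1 x2 x3 w1 w2 w3.
move: (Th ('i * y ^+ 3)) (Th ('i^-1 * y ^+ 3)) (Th (- y ^+ 2)) => Tp3 Tm3 T2.
move=> p60 f0 g6 g6V x10 x20 x30 w10 w20 w30; rewrite yE.
transitivity (u ^+ 2 * phi ^+ 2 * T2 * ('i * 'i * ('i * 'i) * ('i * f ^+ 6) *
    (Tm3 / (w1 * w2 * w3)) - 'i * 'i * ('i * 'i) * ('i * f ^- 6) * (Tp3 / (x1 * x2 * x3)))).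
  by field; rewrite ?x10 ?x20 ?x30 ?w10 ?w20 ?w30 ?tt0 ?uu0 ?i0 ?ph0 ?p60 ?f0.
by rewrite g6 g6V ii; field; rewrite ?x10 ?x20 ?x30 ?w10 ?w20 ?w30.
Qed.

End Psi5.

End ThetaFunctions.

(** * The symmetric group on three letters *)

Section SymmetricGroup3.
Variables (s r : {perm 'I_3}).
Hypothesis transposition_s : exists i j : 'I_3, i != j /\ s = tperm i j.
Hypothesis order_r : #[r]%g = 3.
Local Open Scope group_scope.

Let third (i j a b : 'I_3) : i != j -> a != i -> a != j -> b != i -> b != j -> a = b.
Proof.
move=> ij ai aj bi bj; apply: val_inj; move: ij ai aj bi bj; rewrite -!val_eqE /=.
by have := ltn_ord i; have := ltn_ord j; have := ltn_ord a; have := ltn_ord b; lia.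
Qed.

Lemma rK : r * r * r = 1.
Proof. by have := expg_order r; rewrite order_r !expgS mulg1 mulgA. Qed.

Lemma sK : s * s = 1.
Proof. by have [i [j [_ ->]]] := transposition_s; rewrite tperm2. Qed.

Let r_neq1 : r != 1. Proof. by rewrite -order_eq1 order_r. Qed.
(** A permutation that commutes with the transposition preserves its pair of letters. If it fixes
    both it is the identity on three letters, and if it swaps them its cube is not the identity. *)
Let s_r_noncommuting : s ^ r != s.
Proof.
have [i [j [ij ->]]] := transposition_s; rewrite tpermJ; apply/eqP => e.
have rij : r i != r j by rewrite (inj_eq perm_inj).
have in_ij a b : a != b -> tperm (r i) (r j) a = b -> (a == i) || (a == j).
  move=> ab; rewrite e; case: tpermP => [->|->|]; rewrite ?eqxx ?orbT// => _ _ h.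
  by rewrite h eqxx in ab.
have hi := in_ij _ _ rij (tpermL _ _).
have hj := in_ij (r j) (r i); rewrite eq_sym in hj; have {}hj := hj rij (tpermR _ _).
have r3 a : r (r (r a)) = a by rewrite -!permM mulgA rK perm1.
case/orP: hi => /eqP hi.
  have {}hj : r j = j.
    case/orP: hj => /eqP hj //; by rewrite hi hj eqxx in rij.
  move/eqP: r_neq1; apply; apply/permP => a; rewrite perm1.
  have [->//|ai] := eqVneq a i; have [->//|aj] := eqVneq a j.
  apply: (third ij) => //.
    by apply: contra ai => /eqP h; apply/eqP/(@perm_inj _ r); rewrite h hi.
  by apply: contra aj => /eqP h; apply/eqP/(@perm_inj _ r); rewrite h hj.
have {}hj : r j = i.
  by case/orP: hj => /eqP hj //; rewrite hi hj eqxx in rij.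
by have := r3 i; rewrite hi hj hi => /eqP; rewrite eq_sym (negbTE ij).
Qed.

Let index_r : #|setTfor {perm 'I_3} : <[r]>| = 2.
Proof.
have c6 : #|setTfor {perm 'I_3}| = 6.
  have h := card_perm (setTfor 'I_3); rewrite cardsT card_ord in h; rewrite -[RHS]h cardsT.
  apply: eq_card => x; rewrite [LHS]inE; apply/esym; rewrite unfold_in; apply/fintype.subsetP => y _.
  exact: finset.in_setT.
by rewrite -divgS ?finset.subsetT// c6 -orderE order_r.
Qed.

Let cycle_cases x : x \in <[r]> -> [\/ x = 1, x = r | x = r * r].
Proof.
move=> /cyclePmin[k]; rewrite order_r; case: k => [|[|[|//]]] _ ->.
- by constructor 1.
- by constructor 2.
- by constructor 3.
Qed.

(** The cyclic group of [r] has index two and is normal, so the conjugate of [r] is [1], [r] or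
    [r * r]; the first two are excluded by the order of [r] and by noncommutation. *)
Lemma r_conj_s : s * r * s = r * r.
Proof.
have nr : r ^ s \in <[r]>.
  have /normalP[_ /(_ s (finset.in_setT s)) <-] := index2_normal (finset.subsetT _) index_r.
  by rewrite memJ_conjg cycle_id.
have sV : s^-1 = s by apply/eqP; rewrite eq_invg_mul sK.
have -> : s * r * s = r ^ s by rewrite conjgE sV mulgA.
have [h|h|//] := cycle_cases nr.
  by move/eqP: h; rewrite conjg_eq1 (negbTE r_neq1).
move/eqP: s_r_noncommuting; case; apply/eqP; rewrite conjg_fix.
by rewrite -invg_comm invg_eq1 -conjg_fix h.
Qed.

Let s_notin : s \notin <[r]>.
Proof.
apply/negP => /cycle_cases sr; move/eqP: s_r_noncommuting; apply.
by rewrite conjgE; case: sr => ->; rewrite ?mulg1 ?mul1g ?mulVg// !mulgA mulVg mul1g.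
Qed.

Lemma sym3_decompose x :
  exists k : nat, (k < 3)%N /\ (x = r ^+ k \/ x = r ^+ k * s).
Proof.
have lt3 y : y \in <[r]> -> exists2 k, (k < 3)%N & y = r ^+ k.
  by case/cyclePmin => k; rewrite order_r => k3 ->; exists k.
have [/lt3[k k3 ->]|xr] := boolP (x \in <[r]>); first by exists k; split=> //; left.
have : x \in <[r]> :* s.
  by rewrite (rcoset_index2 (finset.subsetT _) index_r) ?inE ?xr ?s_notin.
by case/rcosetP => y /lt3[k k3 ->] ->; exists k; split=> //; right.
Qed.

(** The element [r * r] is conjugate to [r] by [s], and [r * s] and [r * r * s] are conjugate to [s]
    by powers of [r]. *)
Lemma sym3_conjugate x : exists z, [\/ x = 1, x = s ^ z | x = r ^ z].
Proof.
have sV : s^-1 = s by apply/eqP; rewrite eq_invg_mul sK.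
have rV : r^-1 = r * r by apply/eqP; rewrite eq_invg_mul mulgA rK.
have sr : s * r = r * r * s by rewrite -r_conj_s -!mulgA sK mulg1.
have s2 : s * (r * r) = r * s by rewrite mulgA sr -mulgA sr !mulgA rK mul1g.
have [k [k3 [->|->]]] := sym3_decompose x; case: k k3 => [|[|[|//]]] _.
- by exists 1; constructor 1.
- by exists 1; constructor 3; rewrite conjg1.
- by exists s; constructor 3; rewrite conjgE sV mulgA r_conj_s.
- by exists 1; constructor 2; rewrite conjg1 mul1g.
- exists r; constructor 2; rewrite conjgE rV -[s * r]/(s * r) sr expg1.
  by rewrite !mulgA -[r * r * r]/(r * r * r) rK mul1g.
- exists (r * r); constructor 2; rewrite conjgE invMg rV !mulgA -mulgA.
  by rewrite rK mul1g -(mulgA r s) s2 mulgA expgS expg1.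
Qed.

End SymmetricGroup3.

Section StandardRepresentation.
Variables (K : numClosedFieldType) (s r : {perm 'I_3}).
Hypothesis transposition_s : exists i j : 'I_3, i != j /\ s = tperm i j.
Hypothesis order_r : #[r]%g = 3%N.
Variable std : mx_representation K (setTfor {perm 'I_3}) 2.
Hypothesis irr_std : mx_irreducible std.

Let inT (x : {perm 'I_3}) : x \in setTfor {perm 'I_3}. Proof. exact: finset.in_setT. Qed.

Lemma std_mul x y : std (x * y)%g = std x *m std y.
Proof. exact: repr_mxM. Qed.

Lemma std_conj_trace x z : \tr (std (x ^ z)%g) = \tr (std x).
Proof.
rewrite conjgE !std_mul mxtrace_mulC -mulmxA -std_mul mulgV repr_mx1.
by rewrite mulmx1.
Qed.

(** Such a vector would span an invariant line, since [s] and [r] generate the group. In particular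
    neither matrix is scalar. *)
Let no_common_eigenvector (v : 'rV[K]_2) a b : v != 0 ->
  v *m std r = a *: v -> v *m std s = b *: v -> False.
Proof.
move=> v0 vr vs; have [_ /(_ <<v>>%MS)] := (mx_irrP std).1 irr_std.
have stab x c : v *m std x = c *: v -> x \in rstabs std v.
  by move=> h; rewrite inE inT h scalemx_sub.
have mv : mxmodule std v.
  apply/fintype.subsetP => x _.
  have [k [_ [->|->]]] := sym3_decompose transposition_s order_r x.
    by apply: groupX; exact: stab vr.
  by apply: groupM; [apply: groupX; exact: stab vr|exact: stab vs].
rewrite (eqmx_module _ (genmxE v)) => /(_ mv); rewrite -mxrank_eq0 mxrank_gen rank_rV v0.
by move=> /(_ isT); rewrite /row_full mxrank_gen rank_rV v0.
Qed.

Let eigenvector (M : 'M[K]_2) : exists (v : 'rV_2) a, v != 0 /\ v *m M = a *: v.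
Proof.
have [a /eigenvalueP[v vM v0]] := eigenvalue_closed M (isT : (0 < 2)%N).
by exists v, a.
Qed.

Let r_nonscalar a : std r <> a%:M.
Proof.
move=> h; have [v [b [v0 vs]]] := eigenvector (std s).
by apply: (no_common_eigenvector v0 _ vs); rewrite h mul_mx_scalar.
Qed.

Let s_nonscalar a : std s <> a%:M.
Proof.
move=> h; have [v [b [v0 vr]]] := eigenvector (std r).
by apply: (no_common_eigenvector v0 vr); rewrite h mul_mx_scalar.
Qed.

Let cayley (M : 'M[K]_2) : exists d : K, M *m M = \tr M *: M - d%:M.
Proof.
exists (M 0 0 * M 1 1 - M 0 1 * M 1 0); apply/matrixP => i j.
have tE : \tr M = M 0 0 + M 1 1.
  by rewrite /mxtrace !big_ord_recl big_ord0 addr0; congr (_ + M _ _); apply: val_inj.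
have E2 (f : 'I_2 -> K) : \sum_k f k = f 0 + f 1.
  by rewrite !big_ord_recl big_ord0 addr0; congr (_ + f _); apply: val_inj.
rewrite !mxE E2 tE.
have c2 (k : 'I_2) : k = 0 \/ k = 1 by case: k => [[|[|//]] ?]; [left|right]; apply: val_inj.
by case: (c2 i) => ->; case: (c2 j) => ->; rewrite /= ?mulr1n ?mulr0n; ring.
Qed.

Let scalar_relation (M : 'M[K]_2) (k c : K) : (forall a, M <> a%:M) ->
  k *: M = c%:M -> k = 0 /\ c = 0.
Proof.
move=> nM h; have k0 : k = 0.
  apply/eqP; apply: contraT => k0; case: (nM (k^-1 * c)).
  by rewrite -scale_scalar_mx -h scalerA mulVf// scale1r.
split=> //; move: h; rewrite k0 scale0r => /matrixP/(_ 0 0).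
by rewrite !mxE /= mulr1n.
Qed.

(** The Cayley-Hamilton relation together with [s * s = 1] makes the trace times the matrix scalar,
    and the matrix itself is not scalar. *)
Lemma std_trace_s : \tr (std s) = 0.
Proof.
have [d h] := cayley (std s).
have [||//] := @scalar_relation (std s) (\tr (std s)) (d + 1).
  exact: s_nonscalar.
by rewrite -[LHS](subrK d%:M) -h -std_mul (sK transposition_s) repr_mx1 -raddfD addrC.
Qed.

(** With trace [t] and determinant [d], conjugacy of [r * r] and [r] gives [t = t^2 - 2 d].
    Cayley-Hamilton and [r^3 = 1] give [d = t^2] and [t d = -1]. Hence [t] is nonzero and
    [t = - t^2]. *)
Lemma std_trace_r : \tr (std r) = -1.
Proof.
have [d h] := cayley (std r); set t := \tr (std r) in h *.
have t2 : t = t ^+ 2 - 2 * d.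
  have e : \tr (std r *m std r) = t.
    rewrite -std_mul -(r_conj_s transposition_s order_r).
    have sV : s^-1%g = s by apply/eqP; rewrite eq_invg_mul (sK transposition_s).
    by rewrite -{1}sV -mulgA -conjgE std_conj_trace.
  by rewrite -[LHS]e h linearB linearZ /= mxtrace_scalar expr2 mulr_natl.
have [||td tdr] := @scalar_relation (std r) (t ^+ 2 - d) (1 + t * d).
- exact: r_nonscalar.
- have h3 : std r *m std r *m std r = 1%:M by rewrite -!std_mul (rK order_r) repr_mx1.
  rewrite h mulmxBl -scalemxAl h mul_scalar_mx scalerBr scalerA scale_scalar_mx in h3.
  by rewrite scalerBl expr2 raddfD /= -h3 addrAC addrNK.
have dE : d = t ^+ 2 by apply/eqP; rewrite eq_sym -subr_eq0 td.
have t0 : t != 0.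
  apply/eqP => t0; move: tdr; rewrite t0 mul0r addr0 => /eqP; by rewrite oner_eq0.
apply: (mulfI t0); rewrite mulrN1; apply/eqP; rewrite -subr_eq0 opprK -expr2.
by apply/eqP; rewrite dE in t2; rewrite {2}t2; ring.
Qed.

End StandardRepresentation.

Arguments psi5 : simpl never.

(** * Classes, eigenvalues and values of the trace *)

Section EigenvalueTables.
Variable R : realType.
Local Notation C := (cplx R).
Variables tau z : C.
Hypotheses (t0 : 0 < complex.Im tau) (z0 : 0 < - complex.Im z).
Hypothesis zt : - complex.Im z < complex.Im tau.
Local Notation tv := (twisted_value tau z).

(** This exchanges the roles of [g] and its inverse, and so carries the evaluations for 4A and 12A
    over to 4B and 12B. *)
Lemma twisted_valueV3 la mu a b c :
  tv la^-1 mu^-1 (triple a^-1 b^-1 c^-1) = tv la mu (triple a b c).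
Proof. by rewrite !twisted_valueE !invrK addrC. Qed.

Lemma triple_swap12 la mu a b c : tv la mu (triple a b c) = tv la mu (triple b a c).
Proof.
rewrite !twisted_valueE [theta_prod _ (a * _) * theta_prod _ (b * _)]mulrC.
by rewrite [theta_prod _ (a^-1 * _) * theta_prod _ (b^-1 * _)]mulrC.
Qed.

Lemma triple_swap23 la mu a b c : tv la mu (triple a b c) = tv la mu (triple a c b).
Proof.
rewrite !twisted_valueE [theta_prod _ (a * _) * _ * theta_prod _ (c * _)]mulrAC.
by rewrite [theta_prod _ (a^-1 * _) * _ * theta_prod _ (c^-1 * _)]mulrAC.
Qed.

Let theta_prods_eq (u v : 'I_3 -> C) :
  (forall x, \prod_j (1 - u j * x) = \prod_j (1 - v j * x)) ->
  (forall x, \prod_j (1 - (u j)^-1 * x) = \prod_j (1 - (v j)^-1 * x)) ->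
  \prod_j theta_prod (ce tau) (u j * ce z) = \prod_j theta_prod (ce tau) (v j * ce z).
Proof.
move=> h hV; have q1 := nm_ce_lt1 t0.
apply: (tends_unique (theta_prods_tends (fun j => u j * ce z) q1)).
apply: tends_ext (theta_prods_tends (fun j => v j * ce z) q1) => N.
apply: eq_bigr => n _; rewrite !big_split /=; congr (_ * _).
  transitivity (\prod_j (1 - v j * (ce z * ce tau ^+ n.+1))).
    by apply: eq_bigr => j _; rewrite mulrA.
  by rewrite -h; apply: eq_bigr => j _; rewrite mulrA.
transitivity (\prod_j (1 - (v j)^-1 * ((ce z)^-1 * ce tau ^+ n))).
  by apply: eq_bigr => j _; rewrite invfM mulrA.
by rewrite -hV; apply: eq_bigr => j _; rewrite invfM mulrA.
Qed.

(** By Newton's identities the power sums of the eigenvalues determine the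
    value. *)
Lemma twisted_value_newton la mu (u v : 'I_3 -> C) n : (0 < n)%N ->
  (forall j, u j ^+ n = 1) -> (forall j, v j ^+ n = 1) ->
  (forall m, \sum_j u j ^+ m = \sum_j v j ^+ m) -> tv la mu u = tv la mu v.
Proof.
move=> n0 un vn uv.
(* The inverse of a root of unity is one of its powers, so the power sums of the inverses are
   determined too. *)
have inv_pow (w : C) m : w ^+ n = 1 -> w^-1 ^+ m = w ^+ (m * n.-1).
  move=> wn; have w0 : w != 0.
    by apply: contra_eq_neq wn => ->; rewrite expr0n gtn_eqF// eq_sym oner_eq0.
  rewrite mulnC exprM; congr (_ ^+ m); apply: (mulfI w0).
  by rewrite divff// -exprS prednK.
have uvV m : \sum_j (u j)^-1 ^+ m = \sum_j (v j)^-1 ^+ m.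
  transitivity (\sum_j u j ^+ (m * n.-1)).
    by apply: eq_bigr => j _; exact: inv_pow.
  by rewrite uv; apply: eq_bigr => j _; rewrite inv_pow.
have h1 := prod3_newton uv; have h2 := prod3_newton uvV.
rewrite /twisted_value /twisted_term (theta_prods_eq h1 h2).
congr (- (_ * (_ + _ * _^-1))); apply: theta_prods_eq => // x.
have e (w : 'I_3 -> C) : \prod_j (1 - (w j)^-1^-1 * x) = \prod_j (1 - w j * x).
  by apply: eq_bigr => j _; rewrite invrK.
by rewrite !e.
Qed.

(** The rows stand for the identity, a transposition and a 3-cycle, the columns for the powers of
    [c]. The second row takes the fusion of 4C and 4D into account. *)
Definition class_table (T k : nat) : umbral_class :=
  nth C1A (nth [::] [:: [:: C1A; C4A; C2A; C4B]; [:: C2B; C4A; C2C; C4B];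
                        [:: C3A; C12A; C6A; C12B]] T) k.

Definition sign_table (T : nat) : C := nth 0 [:: 1; -1; 1] T.
(** With [std_table2], the two eigenvalues of the standard representation at the identity, a
    transposition and a 3-cycle. *)
Definition std_table1 (T : nat) : C := nth 0 [:: 1; 1; ce (1 / 3)] T.
Definition std_table2 (T : nat) : C := nth 0 [:: 1; -1; ce (1 / 3) ^+ 2] T.
Definition weyl_table (T k : nat) : 'I_3 -> C :=
  triple (sign_table T * 'i ^+ k) (std_table1 T * (- 'i) ^+ k)
    (std_table2 T * (- 'i) ^+ k).

Let ii : 'i * 'i = -1 :> C. Proof. by rewrite -expr2 sqrCi. Qed.
Let iV : 'i^-1 = - 'i :> C.
Proof. by apply: (mulfI (@neq0Ci _)); rewrite divff ?neq0Ci// mulrN ii opprK. Qed.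
Let i2 : 'i ^+ 2 = -1 :> C. Proof. exact: sqrCi. Qed.
Let mi2 : (- 'i) ^+ 2 = -1 :> C. Proof. by rewrite sqrrN. Qed.
Let i3 : 'i ^+ 3 = - 'i :> C. Proof. by rewrite exprS i2 mulrN1. Qed.
Let mi3 : (- 'i) ^+ 3 = 'i :> C. Proof. by rewrite exprS mi2 mulrN1 opprK. Qed.
Let s3 : (-1) ^+ 3 = -1 :> C. Proof. by rewrite -signr_odd expr1. Qed.
Let s2 : (-1) ^+ 2 = 1 :> C. Proof. by rewrite -signr_odd expr0. Qed.

Let e3 : ce (1 / 12) ^+ 3 = 'i :> C.
Proof. by rewrite -ceMn -ce_quarter; congr ce; field. Qed.
Let e4 : ce (1 / 12) ^+ 4 = ce (1 / 3) :> C.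
Proof. by rewrite -ceMn; congr ce; field. Qed.
Let e1 : ce (1 / 3) * - 'i = ce (1 / 12) :> C.
Proof.
by rewrite -iV -e3 -e4 (exprSr _ 3) mulrAC divff ?(mul1r (ce _))// expf_neq0// ce_neq0.
Qed.
Let e5 : ce (1 / 3) ^+ 2 * - 'i = ce (1 / 12) ^+ 5 :> C.
Proof.
rewrite -iV -e3 -e4 -exprM (_ : 4 * 2 = 3 + 5)%N// exprD mulrAC divff ?(mul1r (_ ^+ 5))//.
by rewrite expf_neq0// ce_neq0.
Qed.

Lemma psi5_table T k : (T < 3)%N -> (k < 4)%N ->
  psi5 (class_table T k) tau z = tv ((-1) ^+ k) ('i ^+ k) (weyl_table T k).
Proof.
have p4 : psi5 C4B tau z = tv (-1) (- 'i) (triple (- 'i) 'i 'i).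
  transitivity (psi5 C4A tau z) => //; rewrite (psi5_4A t0 z0 zt) -twisted_valueV3.
  by rewrite invrN1 !invrK iV.
rewrite /weyl_table; case: T => [|[|[|//]]] _; case: k => [|[|[|[|//]]]] _;
rewrite /class_table /sign_table /std_table1 /std_table2 /=;
rewrite ?expr0 ?expr1 ?s2 ?s3 ?i2 ?mi2 ?i3 ?mi3 ?(mul1r ('i : C)) ?(mul1r (- 'i : C))
  ?(mul1r (1 : C)) ?(mul1r (-1 : C)) ?mulN1r ?opprK ?mulr1 ?mulrN1 ?expr1.
- exact: psi5_1A.
- by rewrite (psi5_4A t0 z0 zt) iV.
- exact: psi5_2A.
- exact: p4.
- exact: psi5_2B.
- by rewrite (psi5_4A t0 z0 zt) iV triple_swap12 triple_swap23.
- exact: psi5_2C.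
- by rewrite p4 triple_swap12 triple_swap23.
- exact: psi5_3A.
- by rewrite (psi5_12A t0 z0 zt) triple_swap12 e1 e5 e3.
- exact: psi5_6A.
- transitivity (psi5 C12A tau z) => //; rewrite (psi5_12A t0 z0 zt) -twisted_valueV3.
have i4 : 'i ^+ 4 = 1 :> C by rewrite -[4%N]/(2 * 2)%N exprM i2 s2.
have inv (x y : C) : x * y = 1 -> x^-1 = y.
  move=> xy; have x0 : x != 0.
    by apply: contra_eq_neq xy => ->; rewrite mul0r eq_sym oner_eq0.
  by apply: (mulfI x0); rewrite divff// xy.
have -> : (ce (1 / 12))^-1 = ce (1 / 3) ^+ 2 * 'i :> C.
  by apply: inv; rewrite -e4 -e3 -exprM -exprD -exprS -[12%N]/(3 * 4)%N exprM e3 i4.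
have -> : (ce (1 / 12) ^+ 5)^-1 = ce (1 / 3) * 'i :> C.
  by apply: inv; rewrite -e4 -e3 -!exprD -[(5 + (4 + 3))%N]/(3 * 4)%N exprM e3 i4.
by rewrite e3 invrN1 iV triple_swap12 triple_swap23.
Qed.

Lemma weyl_table_order T k j : (T < 3)%N -> weyl_table T k j ^+ 12 = 1.
Proof.
move=> T3; have p12 (x w : C) : x ^+ 12 = 1 -> w ^+ 12 = 1 -> (x * w ^+ k) ^+ 12 = 1.
  by move=> hx hw; rewrite exprMn hx -exprM mulnC exprM hw expr1n mulr1.
have i12 : 'i ^+ 12 = 1 :> C by rewrite -[12%N]/(2 * 6)%N exprM i2 -signr_odd expr0.
have mi12 : (- 'i) ^+ 12 = 1 :> C by rewrite -[12%N]/(2 * 6)%N exprM mi2 -signr_odd expr0.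
have om12 : ce (1 / 3) ^+ 12 = 1 :> C.
  by rewrite -e4 -exprM -[(4 * 12)%N]/(3 * 16)%N exprM e3 -[16%N]/(12 + 4)%N
    exprD i12 -[4%N]/(2 * 2)%N exprM i2 s2 mul1r.
have om24 : (ce (1 / 3) ^+ 2) ^+ 12 = 1 :> C by rewrite -exprM mulnC exprM om12 expr1n.
have m12 : (-1) ^+ 12 = 1 :> C by rewrite -signr_odd expr0.
rewrite /weyl_table /triple; case: j => [[|[|[|//]]] ?] /=; apply: p12 => //;
  by case: T T3 => [|[|[|//]]] _ //=; rewrite expr1n.
Qed.

Lemma weyl_table_sum T k m : \sum_j weyl_table T k j ^+ m =
  sign_table T ^+ m * 'i ^+ (k * m)
  + (std_table1 T ^+ m + std_table2 T ^+ m) * (- 'i) ^+ (k * m).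
Proof.
have key (a b c x w : C) : \sum_j (triple (a * x ^+ k) (b * w ^+ k) (c * w ^+ k) j) ^+ m =
    a ^+ m * x ^+ (k * m) + (b ^+ m + c ^+ m) * w ^+ (k * m).
  rewrite !big_ord_recl big_ord0 addr0 /triple /= !exprMn -!exprM mulrDl.
  by [].
exact: key.
Qed.

End EigenvalueTables.

(** * Conjugacy classes of the subgroup of order 24 *)

Section UmbralClasses.
Variables (gT : finGroupType) (G H : {group gT}).
Variables (iota : {morphism (setTfor {perm 'I_3}) >-> gT}) (c : gT).
Variables (s r : {perm 'I_3}).
Hypothesis maxH : maximal_subgroup24 G H iota c.
Hypothesis transposition_s : exists i j : 'I_3, i != j /\ s = tperm i j.
Hypothesis order_r : #[r]%g = 3%N.
Local Open Scope group_scope.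

Definition sym3_repr (T : nat) : {perm 'I_3} := nth 1 [:: 1; s; r] T.

Let i1 : iota 1 = 1. Proof. exact: morph1. Qed.
Let iX x m : iota (x ^+ m) = iota x ^+ m.
Proof. by rewrite morphX ?finset.in_setT. Qed.
Let iJ x z : iota (x ^ z) = iota x ^ iota z.
Proof. by rewrite morphJ ?finset.in_setT. Qed.

Let product_H : (iota @* 'dom iota * <[c]> = H) /\ <[c]> \subset 'C(iota @* 'dom iota).
Proof. by have [_ h1 h2 _] := dprodP (ms_product maxH). Qed.

Let mem_iota x : iota x \in iota @* 'dom iota.
Proof. by apply: mem_morphim; rewrite finset.in_setT. Qed.

Let c_comm x : commute (iota x) c.
Proof.
have [_ /fintype.subsetP h] := product_H; apply/commute_sym.
by have /centP/(_ _ (mem_iota x)) := h c (cycle_id c).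
Qed.

Let iota_H x : iota x \in H.
Proof. by have [<- _] := product_H; rewrite -[iota x]mulg1 mem_mulg. Qed.

Let c4 : c ^+ 4 = 1. Proof. by rewrite -(ms_order_c maxH) expg_order. Qed.

Let decompose g : g \in H -> exists x k, (k < 4)%N /\ g = iota x * c ^+ k.
Proof.
have [<- _] := product_H; case/mulsgP => _ y /morphimP[x _ _ ->] /cyclePmin[k k4 ->] ->.
by exists x, k; rewrite -(ms_order_c maxH).
Qed.

(** Since [c] is central in [H], conjugation only moves the component in the symmetric group. *)
Let conj_class T k g : reflect (exists z, g = iota (sym3_repr T ^ z) * c ^+ k)
  (g \in (iota (sym3_repr T) * c ^+ k) ^: H).
Proof.
apply: (iffP imsetP) => [[h hH ->]|[z ->]]; last first.
  exists (iota z) => //; rewrite conjMg iJ; congr (_ * _).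
  by apply/esym/conjg_fixP/commgP/commute_sym/commuteX; exact: c_comm.
have [z [l [_ ->]]] := decompose hH; exists z.
rewrite conjgM [in X in X ^ _]conjMg -iJ.
have ck : c ^+ k ^ iota z = c ^+ k.
  by apply/conjg_fixP/commgP/commute_sym/commuteX; exact: c_comm.
rewrite ck; apply/conjg_fixP/commgP/commute_sym; apply: commuteM.
  exact/commute_sym/commuteX/c_comm.
exact/commute_sym/commuteX/commute_sym/commuteX.
Qed.

Lemma umbral_class_ofP g : g \in H -> exists T k z,
  [/\ (T < 3)%N, (k < 4)%N, g = iota (sym3_repr T ^ z) * c ^+ k &
      umbral_class_of H c (iota s) (iota r) g = class_table T k].
Proof.
move=> gH.
have cV : c^-1 = c ^+ 3 by apply/eqP; rewrite eq_invg_mul -expgS c4.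
have yE : [/\ 1 = iota (sym3_repr 0) * c ^+ 0, c ^+ 2 = iota (sym3_repr 0) * c ^+ 2,
    c = iota (sym3_repr 0) * c ^+ 1 & c^-1 = iota (sym3_repr 0) * c ^+ 3].
  by rewrite /sym3_repr /= i1 !mul1g cV.
have sE : [/\ iota s = iota (sym3_repr 1) * c ^+ 0, iota s * c = iota (sym3_repr 1) * c ^+ 1
    & iota s * c^-1 = iota (sym3_repr 1) * c ^+ 3].
  by rewrite /sym3_repr /= mulg1 cV.
have rE : iota r = iota (sym3_repr 2) * c ^+ 0 /\ iota r * c = iota (sym3_repr 2) * c ^+ 1.
  by rewrite /sym3_repr /= mulg1.
have [y0 y2 y1 y3] := yE; have [s0 s1 s3] := sE; have [r0 r1] := rE.
have pos T k : (T < 3)%N -> (k < 4)%N -> g \in (iota (sym3_repr T) * c ^+ k) ^: H ->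
    exists T' k' z, [/\ (T' < 3)%N, (k' < 4)%N, g = iota (sym3_repr T' ^ z) * c ^+ k'
      & class_table T k = class_table T' k'].
  by move=> hT hk /conj_class[z ->]; exists T, k, z.
rewrite /umbral_class_of.
case: ifP => [h|n1]; first by apply: (pos 0%N 0%N) => //; rewrite -y0.
case: ifP => [h|n2]; first by apply: (pos 0%N 2%N) => //; rewrite -y2.
case: ifP => [h|n3]; first by apply: (pos 0%N 1%N) => //; rewrite -y1.
case: ifP => [h|n4]; first by apply: (pos 0%N 3%N) => //; rewrite -y3.
case: ifP => [h|n5]; first by apply: (pos 1%N 0%N) => //; rewrite -s0.
case: ifP => [h|n6]; first by apply: (pos 1%N 2%N).
case: ifP => [h|n7]; first by apply: (pos 1%N 1%N) => //; rewrite -s1.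
case: ifP => [h|n8]; first by apply: (pos 1%N 3%N) => //; rewrite -s3.
case: ifP => [h|n9]; first by apply: (pos 2%N 0%N) => //; rewrite -r0.
case: ifP => [h|n10]; first by apply: (pos 2%N 2%N).
case: ifP => [h|n11]; first by apply: (pos 2%N 1%N) => //; rewrite -r1.
(* This is the default branch of the tests: all representatives but the 3-cycle times the inverse of
   [c] have been excluded. *)
have [x [k [k4 gE]]] := decompose gH.
have [z hz] := sym3_conjugate transposition_s order_r x.
have [T [T3 xE]] : exists T, (T < 3)%N /\ x = sym3_repr T ^ z.
  case: hz => ->; [exists 0%N|exists 1%N|exists 2%N]; split=> //.
  by rewrite /sym3_repr /= conj1g.
have gT' : g \in (iota (sym3_repr T) * c ^+ k) ^: H.
  by apply/conj_class; exists z; rewrite gE xE.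
exists T, k, z; split=> //; first by rewrite gE xE.
case: T T3 xE gT' => [|[|[|//]]] _ _; case: k k4 gE => [|[|[|[|//]]]] _ _ //.
- by rewrite -y0 n1.
- by rewrite -y1 n3.
- by rewrite -y2 n2.
- by rewrite -y3 n4.
- by rewrite -s0 n5.
- by rewrite -s1 n7.
- by rewrite n6.
- by rewrite -s3 n8.
- by rewrite -r0 n9.
- by rewrite -r1 n11.
- by rewrite n10.
Qed.

Lemma H_power x k m : (iota x * c ^+ k) ^+ m = iota (x ^+ m) * c ^+ (k * m).
Proof. by rewrite expgMn ?iX ?expgM//; apply: commuteX; exact: c_comm. Qed.

End UmbralClasses.

Section CharacterTables.
Variable R : realType.
Local Notation C := (cplx R).
Variables (s r : {perm 'I_3}).
Hypothesis transposition_s : exists i j : 'I_3, i != j /\ s = tperm i j.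
Hypothesis order_r : #[r]%g = 3%N.
Variable std : mx_representation C (setTfor {perm 'I_3}) 2.
Hypothesis irr_std : mx_irreducible std.

Let odd_pow (x : {perm 'I_3}) m : (-1) ^+ odd_perm (x ^+ m)%g = ((-1) ^+ odd_perm x) ^+ m :> C.
Proof.
elim: m => [|m IHm]; first by rewrite expg0 odd_perm1.
by rewrite expgS odd_permM signr_addb IHm exprS.
Qed.

Lemma sign_tableP T z m : (T < 3)%N ->
  (-1) ^+ odd_perm ((sym3_repr s r T ^ z) ^+ m)%g = sign_table R T ^+ m.
Proof.
move=> T3; rewrite odd_pow odd_permJ; congr (_ ^+ m).
case: T T3 => [|[|[|//]]] _; rewrite /sym3_repr /sign_table /=.
- by rewrite odd_perm1.
- by have [i [j [ij ->]]] := transposition_s; rewrite odd_tperm ij.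
have := rK order_r => /(congr1 (@odd_perm _)).
by rewrite !odd_permM odd_perm1; case: odd_perm.
Qed.

Lemma std_tableP T z m : (T < 3)%N ->
  \tr (std ((sym3_repr s r T ^ z) ^+ m)%g) = std_table1 R T ^+ m + std_table2 R T ^+ m.
Proof.
move=> T3; rewrite -conjXg std_conj_trace.
have tr1 : \tr (std 1%g) = 2 by rewrite repr_mx1 mxtrace1.
case: T T3 => [|[|[|//]]] _; rewrite /sym3_repr /std_table1 /std_table2 /=.
- by rewrite expg1n tr1 !expr1n.
- have o2 : (s ^+ 2 = 1)%g by rewrite expgS expg1 (sK transposition_s).
  rewrite expr1n -(odd_double_half m) -mul2n expgD expgM o2 expg1n mulg1.
  rewrite exprD exprM sqrrN !expr1n mulr1; case: (odd m).
    by rewrite expg1 (std_trace_s transposition_s order_r irr_std) expr1 subrr.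
  by rewrite expg0 tr1 expr0.
have hom := ce_third R; move: (ce _) hom => om hom.
have om3 : om ^+ 3 = 1 by apply/subr0_eq; rewrite -(mulr0 (om - 1)) -hom; ring.
have tr_r := std_trace_r transposition_s order_r irr_std.
have tr_r2 : \tr (std (r * r)%g) = -1.
  rewrite -(r_conj_s transposition_s order_r).
  have sV : s^-1%g = s by apply/eqP; rewrite eq_invg_mul (sK transposition_s).
  by rewrite -{1}sV -mulgA -conjgE std_conj_trace.
rewrite (divn_eq m 3) expgD [(m %/ 3 * 3)%N]mulnC expgM.
have -> : (r ^+ 3 = 1)%g by rewrite !expgS mulg1 mulgA (rK order_r).
have om6 : (om ^+ 2) ^+ 3 = 1 by rewrite -exprM mulnC exprM om3 expr1n.
rewrite expg1n mul1g (exprD om) (exprM om 3) om3 (exprD (om ^+ 2)) (exprM (om ^+ 2) 3) om6.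
rewrite !expr1n !mul1r.
have : (m %% 3 < 3)%N by rewrite ltn_mod.
case: (m %% 3)%N => [|[|[|//]]] _.
- by rewrite tr1 !expr0.
- by rewrite tr_r !expr1; apply/subr0_eq; rewrite -oppr0 -hom; ring.
rewrite expgS expg1 tr_r2 -exprM -[(2 * 2)%N]/(3 + 1)%N exprD om3 mul1r expr1.
by apply/subr0_eq; rewrite -oppr0 -hom; ring.
Qed.

End CharacterTables.

(** * Eigenvectors of a group element *)

Section RepresentationFrames.
Variables (K : numClosedFieldType) (gT : finGroupType) (H : {group gT}).
Variables (p : bool) (P : polarized_space K p) (rho : gT -> 'End(subvs_of (ps_plus P))).
Hypothesis repr_rho : is_representation H rho.

Lemma representation_frame (b : dual_bases P) g d : g \in H -> d = \dim (ps_plus P) ->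
  exists (F : polar_frame P d) (nu : 'I_d -> K) (k : nat),
  [/\ (0 < k)%N, forall j, nu j ^+ k = 1, eigen_frame F (rho g) nu,
      eigen_frame F (rho g^-1%g) (fun j => (nu j)^-1) &
      forall m, endo_trace (rho (g ^+ m)%g) = \sum_j nu j ^+ m].
Proof.
move=> gH dd; have [rho1 rhoM] := repr_rho.
pose f e := rho (g ^+ e)%g.
have fM : forall m n, f (m + n)%N = (f m \o f n)%VF.
  by move=> m n; rewrite /f expgD rhoM ?groupX.
have f0 : f 0 = \1%VF by rewrite /f expg0.
have fk : f #[g]%g = \1%VF by rewrite /f expg_order.
have [F [nu [Fnu tr]]] := eigenframe b f0 (fM 1%N) (order_gt0 g) fk dd.
pose v j := vsproj (ps_plus P) (pf_plus F j).
have v0 j : v j != 0.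
  apply/eqP => vj; have : pf_plus F j = 0 by rewrite -[LHS](vsprojK (pf_mem_plus F j)) -/(v j) vj.
  move=> e; have := pf_dual F j j; rewrite e eqxx ps_form0r => /eqP.
  by rewrite eq_sym oner_eq0.
have fnu m j : f m (v j) = nu j ^+ m *: v j.
  elim: m => [|m IHm]; first by rewrite f0 id_lfunE expr0 scale1r.
  by rewrite (fM 1%N m) comp_lfunE IHm linearZ /= Fnu scalerA exprSr.
have nuk j : nu j ^+ #[g]%g = 1.
  have := fnu #[g]%g j; rewrite fk id_lfunE => /eqP; rewrite -subr_eq0 -[X in X - _]scale1r.
  by rewrite -scalerBl scaler_eq0 (negbTE (v0 j)) orbF subr_eq0 => /eqP <-.
have nu0 j : nu j != 0.
  by apply: contra_eq_neq (nuk j) => ->; rewrite expr0n gtn_eqF ?order_gt0// eq_sym oner_eq0.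
have rg : rho g = f 1%N by rewrite /f expg1.
exists F, nu, #[g]%g; split=> //.
split=> j; first by rewrite invr_eq0.
have : (rho g^-1%g \o rho g)%VF (v j) = v j by rewrite -rhoM ?groupV// mulVg rho1 id_lfunE.
rewrite comp_lfunE rg Fnu linearZ /= -/(v j) => h.
by apply: (scalerI (nu0 j)); rewrite h scalerA divff// scale1r.
Qed.

End RepresentationFrames.

Section CharacterWeights.
Variables (R : realType) (p : bool) (d : nat).
Local Notation C := (cplx R).

Lemma state_prod_ext (w w' : fock_mode d -> C) : w =1 w' -> state_prod p w =1 state_prod p w'.
Proof.
by move=> h s; rewrite /state_prod; case: ifP => // _; apply: eq_bigr => a _.
Qed.

Lemma state_prod_removed (a0 : fock_mode d) (w : fock_mode d -> C) s :
  state_prod p (fun a => if a == a0 then 0 else w a) s =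
  if a0 \in enum_mset s then 0 else state_prod p w s.
Proof.
rewrite /state_prod; case: ifP => _; last by rewrite if_same.
case: ifP => as0; first by rewrite (big_rem a0 as0) /= eqxx mul0r.
apply: eq_big_seq => a sa; case: eqP => // e.
by rewrite -e sa in as0.
Qed.

(** Minus modes carry inverse weights; as [sg] is its own inverse, every letter nevertheless
    contributes the same sign. *)
Lemma state_prod_char (sg : C) (nu : 'I_d -> C) (y q : C) s : sg * sg = 1 -> y != 0 ->
  state_prod p (mode_weight q (fun j => sg * (nu j * y))) s =
  if state_valid p s then sg ^+ size (enum_mset s) * char_prod nu s *
    y ^ charge (enum_mset s) * q ^+ degree (enum_mset s) else 0.
Proof.
move=> sg2 y0; have sgV : sg^-1 = sg.
  have sg0 : sg != 0 by apply: contra_eq_neq sg2 => ->; rewrite mul0r eq_sym oner_eq0.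
  by apply: (mulfI sg0); rewrite divff.
rewrite /state_prod /char_prod /charge /degree; case: ifP => // _.
elim: (enum_mset s) => [|a r IHr]; first by rewrite !big_nil expr0z !mulr1.
have E : mode_weight q (fun j => sg * (nu j * y)) a =
    sg * mode_char nu a * y ^ ((-1) ^+ (~~ a.1.1)) * q ^+ mode_degree a.
  rewrite /mode_weight /mode_char /mode_degree; case: ifP => _ /=.
    by rewrite expr0 expr1z mulrA.
  by rewrite expr1 exprN1 !invfM sgV mulrA.
rewrite !big_cons IHr E /= exprS exprD (expfzDr _ _ y0).
move: (sg ^+ _) (mode_char nu a) (\prod_(x <- r) _) (y ^ _) (y ^ (\sum_(x <- r) _))
  (q ^+ _) (q ^+ (\sum_(x <- r) _)%N).
by move=> x1 x2 x3 x4 x5 x6 x7; ring.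
Qed.

End CharacterWeights.

(** * Toggling the fermionic zero mode *)

Section ZeroMode.
Local Open Scope mset_scope.
Local Notation S := (multiset (fock_mode 1)).

Definition toggle (s : S) : S :=
  if zero_mode \in enum_mset s then s `\ zero_mode else zero_mode +` s.

Let add_perm (s : S) : perm_eq (enum_mset (zero_mode +` s)) (zero_mode :: enum_mset s).
Proof. by apply/allP => a _ /=; rewrite !count_mem_mset mset1DE (eq_sym a). Qed.

Lemma toggle_add (s : S) : zero_mode \notin enum_mset s ->
  perm_eq (enum_mset (toggle s)) (zero_mode :: enum_mset s).
Proof. by move=> /negbTE h; rewrite /toggle h. Qed.

Lemma toggleP (s : S) : state_valid true s ->
  [/\ (zero_mode \in enum_mset (toggle s)) = (zero_mode \notin enum_mset s),
      state_valid true (toggle s), toggle (toggle s) = s &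
      degree (enum_mset (toggle s)) = degree (enum_mset s)].
Proof.
have key (b : S) : zero_mode \notin enum_mset b -> state_valid true b ->
    [/\ zero_mode \in enum_mset (zero_mode +` b), state_valid true (zero_mode +` b),
        (zero_mode +` b) `\ zero_mode = b &
        degree (enum_mset (zero_mode +` b)) = degree (enum_mset b)].
  move=> zb vb; have pe := add_perm b; split.
  - by rewrite (perm_mem pe) inE eqxx.
  - by rewrite /state_valid /= (perm_uniq pe) /= zb.
  - by apply/msetP => a; rewrite msetB1E mset1DE addKn.
  - by rewrite /degree (perm_big _ pe) big_cons.
move=> vs; have [zs|zs] := boolP (zero_mode \in enum_mset s); last first.
  have [h1 h2 h3 h4] := key s zs vs.
  have E : toggle s = zero_mode +` s by rewrite /toggle (negbTE zs).
  by rewrite E; split=> //; rewrite /toggle h1 h3.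
pose b := s `\ zero_mode; have sb : zero_mode +` b = s by exact: msetB1K.
have E : toggle s = b by rewrite /toggle zs.
have pe := add_perm b; rewrite sb in pe.
have : uniq (zero_mode :: enum_mset b) by rewrite -(perm_uniq pe); exact: vs.
rewrite /= => /andP[zb ub]; have [h1 h2 h3 h4] := key b zb ub.
rewrite E; split=> //; first by rewrite (negbTE zb).
- by rewrite /toggle (negbTE zb).
- by rewrite -h4 sb.
Qed.

End ZeroMode.

(** * The trace as a sum over states *)

Section TermSums.
Variable R : realType.
Local Notation C := (cplx R).
Variables y q : C.
Hypotheses (q1 : nm q < 1) (yV1 : nm y^-1 < 1) (yq1 : nm (y * q) < 1) (y0 : y != 0).

Definition char5 (nuA nuA' : 'I_1 -> C) (nuB : 'I_3 -> C) (s : state5) : C :=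
  char_prod nuA s.1.1.2 * char_prod nuA' s.1.2 * char_prod nuB s.2.

Definition size5 (s : state5) : nat :=
  (size (enum_mset s.1.1.1) + size (enum_mset s.1.1.2) + size (enum_mset s.1.2))%N.

Local Notation fermion d sg nu e :=
  (state_prod true (mode_weight q (fun j : 'I_d => sg * (nu j * y ^+ e)))).
Local Notation boson nu :=
  (state_prod false (mode_weight q (fun j : 'I_3 => 1 * (nu j * y)))).

(** The choice [sg = -1] inserts [(-1)^F], and [sg = 1] gives weights suited to counting states. The
    exponent 0 of [y] reflects that the first factor does not enter [J(0)]. *)
Definition weight5 sg nuA nuA' nuB (s : state5) : C :=
  fermion 1 sg (fun=> 1) 0 s.1.1.1 * fermion 1 sg nuA 2 s.1.1.2
  * fermion 1 sg nuA' 3 s.1.2 * boson nuB s.2.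

Lemma weight5_invalid sg nuA nuA' nuB s : ~~ valid5 s -> weight5 sg nuA nuA' nuB s = 0.
Proof.
rewrite /valid5 /weight5 /state_prod !negb_and => /orP[/orP[/orP[h|h]|h]|h];
by rewrite (negbTE h) ?mulr0 ?mul0r.
Qed.

Lemma weight5E sg nuA nuA' nuB s : sg * sg = 1 -> valid5 s ->
  weight5 sg nuA nuA' nuB s =
  sg ^+ size5 s * char5 nuA nuA' nuB s * (y ^ charge5 s / y * q ^ degree5 s).
Proof.
move=> sg2 /andP[/andP[/andP[vE vA] vA'] vB].
have ye n : y ^+ n != 0 by rewrite expf_neq0.
rewrite /weight5 !(state_prod_char _ _ _ _ sg2 (ye _)) (state_prod_char _ _ _ _ (mulr1 1) y0).
rewrite vE vA vA' vB char_prod1 expr0 exp1rz expr1n.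
have -> : y ^ charge5 s / y = (y ^+ 2) ^ charge (enum_mset s.1.1.2)
    * (y ^+ 3) ^ charge (enum_mset s.1.2) * y ^ charge (enum_mset s.2).
  rewrite /charge5 !(expfzDr _ _ y0) expr1z !exprnP !exprz_exp.
  by rewrite -!mulrA [LHS]mulrC -!mulrA mulVf// mulr1.
have -> : q ^ degree5 s = q ^+ degree (enum_mset s.1.1.1) * q ^+ degree (enum_mset s.1.1.2)
    * q ^+ degree (enum_mset s.1.2) * q ^+ degree (enum_mset s.2).
  by rewrite /degree5 -!exprD.
rewrite /size5 /char5 !exprD.
move: (sg ^+ _) (sg ^+ _) (sg ^+ _) (char_prod nuA _) (char_prod nuA' _) (char_prod nuB _).
move=> a1 a2 a3 b1 b2 b3.
move: (_ ^ _) (_ ^ _) (_ ^ _) => c1 c2 c3.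
move: (q ^+ _) (q ^+ _) (q ^+ _) (q ^+ _) => d1 d2 d3 d4.
by ring.
Qed.

Lemma fermion_sum d sg (nu : 'I_d -> C) e :
  (exists M, abs_bounded (fermion d sg nu e) M) /\
  sums_to (fermion d sg nu e) (\prod_j theta_prod q (- (sg * (nu j * y ^+ e)))).
Proof.
have := clifford_sum (fun j => - (sg * (nu j * y ^+ e))) q1.
have -> : (fun j => - - (sg * (nu j * y ^+ e))) = (fun j => sg * (nu j * y ^+ e)).
  by apply/funext => j; rewrite opprK.
by [].
Qed.

Lemma boson_sum (nu : 'I_3 -> C) : (forall j, nm (nu j) = 1) ->
  (exists M, abs_bounded (boson nu) M) /\
  sums_to (boson nu) (\prod_j theta_prod q (nu j * y))^-1.
Proof.
move=> nu1; have := @weyl_sum R 3 q (fun j => nu j * y)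
  (Num.max (nm y^-1) (nm (y * q))) q1.
have -> : (fun j : 'I_3 => 1 * (nu j * y)) = (fun j => nu j * y).
  by apply/funext => j; rewrite mul1r.
apply.
- by rewrite gt_max yV1.
- by move=> j; rewrite (invfM (nu j)) (nmM (nu j)^-1) (nmV (nu j)) nu1 invr1 mul1r le_max lexx.
- by move=> j; rewrite -mulrA (nmM (nu j)) nu1 mul1r le_max lexx orbT.
Qed.

Lemma weight5_bounded sg nuA nuA' nuB : (forall j, nm (nuB j) = 1) ->
  exists M, abs_bounded (weight5 sg nuA nuA' nuB) M.
Proof.
move=> /boson_sum[[M4 h4] _].
have [[M1 h1] _] := fermion_sum sg (fun _ : 'I_1 => 1) 0.
have [[M2 h2] _] := fermion_sum sg nuA 2.
have [[M3 h3] _] := fermion_sum sg nuA' 3.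
exists (M1 * M2 * M3 * M4).
exact: abs_bounded_prod (abs_bounded_prod (abs_bounded_prod h1 h2) h3) h4.
Qed.

Lemma weight5_sum (nuA nuA' : 'I_1 -> C) nuB : (forall j, nm (nuB j) = 1) ->
  sums_to (fun s => if zero_mode \in enum_mset s.1.1.1 then 0
                    else weight5 (-1) nuA nuA' nuB s)
    (poch q q ^+ 2 * (theta_prod q (nuA 0 * y ^+ 2) * theta_prod q (nuA' 0 * y ^+ 3)
       * (\prod_j theta_prod q (nuB j * y))^-1)).
Proof.
move=> /boson_sum[[M4 h4] s4].
have [[M1 h1] s1] := zero_mode_removed_sum q1.
have [[M2 h2] s2] := fermion_sum (-1) nuA 2.
have [[M3 h3] s3] := fermion_sum (-1) nuA' 3.
rewrite !big_ord1 !mulN1r !opprK in s2 s3.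
have s12 := sums_to_prod h1 h2 s1 s2; have h12 := abs_bounded_prod h1 h2.
have s123 := sums_to_prod h12 h3 s12 s3; have h123 := abs_bounded_prod h12 h3.
have := sums_to_prod h123 h4 s123 s4; rewrite !mulrA; apply: sums_to_ext => s /=.
rewrite state_prod_removed /weight5; case: ifP => _; first by rewrite !mul0r.
congr (_ * _ * _ * _); apply: state_prod_ext => a; rewrite /mode_weight expr0.
by rewrite !mulr1.
Qed.

End TermSums.

(** Finiteness is deduced from absolute convergence at one point, [y = 2] and [q = 1/4]. With
    trivial signs and eigenvalues the weight of a state is a positive number that depends only on
    its charge and degree. *)
Lemma fibers5 (R : realType) : exists fib : int * int -> {fset state5},
  forall i s, (s \in fib i) = valid5 s && ((charge5 s, degree5 s) == i).
Proof.
pose y : cplx R := 2; pose q : cplx R := 4^-1.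
have nm_nat n : nm (n%:R : cplx R) = n%:R.
  by apply: complexI; rewrite -normE normr_nat rmorph_nat.
have q1 : nm q < 1 by rewrite nmV nm_nat invf_lt1 ?ltr1n.
have y0 : y != 0 by rewrite pnatr_eq0.
have q0 : q != 0 by rewrite invr_eq0 pnatr_eq0.
have yV1 : nm y^-1 < 1 by rewrite nmV nm_nat invf_lt1 ?ltr1n.
have yq1 : nm (y * q) < 1 by rewrite nmM nmV !nm_nat ltr_pdivrMr ?mul1r ?ltr_nat.
have [M hM] := @weight5_bounded R y q q1 yV1 yq1 1 (fun=> 1) (fun=> 1) (fun=> 1)
  (fun=> nm1 R).
apply: (finite_fibers (c := fun i : int * int => nm (y ^ i.1 / y * q ^ i.2)) hM).
  move=> i; rewrite lt_def nm_ge0 andbT nm_eq0.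
  by rewrite !mulf_neq0 ?invr_eq0 ?expfz_neq0.
move=> s vs; rewrite (@weight5E R y q y0 1 _ _ _ s (mulr1 1) vs) /char5 !char_prod1 expr1n !mul1r.
exact: lexx.
Qed.

Lemma composite_eigenvector (K : fieldType) (W : lmodType K) (D f a a' : W -> W)
    (v : W) (k l m n : K) : linear D -> linear a -> linear a' ->
  f v = k *: v -> D v = l *: v -> a v = m *: v -> a' v = n *: v ->
  a (D (f v)) + a' (D (f v)) = (l * k * (m + n)) *: v.
Proof.
move=> DL aL a'L fv Dv av a'v.
rewrite fv (plinZ DL) Dv scalerA (plinZ aL) (plinZ a'L) av a'v -scalerDr -scalerDl scalerA.
by rewrite [k * l]mulrC.
Qed.

Lemma dim_plus (K : numFieldType) (p : bool) (P : polarized_space K p) (b : dual_bases P) :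
  \dim (ps_plus P) = db_size b.
Proof. by rewrite (size_basis (db_plus_basis b)) card_ord. Qed.

Lemma nm_root_of_unity (R : realType) (x : cplx R) k : (0 < k)%N -> x ^+ k = 1 -> nm x = 1.
Proof.
move=> k0 xk; have := congr1 (@nm R) xk; rewrite nmX nm1 => /eqP.
by rewrite pexpr_eq1 ?nm_ge0// => /eqP.
Qed.

Section TraceSum.
Variable R : realType.
Local Notation C := (cplx R).
Variables (nuA nuA' : 'I_1 -> C) (nuB : 'I_3 -> C).
Variable fib : int * int -> {fset state5}.
Hypothesis fibP : forall i s, (s \in fib i) = valid5 s && ((charge5 s, degree5 s) == i).

Let inv d (nu : 'I_d -> C) j := (nu j)^-1.

Definition eigenvalue5 (s : state5) : C :=
  (2^-1 + (charge (enum_mset s.1.1.1))%:~R) * (-1) ^+ size5 s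
  * (char5 nuA nuA' nuB s + char5 (inv nuA) (inv nuA') (inv nuB) s).

Let tog (s : state5) : state5 := (toggle s.1.1.1, s.1.1.2, s.1.2, s.2).

(** The states that differ by the fermionic zero mode of the first factor
    cancel up to the difference of their eigenvalues of [J_e(0)]. *)
Let paired (s : state5) : C := if zero_mode \in enum_mset s.1.1.1 then 0 else
  (-1) ^+ size5 s * (char5 nuA nuA' nuB s + char5 (inv nuA) (inv nuA') (inv nuB) s).

Let trace_paired i : \sum_(s <- fib i) eigenvalue5 s = \sum_(s <- fib i) paired s.
Proof.
rewrite (@toggle_sum _ _ (fib i) (fun s => zero_mode \in enum_mset s.1.1.1) tog); last first.
- move=> s; rewrite fibP => /andP[/andP[/andP[/andP[vE _] _] _] _].
  by have [-> _ _ _] := toggleP vE.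
- move=> s; rewrite !fibP => /andP[vs si].
  have /andP[/andP[/andP[vE vA] vA'] vB] := vs.
  have [_ h2 h3 h4] := toggleP vE; split; last by rewrite /tog h3; case: (s) => [[[]]].
  have -> : valid5 (tog s) by move: h2 vA vA' vB; rewrite /valid5 /tog /= => -> -> -> _.
  by have -> : degree5 (tog s) = degree5 s by rewrite /degree5 /tog /= h4.
apply: eq_big_seq => s; rewrite fibP => /andP[/andP[/andP[/andP[vE _] _] _] _].
rewrite /paired; case: ifPn => // zs.
have pe := toggle_add zs; rewrite /eigenvalue5.
(* Adding the zero mode lowers the eigenvalue of [J_e(0)] by one and reverses the sign, so the two
   contributions differ by exactly one unit. *)
have -> : charge (enum_mset (tog s).1.1.1) = charge (enum_mset s.1.1.1) - 1.
  by rewrite /charge (perm_big _ pe) big_cons addrC.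
have -> : (-1) ^+ size5 (tog s) = - (-1) ^+ size5 s :> C.
  by rewrite /size5 /= (perm_size pe) /= !addSn exprS mulN1r.
rewrite /char5 /=; move: (char_prod _ _ * _ * _) (char_prod _ _ * _ * _) => a a'.
move: ((-1) ^+ _) (charge _) => w n; rewrite rmorphB /=.
by ring.
Qed.

Variables tau z : C.
Hypotheses (t0 : 0 < complex.Im tau) (z0 : 0 < - complex.Im z).
Hypothesis zt : - complex.Im z < complex.Im tau.
Hypothesis nuB1 : forall j, nm (nuB j) = 1.

Lemma trace_sum : has_sum
  (fun mn : int * int => - (\sum_(s <- fib (mn.1, mn.2)) eigenvalue5 s)
     * (ce z ^ mn.1 * ce tau ^ mn.2))
  (twisted_value tau z (nuA 0) (nuA' 0) nuB).
Proof.
have q1 := nm_ce_lt1 t0; have yV1 := nm_yV z0; have yq1 := nm_yq zt.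
have y0 := ce_neq0 z.
have nuBV1 j : nm (inv nuB j) = 1 by rewrite /inv nmV nuB1 invr1.
have S1 := weight5_sum q1 yV1 yq1 nuA nuA' nuB1.
have S2 := weight5_sum q1 yV1 yq1 (inv nuA) (inv nuA') nuBV1.
have S := sums_toZ (- ce z) (sums_toD S1 S2).
apply: sums_to_has_sum.
have -> : twisted_value tau z (nuA 0) (nuA' 0) nuB = - ce z * (poch (ce tau) (ce tau) ^+ 2
    * (theta_prod (ce tau) (nuA 0 * ce z ^+ 2) * theta_prod (ce tau) (nuA' 0 * ce z ^+ 3)
       * (\prod_j theta_prod (ce tau) (nuB j * ce z))^-1)
  + poch (ce tau) (ce tau) ^+ 2 * (theta_prod (ce tau) (inv nuA 0 * ce z ^+ 2)
       * theta_prod (ce tau) (inv nuA' 0 * ce z ^+ 3)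
       * (\prod_j theta_prod (ce tau) (inv nuB j * ce z))^-1)).
  by rewrite -mulrDr mulNr mulrA.
(* The absolutely convergent sum over states is regrouped by charge and degree, which yields the
   coefficients of the series. *)
have F := sums_to_fibers fibP _ S; apply: sums_to_ext (F _) => [[m n]|s vs]; last first.
  by rewrite !weight5_invalid// if_same addr0 mulr0.
rewrite trace_paired mulNr mulr_suml -sumrN; apply: eq_big_seq => s.
rewrite fibP => /andP[vs /eqP[<- <-]] /=; rewrite /paired.
case: ifP => _; first by rewrite addr0 mulr0 mul0r oppr0.
have sg : -1 * -1 = 1 :> C by rewrite mulrNN mulr1.
rewrite (weight5E (ce tau) y0 nuA nuA' nuB sg vs).
rewrite (weight5E (ce tau) y0 (inv nuA) (inv nuA') (inv nuB) sg vs).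
move: (char5 _ _ _ _) (char5 _ _ _ _) ((-1) ^+ _) (ce z ^ _) (ce tau ^ _) => a a' w u v.
by move: (ce z) y0 => y y0; field.
Qed.

End TraceSum.

Local Close Scope classical_set_scope.

Theorem proposition4p4 (R : realType)
  (gT : finGroupType) (G H : {group gT})
  (iota : {morphism [set: {perm 'I_3}] >-> gT}) (c : gT) (s r : {perm 'I_3})
  (umbralG : umbral_group_A4_6 G)
  (maxH : maximal_subgroup24 G H iota c)
  (transposition_s : exists i j : 'I_3, i != j /\ s = tperm i j)
  (cycle_r : #[r]%g = 3%N)
  (std : mx_representation (cplx R) [set: {perm 'I_3}] 2)
  (irr_std : mx_irreducible std)
  (E A A' : polarized_space (cplx R) true)
  (B : polarized_space (cplx R) false)
  (dimE : \dim {: E} = 2%N) (dimA : \dim {: A} = 2%N)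
  (dimA' : \dim {: A'} = 2%N) (dimB : \dim {: B} = 6%N)
  (bE : dual_bases E) (bA : dual_bases A) (bA' : dual_bases A')
  (bB : dual_bases B)
  (vE : vertex_structure E) (vA : vertex_structure A)
  (vA' : vertex_structure A') (vB : vertex_structure B)
  (rhoA : gT -> 'End(subvs_of (ps_plus A)))
  (rhoA' : gT -> 'End(subvs_of (ps_plus A')))
  (rhoB : gT -> 'End(subvs_of (ps_plus B)))
  (reprA : is_representation H rhoA) (reprA' : is_representation H rhoA')
  (reprB : is_representation H rhoB)
  (charA : forall (x : {perm 'I_3}) (k : nat),
    endo_trace (rhoA (iota x * c ^+ k)%g) = (-1) ^+ k)
  (charA' : forall (x : {perm 'I_3}) (k : nat),
    endo_trace (rhoA' (iota x * c ^+ k)%g) = 'i ^+ k)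
  (charB : forall (x : {perm 'I_3}) (k : nat),
    endo_trace (rhoB (iota x * c ^+ k)%g) =
    (-1) ^+ odd_perm x * 'i ^+ k + \tr (std x) * (- 'i) ^+ k) :
  let Ytw := W5tw_fields vE vA vA' vB in
  let JE0 := Ytw (currentE A A' B bE) 0 in
  let J0 := Ytw (current5 E bA bA' bB) 0 in
  let L0 := Ytw (omega5 bE bA bA' bB) 1 in
  let act g : W5tw E A A' B -> W5tw E A A' B :=
    act5 (rhoA g) (rhoA' g) (rhoB g) in
  forall g : gT, g \in H ->
  exists t : int -> int -> cplx R,
    trace_series
      (fun w => let u := JE0 (fermion_sign w) in act g u + act (g^-1)%g u)
      J0 L0 t /\
    forall tau z : cplx R,
      0 < complex.Im tau -> 0 < - complex.Im z -> - complex.Im z < complex.Im tau ->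
      has_sum (fun mn : int * int => - t mn.1 mn.2 * (ce z ^ mn.1 * ce tau ^ mn.2))
        (psi5 (umbral_class_of H c (iota s) (iota r) g) tau z).
Proof.
move=> Ytw JE0 J0 L0 act g gH.
have size_of (p : bool) (P : polarized_space (cplx R) p) (b : dual_bases P) n :
    \dim {: P} = n.*2 -> db_size b = n.
  by rewrite (dual_bases_size b) => /double_inj.
have sE : db_size bE = 1%N by exact: (size_of _ _ bE 1%N dimE).
have sA : db_size bA = 1%N by exact: (size_of _ _ bA 1%N dimA).
have sA' : db_size bA' = 1%N by exact: (size_of _ _ bA' 1%N dimA').
have sB : db_size bB = 3%N by exact: (size_of _ _ bB 3%N dimB).
have dE : 1%N = \dim (ps_plus E) by rewrite (dim_plus bE).
have dA : 1%N = \dim (ps_plus A) by rewrite (dim_plus bA).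
have dA' : 1%N = \dim (ps_plus A') by rewrite (dim_plus bA').
have dB : 3%N = \dim (ps_plus B) by rewrite (dim_plus bB).
(* Every frame consists of eigenvectors of the identity; this way of obtaining one makes its index
   type ['I_1] rather than ['I_(db_size bE)]. *)
have [FE _] := @eigenframe _ _ E bE (fun=> \1%VF) erefl
  (fun _ => esym (comp_lfun1l _)) 1 1 isT erefl dE.
have [FA [nuA [kA [_ _ eA eA' trA]]]] := representation_frame reprA bA gH dA.
have [FA' [nuA' [kA' [_ _ eB eB' trA']]]] := representation_frame reprA' bA' gH dA'.
have [FB [nuB [kB [kB0 nuBk eC eC' trB]]]] := representation_frame reprB bB gH dB.
have [fib fibP] := fibers5 R.
exists (fun m n => \sum_(s <- fib (m, n)) eigenvalue5 nuA nuA' nuB s); split.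
  apply: (@diagonal_trace_series _ _ _ _ _ J0 L0 _ _ _ (eigenvalue5 nuA nuA' nuB)
    (vector5_basis FE FA FA' FB)
    (Ytw_vector_linear vE vA vA' vB _ _) (Ytw_vector_linear vE vA vA' vB _ _)
    (fun s _ => current5_vector vE vA vA' vB sA sA' sB FE FA FA' FB s)
    (fun s _ => conformal5_vector vE vA vA' vB sE sA sA' sB FE FA FA' FB s)
    _ (fun m n => fib (m, n))).
    move=> s0 _; apply: (@composite_eigenvector _ _ JE0 (@fermion_sign _ E A A' B)
      (act g) (act (g^-1)%g)).
    - exact: Ytw_vector_linear.
    - exact: act5_linear eA eB eC.
    - exact: act5_linear eA' eB' eC'.
    - exact: fermion_sign_vector.
    - exact: (currentE_vector vE vA vA' vB sE FE FA FA' FB s0).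
    - exact: act5_vector eA eB eC.
    - exact: act5_vector eA' eB' eC'.
  by move=> m n s0; rewrite fibP xpair_eqE.
move=> tau z t0 z0 zt.
have nuB1 j : nm (nuB j) = 1 by exact: nm_root_of_unity kB0 (nuBk j).
have [T [k [w [T3 k4 gE ->]]]] := umbral_class_ofP maxH transposition_s cycle_r gH.
(* On a one-dimensional space the eigenvalue is the character itself; on [ps_plus B] the characters
   of the powers of [g] only give the power sums. *)
have nuAE : nuA 0 = (-1) ^+ k.
  by have := trA 1%N; rewrite big_ord1 expr1 expg1 gE charA => ->.
have nuA'E : nuA' 0 = 'i ^+ k.
  by have := trA' 1%N; rewrite big_ord1 expr1 expg1 gE charA' => ->.
have nuBE m : \sum_j weyl_table R T k j ^+ m = \sum_j nuB j ^+ m.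
  rewrite -trB gE (H_power maxH) charB weyl_table_sum.
  by rewrite (sign_tableP R transposition_s cycle_r w m T3)
    (std_tableP transposition_s cycle_r irr_std w m T3).
rewrite (psi5_table t0 z0 zt T3 k4) -nuAE -nuA'E.
(* A common exponent: the tabulated eigenvalues are twelfth roots of unity, and [kB] is an exponent
   for those of [g]. *)
rewrite (@twisted_value_newton R tau z t0 _ _ _ nuB (12 * kB)) ?muln_gt0//.
- exact: (trace_sum nuA nuA' fibP t0 z0 zt nuB1).
- by move=> j; rewrite exprM weyl_table_order// expr1n.
- by move=> j; rewrite mulnC exprM nuBk expr1n.
Qed.
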